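(* Let $\mathcal{A}$ be a spectral algebra, $0<p_0\le1$, and $\omega$ an $(\mathcal{A},p_0)$-admissible weight. If $T=(T_k)_{k\in X}$ is an intrinsically $\mathcal{A}$-localized g-frame for $\mathcal{H}$ with g-frame operator $S_T$ and canonical dual g-frame $\widetilde T=(T_kS_T^{-1})_{k\in X}$, then for each $p\in(p_0,\infty]\cup\{0,1\}$, $$\mathcal{H}^p_\omega(\widetilde T,T)=\mathcal{H}^p_\omega(T,\widetilde T)$$ with equivalent (quasi-)norms, and $$f=\sum_{k\in X}T_k^*T_kS_T^{-1}f=\sum_{k\in X}S_T^{-1}T_k^*T_kf\qquad\text{for all } f\in\mathcal{H}^p_\omega(\widetilde T,T),$$ with unconditional convergence in $\mathcal{H}^p_\omega(\widetilde T,T)$ for $p<\infty$ (including $p=0$), and unconditional convergence in the $\sigma(\mathcal{H},\mathcal{H}^{00}(\widetilde T))$-topology in the case $p=\infty$.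
   Context: $\mathcal{H}$ is a separable Hilbert space, $X\subset\mathbb{R}^d$ is countable; a weight is a continuous function $\omega:\mathbb{R}^d\to(0,\infty)$. g-frames. $T=(T_k)_{k\in X}\subset\mathcal{B}(\mathcal{H})$ is a g-frame if $A\|f\|^2\le\sum_k\|T_kf\|^2\le B\|f\|^2$ for all $f\in\mathcal H$ and some $0<A\le B<\infty$. $S_Tf=\sum_kT_k^*T_kf$ is then bounded, positive and invertible; $\widetilde T_k=T_kS_T^{-1}$, and $f=\sum_kT_k^*\widetilde T_kf=\sum_k\widetilde T_k^*T_kf$ on $\mathcal{H}$. For a g-frame $U$: $C_{U}f=(U_kf)_{k\in X}$, $D_U(f_k)_k=\sum_kU_k^*f_k$. Sequence spaces. For $0<p\le\infty$, $\ell^p_\omega(X;\mathcal{H})$ consists of $\mathcal{H}$-valued $(f_k)_{k\in X}$ with $\|(f_k)\|_{\ell^p_\omega(X;\mathcal H)}=\|(\|f_k\|\omega(k))_k\|_{\ell^p(X)}<\infty$. $\ell^{00}(X;\mathcal{H})$ is the space of finitely supported sequences and $\ell^0_\omega(X;\mathcal{H})$ its closure in $\ell^\infty_\omega(X;\mathcal{H})$, with the $\ell^\infty_\omega$-norm. Spectral algebra. A unital Banach *-algebra $\mathcal{A}$ of $\mathcal{B}(\mathcal{H})$-valued matrices $[A_{k,l}]_{k,l\in X}$ (matrix product, involution $[A_{k,l}]^*=[A_{l,k}^*]_{k,l}$, action $(Af)_k=\sum_lA_{k,l}f_l$) such that (1) $\mathcal{A}\subseteq\mathcal{B}(\ell^2(X;\mathcal{H}))$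 via a unital *-monomorphism; (2) $A\in\mathcal{A}$ invertible in $\mathcal{B}(\ell^2(X;\mathcal{H}))$ implies $A^{-1}\in\mathcal{A}$; (3) $A\in\mathcal{A}$ and $\|B_{k,l}\|\le\|A_{k,l}\|$ for all $k,l$ imply $B\in\mathcal{A}$, $\|B\|_{\mathcal{A}}\le\|A\|_{\mathcal{A}}$. $U\sim_{\mathcal{A}}T$ means $[U_kT_l^*]_{k,l\in X}\in\mathcal{A}$; $T$ is intrinsically $\mathcal{A}$-localized if $T\sim_{\mathcal{A}}T$ (in which case $\widetilde T\sim_{\mathcal A}T$ and $\widetilde T\sim_{\mathcal A}\widetilde T$ as well, so that the spaces below are defined). A weight $\omega$ is $(\mathcal{A},p_0)$-admissible if every $A\in\mathcal{A}$ defines a bounded operator on $\ell^p_\omega(X;\mathcal{H})$ for every $p\in(p_0,\infty]\cup\{1\}$. The spaces $\mathcal{H}^p_\omega(U^d,U)$, for $(U^d,U)=(\widetilde T,T)$ or $(T,\widetilde T)$. Let $\mathcal{H}^{00}(U)=D_U(\ell^{00}(X;\mathcal{H}))$. For $p\in(p_0,\infty)\cup\{0,1\}$, $\mathcal{H}^p_\omega(U^d,U)$ is the completion of $\mathcal{H}^{00}(U)$ with respect to the (quasi-)norm $\|f\|=\|C_{U^d}f\|_{\ell^p_\omega(X;\mathcal{H})}$; $C_{U^d}$ (hence each $U^d_k$) extends by density to an isometry into $\ell^p_\omega(X;\mathcal{H})$. Equivalently it is the completion, in the same (quasi-)norm, of $V^p_\omega(U^d,U)=\{f\in\mathcal{H}:C_{U^d}f\in\ell^p_\omega(X;\mathcal{H})\}\supseteq\mathcal{H}^{00}(U)$.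 For $p=\infty$: sequences $\{f_n\},\{g_n\}$ in $\mathcal{H}$ are $(U^d,\omega)$-equivalent if $\lim_n\|U^d_k(f_n-g_n)\|=0$ for all $k\in X$ and $\sup_n\|C_{U^d}(f_n-g_n)\|_{\ell^\infty_\omega(X;\mathcal{H})}<\infty$. $\mathcal{H}^\infty_\omega(U^d,U)$ is the space of classes $f=[\{f_n\}]$ such that $U^d_kf:=\lim_nU^d_kf_n$ exists in $\mathcal{H}$ for each $k$ and $\sup_n\|C_{U^d}f_n\|_{\ell^\infty_\omega(X;\mathcal{H})}<\infty$, with norm $\sup_k\|U^d_kf\|\omega(k)$. Equality of spaces. For $p<\infty$, $\mathcal{H}^p_\omega(\widetilde T,T)=\mathcal{H}^p_\omega(T,\widetilde T)$ with equivalent norms means $V^p_\omega(\widetilde T,T)=V^p_\omega(T,\widetilde T)$ as subsets of $\mathcal{H}$ with equivalent (quasi-)norms, so that the completions are canonically identified. For $p=\infty$ it means that both spaces consist of the same equivalence classes of sequences in $\mathcal{H}$, with equivalent norms. Through this equality, $T_kS_T^{-1}f:=\widetilde T_kf$ and $T_kf$ are both defined for $f\in\mathcal{H}^p_\omega(\widetilde T,T)$. Convergence for $p=\infty$. $\sigma(\mathcal{H},\mathcal{H}^{00}(\widetilde T))$ is the locally convex topology on $\mathcal{H}$ given by the seminorms $h\mapsto|\langle g,h\rangle|$, $g\in\mathcal{H}^{00}(\widetilde T)=D_{\widetilde T}(\ell^{00}(X;\mathcal{H}))$; elements of $\mathcal{H}^\infty_\omega(\widetilde T,T)$ are viewed in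 its completion. A series $\sum_{l\in X}h_l$ with $h_l\in\mathcal{H}$ converges unconditionally to $f=[\{f_n\}]$ in this topology if for every nested sequence $F_1\subseteq F_2\subseteq\cdots$ of finite subsets with union $X$ and every $g\in\mathcal{H}^{00}(\widetilde T)$, $\lim_n\langle\sum_{l\in F_n}h_l,g\rangle=\lim_n\langle f_n,g\rangle$. As elements of $\mathcal{H}^\infty_\omega(\widetilde T,T)$, such series denote the classes of their partial sums over $F_n$. *)

(* Defs.v *)
From HB Require Import structures.
From mathcomp Require Import all_boot all_order all_algebra.
From mathcomp Require Import finmap complex.
From mathcomp Require Import all_classical all_reals all_analysis.
From mathcomp.analysis.showcase Require summability.
Import Order.TTheory GRing.Theory Num.Theory.
Import numFieldNormedType.Exports.

Set Implicit Arguments.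
Unset Strict Implicit.
Unset Printing Implicit Defensive.

Local Open Scope classical_set_scope.
Local Open Scope complex_scope.
Local Open Scope ring_scope.

(* Complex Hilbert spaces; [inner] is linear in its first argument. *)
HB.mixin Record isHilbert (R : realType) H & CompleteNormedModule R[i] H := {
  inner : {dot H for Num.conj};
  normr_inner : forall x : H, `|x| ^+ 2 = inner x x
}.

#[short(type="hilbertType")]
HB.structure Definition Hilbert (R : realType) :=
  {H of isHilbert R H & CompleteNormedModule R[i] H}.

Definition separable (T : topologicalType) : Prop :=
  exists2 D : set T, countable D & dense D.

Definition weight (R : realType) (d : nat) (w : 'rV[R]_d -> R) : Prop :=
  continuous w /\ forall x, 0 < w x.

Definition equiv_norm (R : realType) (T : Type) (D : set T)
    (n1 n2 : T -> \bar R) : Prop :=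
  exists c C : R, [/\ 0 < c, 0 < C & forall x, D x ->
    (c%:E * n1 x <= n2 x)%E /\ (n2 x <= C%:E * n1 x)%E].

Section Operators.
Context {R : realType} {H : hilbertType R}.

(* In a normed module over R[i], `|x| is a (real) element of R[i]. *)
Definition hnorm (x : H) : R := complex.Re `|x|.

Definition bounded_op (A : H -> H) : Prop :=
  linear A /\ exists C : R, forall x, hnorm (A x) <= C * hnorm x.

Definition opnorm (A : H -> H) : R :=
  sup [set hnorm (A x) | x in [set x | hnorm x <= 1]].

(* For a bounded operator the vector z below exists and is unique (Riesz). *)
Definition adj (A : H -> H) (y : H) : H :=
  xget 0 [set z | forall x, inner (A x) y = inner x z].

End Operators.

Section Sequences.
Context {R : realType} {H : hilbertType R} {I : choiceType}.
Implicit Types (p : \bar R) (w : I -> R) (c : I -> H) (A B : I -> I -> H -> H).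

(* Unconditional sums: limits along the filter of finite subsets of I. *)
Definition usummable (h : I -> H) : Prop :=
  cvg (summability.partial_sum h @ summability.totally).

Definition usum (h : I -> H) : H := summability.sum h.

(* The value p = 0 stands for the l^0 space, which carries the l^oo norm. The
   point 0 is added to the supremum only so that it is 0 when I is empty. *)
Definition ellnorm p w c : \bar R :=
  let supnorm := ereal_sup (0%E |` [set (hnorm (c k) * w k)%:E | k in setT]) in
  match p with
  | r%:E => if r == 0 then supnorm else
      poweR (\esum_(k in [set: I]) ((hnorm (c k) * w k) `^ r)%:E) r^-1
  | _ => supnorm
  end.

Definition ell00 : set (I -> H) := [set c | finite_set [set k | c k != 0]].

Definition ell p w : set (I -> H) :=
  if p == 0%E then
    [set c | (ellnorm +oo w c < +oo)%E /\
       forall e : R, 0 < e ->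
         exists2 g, ell00 g & (ellnorm +oo w (c - g)%R < e%:E)%E]
  else [set c | (ellnorm p w c < +oo)%E].

Definition ell_bounded p w (L : (I -> H) -> (I -> H)) : Prop :=
  [/\ forall c, ell p w c -> ell p w (L c),
      forall (a : R[i]) c c', ell p w c -> ell p w c' ->
        L (a *: c + c') = a *: L c + L c'
    & exists C : R, forall c, ell p w c ->
        (ellnorm p w (L c) <= C%:E * ellnorm p w c)%E].

Definition mxapp A c : I -> H := fun k => usum (fun l => A k l (c l)).

Definition mxmul A B : I -> I -> H -> H :=
  fun k l x => usum (fun j => A k j (B j l x)).

Definition mxone : I -> I -> H -> H := fun k l x => if k == l then x else 0.

Definition mxadj A : I -> I -> H -> H := fun k l => adj (A l k).

Definition mx_acts p w A : Prop :=
  (forall c, ell p w c -> forall k, usummable (fun l => A k l (c l))) /\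
  ell_bounded p w (mxapp A).

Definition ell2 : set (I -> H) := ell 2%:E (fun=> 1).

Definition ell2_inner (c c' : I -> H) : R[i] :=
  summability.sum (fun k => inner (c k) (c' k) : R[i]^o).

(* The involution is not required to be isometric, nor the unit to have
   norm 1. *)
Record spectral_algebra (AA : set (I -> I -> H -> H))
    (nA : (I -> I -> H -> H) -> R) : Prop := SpectralAlgebra {
  sa_entries : forall A, AA A -> forall k l, bounded_op (A k l);
  sa_one : AA mxone;
  sa_lin : forall (a : R[i]) A B, AA A -> AA B -> AA (a *: A + B);
  sa_mul : forall A B, AA A -> AA B -> AA (mxmul A B);
  sa_adj : forall A, AA A -> AA (mxadj A);
  sa_norm_ge0 : forall A, AA A -> 0 <= nA A;
  sa_norm_eq0 : forall A, AA A -> nA A = 0 -> A = 0;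
  sa_normZ : forall (a : R[i]) A, AA A -> nA (a *: A) = complex.Re `|a| * nA A;
  sa_normD : forall A B, AA A -> AA B -> nA (A + B) <= nA A + nA B;
  sa_normM : forall A B, AA A -> AA B -> nA (mxmul A B) <= nA A * nA B;
  sa_complete : forall A_ : nat -> I -> I -> H -> H, (forall n, AA (A_ n)) ->
    (forall e : R, 0 < e -> exists N, forall m n,
       (N <= m)%N -> (N <= n)%N -> nA (A_ m - A_ n) < e) ->
    exists2 A, AA A & nA (A_ n - A) @[n --> \oo] --> (0 : R);
  (* A |-> mxapp A is a unital *-monomorphism into B(l^2(I; H)) *)
  sa_ell2 : forall A, AA A -> mx_acts 2%:E (fun=> 1) A;
  sa_ell2_one : forall c, ell2 c -> mxapp mxone c = c;
  sa_ell2_lin : forall (a : R[i]) A B, AA A -> AA B -> forall c, ell2 c ->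
    mxapp (a *: A + B) c = a *: mxapp A c + mxapp B c;
  sa_ell2_mul : forall A B, AA A -> AA B -> forall c, ell2 c ->
    mxapp (mxmul A B) c = mxapp A (mxapp B c);
  sa_ell2_adj : forall A, AA A -> forall c c', ell2 c -> ell2 c' ->
    ell2_inner (mxapp A c) c' = ell2_inner c (mxapp (mxadj A) c');
  sa_ell2_inj : forall A B, AA A -> AA B ->
    (forall c, ell2 c -> mxapp A c = mxapp B c) -> A = B;
  (* closedness under inversion in B(l^2(I; H)) *)
  sa_inv : forall A L, AA A -> ell_bounded 2%:E (fun=> 1) L ->
    (forall c, ell2 c -> L (mxapp A c) = c /\ mxapp A (L c) = c) ->
    exists2 B, AA B & forall c, ell2 c -> mxapp B c = L c;
  sa_solid : forall A B, AA A -> (forall k l, bounded_op (B k l)) ->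
    (forall k l, opnorm (B k l) <= opnorm (A k l)) ->
    AA B /\ nA B <= nA A
}.

Definition admissible (AA : set (I -> I -> H -> H)) (p0 : R) w : Prop :=
  forall A, AA A -> forall p, (p0%:E < p)%E \/ p = 1%E -> mx_acts p w A.

End Sequences.

Section Frames.
Context {R : realType} {H : hilbertType R} {I : choiceType}.
Implicit Types (T U : I -> H -> H).

Definition gframe T : Prop :=
  (forall k, bounded_op (T k)) /\
  exists A B : R, [/\ 0 < A, A <= B & forall f : H,
    ((A * hnorm f ^+ 2)%:E <= \esum_(k in [set: I]) (hnorm (T k f) ^+ 2)%:E)%E /\
    (\esum_(k in [set: I]) (hnorm (T k f) ^+ 2)%:E <= (B * hnorm f ^+ 2)%:E)%E].

Definition frame_op T (f : H) : H := usum (fun k => adj (T k) (T k f)).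

(* S_T^{-1}: for a g-frame, [frame_op T] is bijective. *)
Definition frame_inv T (f : H) : H := xget 0 [set g | frame_op T g = f].

Definition dual T : I -> H -> H := fun k f => T k (frame_inv T f).

Definition localized (AA : set (I -> I -> H -> H)) U T : Prop :=
  AA (fun k l f => U k (adj (T l) f)).

Definition analysis U (f : H) : I -> H := fun k => U k f.

Definition synthesis U (c : I -> H) : H := usum (fun k => adj (U k) (c k)).

Definition H00 U : set H := synthesis U @` ell00.

End Frames.

(* The spaces H^p_w(Ud, U). All of them are sets of classes of sequences in H:
   a class is represented by the set of all sequences belonging to it. *)
Section Coorbit.
Context {R : realType} {H : hilbertType R} {I : choiceType}.
Implicit Types (p : \bar R) (w : I -> R) (Ud U : I -> H -> H).
Implicit Types (u v : nat -> H) (f : set (nat -> H)).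

Definition Vnorm p w Ud (x : H) : \bar R := ellnorm p w (analysis Ud x).

Definition V p w Ud : set H := [set x | ell p w (analysis Ud x)].

Definition cauchyV p w Ud u : Prop :=
  (forall n, V p w Ud (u n)) /\
  forall e : R, 0 < e -> exists N, forall m n,
    (N <= m)%N -> (N <= n)%N -> (Vnorm p w Ud (u m - u n)%R < e%:E)%E.

Definition class_fin p w Ud u : set (nat -> H) :=
  [set v | cauchyV p w Ud v /\ Vnorm p w Ud (u n - v n)%R @[n --> \oo] --> 0%E].

(* p < oo: the classes of Cauchy sequences of V p w Ud which contain a Cauchy
   sequence of H00 U, i.e. the closure of H00 U in the completion of V p w Ud.
   This is the completion of H00 U, realized in such a way that H^p_w(Ud, U)
   and H^p_w(U, Ud) become literally comparable sets. *)
Definition coorbit_fin p w Ud U : set (set (nat -> H)) :=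
  [set f | exists u, [/\ cauchyV p w Ud u, forall n, H00 U (u n)
                       & f = class_fin p w Ud u]].

Definition bounded_seq w Ud u : Prop :=
  (ereal_sup (range (fun n => Vnorm +oo w Ud (u n))) < +oo)%E.

Definition class_infty w Ud u : set (nat -> H) :=
  [set v | (forall k, Ud k (u n - v n) @[n --> \oo] --> (0 : H)) /\
           bounded_seq w Ud (fun n => u n - v n)].

Definition coorbit_infty w Ud : set (set (nat -> H)) :=
  [set f | exists u, [/\ forall k, cvg (Ud k (u n) @[n --> \oo]),
                         bounded_seq w Ud u & f = class_infty w Ud u]].

Definition coorbit p w Ud U : set (set (nat -> H)) :=
  if p == +oo%E then coorbit_infty w Ud else coorbit_fin p w Ud U.

(* The extension of an operator A of H to a class: the common limit of (A u_n)
   over all representatives u. *)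
Definition ext (A : H -> H) f : H :=
  xget 0 [set h | forall u, f u -> A (u n) @[n --> \oo] --> h].

Definition coorbit_norm p w Ud f : \bar R :=
  if p == +oo%E then ellnorm +oo w (fun k => ext (Ud k) f)
  else xget 0%E
    [set r | forall u, f u -> Vnorm p w Ud (u n) @[n --> \oo] --> r].

Definition coorbit_eq p w (U1 U2 : I -> H -> H) : Prop :=
  (p != +oo%E -> V p w U1 = V p w U2 /\
     equiv_norm (V p w U1) (Vnorm p w U1) (Vnorm p w U2)) /\
  coorbit p w U1 U2 = coorbit p w U2 U1 /\
  equiv_norm (coorbit p w U1 U2) (coorbit_norm p w U1) (coorbit_norm p w U2).

(* The difference of the class f and the class of the constant sequence h. *)
Definition class_sub f (h : H) : set (nat -> H) :=
  [set (fun n => u n - h) | u in f].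

Definition ucvg_fin p w Ud (h : I -> H) f : Prop :=
  (forall k, V p w Ud (h k)) /\
  coorbit_norm p w Ud (class_sub f (summability.partial_sum h F))
    @[F --> summability.totally] --> 0%E.

Definition exhausting (F : nat -> {fset I}) : Prop :=
  (forall n, (F n `<=` F n.+1)%fset) /\ forall k, exists n, k \in F n.

(* p = oo: convergence in sigma(H, H00 Ud); in addition the partial sums form a
   representative of f, so that f is the sum as an element of the space. *)
Definition ucvg_infty Ud (h : I -> H) f : Prop :=
  forall F, exhausting F ->
    f (fun n => summability.partial_sum h (F n)) /\
    forall g u, H00 Ud g -> f u -> exists z : R[i]^o,
      (inner (summability.partial_sum h (F n)) g : R[i]^o) @[n --> \oo] --> z /\
      (inner (u n) g : R[i]^o) @[n --> \oo] --> z.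

Definition ucvg p w Ud (h : I -> H) f : Prop :=
  if p == +oo%E then ucvg_infty Ud h f else ucvg_fin p w Ud h f.

End Coorbit.

(* Main.v *)
Require Import Defs.
From mathcomp Require Import all_boot all_order all_algebra.
From mathcomp Require Import finmap complex.
From mathcomp Require Import all_classical all_reals all_analysis.
From mathcomp Require Import ring lra zify.
Import Order.TTheory GRing.Theory Num.Theory.
Import numFieldNormedType.Exports.

Set Implicit Arguments.
Unset Strict Implicit.
Unset Printing Implicit Defensive.

Local Open Scope classical_set_scope.
Local Open Scope ring_scope.

#[local] Existing Instance summability.totally_filter.

(** Let G = [T_k T_l^*] be the Gram matrix of T and S its g-frame operator. The
    cross Gram matrices of T and its canonical dual are [T_k S^-1 T_l^*] and
    [T_k S^-2 T_l^*], the range projection P and the pseudo-inverse of G, and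
    everything follows once both lie in the spectral algebra.

    For P, choose c > 0 such that the spectrum of a = c G lies in {0} and
    (1, oo). Then 1 - u a is invertible in B(l^2), hence in the algebra, for all
    |u| = 1; the algebra norm of (1 - u a)^-1 is bounded on the circle by
    compactness, so that u |-> (1 - u a)^-1 is Lipschitz there. The identity
    2 (1 - x^2)^-1 = (1 - x)^-1 + (1 + x)^-1 transfers this to
    (1 - u a^(2^n))^-1, with Lipschitz constants that decay geometrically, so
    (1 - a^(2^n))^-1 is Cauchy in the algebra. Solidity makes matrix entries
    continuous for the algebra norm, and the entries converge to those of
    1 - P. The pseudo-inverse is then (1 - P + G)^-1 - (1 - P).

    By admissibility these matrices act on l^p_w, which gives T f = G (T~ f),
    T~ f = [T_k S^-2 T_l^*] (T f) and T~ f = P (T~ f) with bounds, on H and, by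
    passing to limits of coefficient sequences, on the coorbit spaces. Both
    expansions converge because the truncations of a sequence in l^p_w converge
    to it when p < oo, and by dominated convergence, row by row, when p = oo:
    by solidity the rows of these matrices are absolutely summable against
    w^-1. *)

(** * Real-valued modulus on [R[i]] *)

Section ComplexModulus.
Variable R : realType.
Implicit Types a b z : R[i].

(** The obstacle is that G is in general not invertible on l^2: it vanishes on the kernel of D_T, so
    closedness under inversion cannot be applied to G itself. What is needed is the Riesz projection
    of a = c G at 0, the mean of (1 - u a)^-1 over |u| = 1. Unfolding the doubling identity shows
    that (1 - a^(2^n))^-1 is the average of (1 - u a)^-1 over the 2^n-th roots of unity u, a Riemann
    sum of this mean, so that no integral in the algebra has to be formed.

    Nothing is inverted on l^2 directly. With G = C_T D_T and S = D_T C_T, all matrices involved are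
    C_T Y D_T or 1 + C_T Y D_T with Y in B(H), and their products are governed by Y and S alone. The
    inverses come from operators on H, by Lax-Milgram.

    For p < 1 there is only a quasi-norm. Its triangle inequality is used with the constant 1 + e on
    one summand and a large one on the other, which makes the norm continuous and treats all
    exponents alike. On the coorbit side a class is identified with the limit c of its coefficient
    sequences, so that statements about the spaces become statements about sequences c with c = P
    c. *)

Definition cabs a : R := complex.Re `|a|.

Lemma cabsE a : (cabs a)%:C%C = `|a|.
Proof. by rewrite /cabs RRe_real // ger0_real. Qed.

Lemma cabs_ge0 a : 0 <= cabs a.
Proof. by rewrite -ler0c cabsE. Qed.

Lemma cabsM a b : cabs (a * b) = cabs a * cabs b.
Proof. by apply: complexI; rewrite rmorphM /= !cabsE normrM. Qed.

Lemma cabsD a b : cabs (a + b) <= cabs a + cabs b.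
Proof. by rewrite -lecR rmorphD /= !cabsE ler_normD. Qed.

Lemma cabsN a : cabs (- a) = cabs a.
Proof. by rewrite /cabs normrN. Qed.

Lemma cabs0 : cabs 0 = 0.
Proof. by rewrite /cabs normr0. Qed.

Lemma cabs1 : cabs 1 = 1.
Proof. by rewrite /cabs normr1. Qed.

Lemma cabs_real (r : R) : cabs r%:C%C = `|r|.
Proof. by apply: complexI; rewrite cabsE normc_def /= expr0n addr0 sqrtr_sqr. Qed.

Lemma cabs_sqr a : cabs a ^+ 2 = complex.Re a ^+ 2 + complex.Im a ^+ 2.
Proof. by apply: complexI; rewrite rmorphXn /= cabsE -add_Re2_Im2. Qed.

Lemma normRe_le_cabs a : `|complex.Re a| <= cabs a.
Proof. by rewrite -lecR cabsE normc_ge_Re. Qed.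

Lemma Re_le_cabs a : complex.Re a <= cabs a.
Proof. exact: le_trans (ler_norm _) (normRe_le_cabs a). Qed.

Lemma ReD a b : complex.Re (a + b) = complex.Re a + complex.Re b.
Proof. by case: a => ? ?; case: b. Qed.

Lemma ReN a : complex.Re (- a) = - complex.Re a.
Proof. by case: a. Qed.

Lemma Re_realM (r : R) a : complex.Re (r%:C%C * a) = r * complex.Re a.
Proof. by case: a => x y /=; rewrite mul0r subr0. Qed.

Lemma Re_conjC a : complex.Re (Num.conj a) = complex.Re a.
Proof.
have -> : Num.conj a = conjc a by [].
by case: a.
Qed.

End ComplexModulus.

(** * Real-valued norm and inner product of a Hilbert space *)

Section HilbertNorm.
Context {R : realType} {H : hilbertType R}.
Implicit Types (x y z : H) (a : R[i]).

Lemma hnormE x : (hnorm x)%:C%C = `|x|.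
Proof. by rewrite /hnorm RRe_real // ger0_real. Qed.

Lemma hnorm_ge0 x : 0 <= hnorm x.
Proof. by rewrite -ler0c hnormE. Qed.

Lemma hnormZ a x : hnorm (a *: x) = cabs a * hnorm x.
Proof. by apply: complexI; rewrite rmorphM /= cabsE !hnormE normrZ. Qed.

Lemma ler_hnormD x y : hnorm (x + y) <= hnorm x + hnorm y.
Proof. by rewrite -lecR rmorphD /= !hnormE ler_normD. Qed.

Lemma hnormNE x : hnorm (- x) = hnorm x.
Proof. by rewrite /hnorm normrN. Qed.

Lemma hnorm0 : hnorm (0 : H) = 0.
Proof. by rewrite /hnorm normr0. Qed.

Lemma hnorm_eq0 x : (hnorm x == 0) = (x == 0).
Proof. by rewrite -(normr_eq0 x) -hnormE -(inj_eq (@complexI R)). Qed.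

Lemma hnorm_distC x y : hnorm (x - y) = hnorm (y - x).
Proof. by rewrite -hnormNE opprB. Qed.

Lemma ler_hnormB x y : hnorm (x - y) <= hnorm x + hnorm y.
Proof. by rewrite -(hnormNE y) ler_hnormD. Qed.

Lemma hnorm_triB z x y : hnorm (x - y) <= hnorm (x - z) + hnorm (z - y).
Proof. by rewrite -[x - y](subrKA z) ler_hnormD. Qed.

Lemma hnorm_le_sub x y : hnorm x <= hnorm y + hnorm (x - y).
Proof. by rewrite -{1}[x](addrNK y) addrC ler_hnormD. Qed.

Lemma ler_hnorm_sum (I : Type) (r : seq I) (P : pred I) (F : I -> H) :
  hnorm (\sum_(i <- r | P i) F i) <= \sum_(i <- r | P i) hnorm (F i).
Proof.
elim/big_ind2 : _ => [|x a y b xa yb|//]; first by rewrite hnorm0.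
exact: le_trans (ler_hnormD _ _) (lerD xa yb).
Qed.

Lemma innerDl x y z : inner (x + y) z = inner x z + inner y z.
Proof. by rewrite linearDl. Qed.

Lemma innerDr x y z : inner x (y + z) = inner x y + inner x z.
Proof. by rewrite linearDr. Qed.

Lemma innerBr x y z : inner x (y - z) = inner x y - inner x z.
Proof. by rewrite linearBr. Qed.

Lemma innerBl x y z : inner (x - y) z = inner x z - inner y z.
Proof. by rewrite linearBl. Qed.

Lemma innerZl a x y : inner (a *: x) y = a * inner x y.
Proof. by rewrite linearZl_LR. Qed.

Lemma innerZr a x y : inner x (a *: y) = Num.conj a * inner x y.
Proof. by rewrite linearZr_LR. Qed.

Lemma inner0l x : inner 0 x = 0 :> R[i].
Proof. by rewrite linear0l. Qed.

Lemma inner0r x : inner x 0 = 0 :> R[i].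
Proof. by rewrite linear0r. Qed.

Lemma innerC x y : inner x y = Num.conj (inner y x) :> R[i].
Proof. by rewrite hermC /= expr0 mul1r. Qed.

Lemma inner_real x : inner x x = (hnorm x ^+ 2)%:C%C.
Proof.
by rewrite rmorphXn /= hnormE; exact: esym (normr_inner x).
Qed.

Lemma hnorm_sqr x : hnorm x ^+ 2 = complex.Re (inner x x).
Proof. by rewrite inner_real. Qed.

Lemma inner_eqr x y : (forall z, inner z x = inner z y :> R[i]) -> x = y.
Proof.
move=> h; apply/eqP; rewrite -subr_eq0 -hnorm_eq0 -sqrf_eq0 hnorm_sqr innerBr.
by rewrite h subrr.
Qed.

Lemma hnormD_sqr x y :
  hnorm (x + y) ^+ 2 = hnorm x ^+ 2 + 2 * complex.Re (inner x y) + hnorm y ^+ 2.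
Proof.
rewrite !hnorm_sqr !innerDl !innerDr !ReD [inner y x]innerC Re_conjC.
ring.
Qed.

Lemma hnormB_sqr x y :
  hnorm (x - y) ^+ 2 = hnorm x ^+ 2 - 2 * complex.Re (inner x y) + hnorm y ^+ 2.
Proof. by rewrite hnormD_sqr hnormNE linearNr ReN; ring. Qed.

Lemma Re_inner_le x y : complex.Re (inner x y) <= hnorm x * hnorm y.
Proof.
have [->|x0] := eqVneq x 0; first by rewrite inner0l hnorm0 mul0r.
have [->|y0] := eqVneq y 0; first by rewrite inner0r hnorm0 mulr0.
have nx : 0 < hnorm x by rewrite lt_def hnorm_eq0 x0 hnorm_ge0.
have ny : 0 < hnorm y by rewrite lt_def hnorm_eq0 y0 hnorm_ge0.
(* The square expands to 2 |x| |y| (|x| |y| - Re <x, y>). *)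
have := sqr_ge0 (hnorm ((hnorm y)%:C%C *: x - (hnorm x)%:C%C *: y)).
rewrite hnormB_sqr !hnormZ !cabs_real innerZl innerZr.
have -> : Num.conj ((hnorm x)%:C%C) = ((hnorm x)%:C%C : R[i]).
  by apply: conj_Creal; rewrite complex_real.
rewrite !Re_realM !ger0_norm ?hnorm_ge0 // => h.
have : 0 <= 2 * (hnorm x * hnorm y) * (hnorm x * hnorm y - complex.Re (inner x y)).
  by move: h; congr (0 <= _); ring.
by rewrite pmulr_rge0 ?subr_ge0 // !mulr_gt0.
Qed.

Lemma inner_le x y : cabs (inner x y) <= hnorm x * hnorm y.
Proof.
have [e0|e0] := eqVneq (inner x y) 0.
  by rewrite e0 cabs0 mulr_ge0 // hnorm_ge0.
(* [u] is the phase that makes [u * inner x y] equal to its modulus, which reduces the claim to the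
   bound on real parts. *)
pose u := Num.conj (inner x y) / `|inner x y|.
have n0 : `|inner x y| != 0 by rewrite normr_eq0.
have hu : u * inner x y = `|inner x y|.
  by rewrite /u mulrAC [_ * inner x y]mulrC -normCK expr2 mulfK.
have nu : cabs u = 1.
  by rewrite /cabs normrM norm_conjC normfV normr_id divff.
by have := Re_inner_le (u *: x) y; rewrite innerZl hu hnormZ nu mul1r.
Qed.

Lemma Re_inner_ge x y : - (hnorm x * hnorm y) <= complex.Re (inner x y).
Proof. by rewrite lerNl -(hnormNE x) -ReN -linearNl Re_inner_le. Qed.

Lemma hnorm_le_dual x (C : R) : 0 <= C ->
  (forall y, complex.Re (inner x y) <= C * hnorm y) -> hnorm x <= C.
Proof.
move=> C0 /(_ x); rewrite -hnorm_sqr expr2.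
have [->|x0] := eqVneq x 0; first by rewrite hnorm0.
by rewrite ler_pM2r // lt_def hnorm_eq0 x0 hnorm_ge0.
Qed.

(** The norm of [H] takes its values in [R[i]]; a positive element of [R[i]] is real, so real [e]
    suffice. *)
Lemma cvg_hnormP (T : Type) (F : set_system T) {FF : Filter F} (f : T -> H) (l : H) :
  f @ F --> l <-> forall e : R, 0 < e -> \forall t \near F, hnorm (l - f t) < e.
Proof.
rewrite cvgrPdist_lt; split=> h e e0.
  have /h : 0 < e%:C%C by rewrite ltcR.
  by apply: filterS => t; rewrite -hnormE ltcR.
have er : e \is Num.real by exact: gtr0_real.
have : 0 < complex.Re e by rewrite -ltcR RRe_real.
move/h; apply: filterS => t.
by rewrite -ltcR hnormE RRe_real.
Qed.

Lemma cauchy_hnorm_cvg (T : Type) (F : set_system T) {FF : ProperFilter F}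
    (f : T -> H) :
  (forall e : R, 0 < e -> exists2 A, F A &
     forall s t, A s -> A t -> hnorm (f s - f t) < e) ->
  cvg (f @ F).
Proof.
move=> h; apply/cauchy_cvgP; apply/cauchy_ballP => e e0.
have er : e \is Num.real by exact: gtr0_real.
have /h[A FA hA] : 0 < complex.Re e by rewrite -ltcR RRe_real.
have Ff : F (f @^-1` (f @` A)) by apply: filterS FA => t At; exists t.
exists (f @` A, f @` A); first by split.
move=> [_ _] [/= [s As <-] [t At <-]].
by rewrite -ball_normE /= -hnormE -[e]RRe_real // ltcR; exact: hA.
Qed.

Lemma cvg_hnorm_unique (T : Type) (F : set_system T) {FF : ProperFilter F}
    (f : T -> H) (l l' : H) : f @ F --> l -> f @ F --> l' -> l = l'.
Proof. by move=> h h'; apply: (cvg_unique _ h h'); exact: norm_hausdorff. Qed.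

Lemma hnorm_cvg_le (T : Type) (F : set_system T) {FF : ProperFilter F}
    (f : T -> H) (l x : H) (M : R) :
  f @ F --> l -> (\forall t \near F, hnorm (f t - x) <= M) -> hnorm (l - x) <= M.
Proof.
move=> /cvg_hnormP h b; apply/ler_addgt0Pr => e e0.
have [t [ht bt]] := filter_ex (filterI (h _ e0) b).
by rewrite [M + e]addrC (le_trans (hnorm_triB (f t) _ _)) // lerD // ltW.
Qed.

End HilbertNorm.

(** * Riesz representation *)

Section Riesz.
Context {R : realType} {H : hilbertType R}.

Lemma le0_of_small (x K : R) : (forall e : R, 0 < e -> x <= e * K) -> x <= 0.
Proof.
move=> h; rewrite leNgt; apply/negP => x0.
have K0 : 0 < K.
  have := h 1 ltr01; rewrite mul1r; exact: lt_le_trans.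
have := h (x / (2 * K)); rewrite divr_gt0 ?mulr_gt0 // => /(_ isT).
have -> : x / (2 * K) * K = x / 2 by field; exact: lt0r_neq0.
by rewrite leNgt; apply/negP; rewrite negbK; lra.
Qed.

(* Minimize |x|^2 - 2 Re l(x): the parallelogram identity makes minimizing
   sequences Cauchy. *)
Lemma riesz (l : H -> R[i]) (C : R) :
  (forall a x y, l (a *: x + y) = a * l x + l y) ->
  (forall x, cabs (l x) <= C * hnorm x) ->
  exists z, forall x, l x = inner x z.
Proof.
move=> ll lb.
have lZ a x : l (a *: x) = a * l x.
  have l0 : l 0 = 0 by have := ll (-1) 0 0; rewrite scaler0 addr0 mulN1r addNr.
  by have := ll a x 0; rewrite !addr0 l0 addr0.
have lD x y : l (x + y) = l x + l y by rewrite -[x]scale1r ll mul1r scale1r.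
pose J x := hnorm x ^+ 2 - 2 * complex.Re (l x).
have Jlb x : - C ^+ 2 <= J x.
  have h1 : complex.Re (l x) <= C * hnorm x := le_trans (Re_le_cabs _) (lb x).
  have := sqr_ge0 (hnorm x - C); rewrite /J; nra.
have Jhi : has_inf (range J).
  by split; [exists (J 0), 0 | exists (- C ^+ 2) => _ [x _ <-]].
set m := inf (range J).
have mJ x : m <= J x by apply: ge_inf; [exact: Jhi.2|exists x].
have half x y : hnorm (x - y) ^+ 2 <= 2 * J x + 2 * J y - 4 * m.
  have := mJ ((2^-1)%:C%C *: (x + y)).
  rewrite /J hnormZ lZ Re_realM cabs_real exprMn lD ReD hnormD_sqr hnormB_sqr.
  rewrite ger0_norm ?invr_ge0 //; lra.
have /choice[u hu] : forall n : nat, exists x, J x < m + n.+1%:R^-1.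
  move=> n; have n0 : 0 < (n.+1%:R^-1 : R) by [].
  by have [_ [x _ <-] h] := inf_adherent n0 Jhi; exists x.
have ucv : cvg (u @ \oo).
  apply: cauchy_hnorm_cvg => e e0.
  exists [set n | n.+1%:R^-1 < e ^+ 2 / 4].
    apply: near_infty_natSinv_lt (PosNum _) => //; by rewrite divr_gt0 // exprn_gt0.
  move=> s t /= hs ht; have hsq : hnorm (u s - u t) ^+ 2 < e ^+ 2.
    apply: le_lt_trans (half _ _) _.
    have := hu s; have := hu t; move: hs ht.
    move: (s.+1%:R^-1) (t.+1%:R^-1) (J (u s)) (J (u t)) => a b c d; lra.
  by rewrite -(ltr_pXn2r (n := 2)) // ?nnegrE ?hnorm_ge0 // ltW.
set z := lim (u @ \oo).
(* This is J (z + v) - J z >= 0, obtained along the minimizing sequence, so that [J] is never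
   evaluated at its limit [z]. *)
have key v : 0 <= hnorm v ^+ 2 + 2 * (complex.Re (inner v z) - complex.Re (l v)).
  rewrite -oppr_le0; apply: (@le0_of_small _ (1 + 2 * hnorm v)) => e e0.
  have /cvg_hnormP/(_ _ e0) h1 := ucv.
  have h2 : \forall n \near \oo, n.+1%:R^-1 < e :> R.
    exact: near_infty_natSinv_lt (PosNum e0).
  have [n [hn1 hn2]] := filter_ex (filterI h1 h2).
  have := mJ (u n + v); have := hu n.
  rewrite /J hnormD_sqr lD ReD [inner (u n) v]innerC Re_conjC.
  have -> : inner v (u n) = inner v z - inner v (z - u n).
    by rewrite innerBr opprB addrC subrK.
  rewrite ReD ReN.
  have := Re_inner_ge v (z - u n); have : 0 <= hnorm v * (e - hnorm (z - u n)).
    by rewrite mulr_ge0 ?hnorm_ge0 // subr_ge0 ltW.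
  move: hn2; move: (n.+1%:R^-1) (complex.Re (inner v z)) => a b.
  move: (complex.Re (inner v (z - u n))) (hnorm (z - u n)) => c d.
  move: (complex.Re (l (u n))) (complex.Re (l v)) (hnorm (u n)) => f g q.
  lra.
have Rekey v : complex.Re (inner v z) = complex.Re (l v).
  have t0 (t : R) : 0 <= t ^+ 2 * hnorm v ^+ 2
      + 2 * t * (complex.Re (inner v z) - complex.Re (l v)).
    have := key (t%:C%C *: v).
    by rewrite hnormZ cabs_real exprMn real_normK ?num_real // innerZl lZ
      !Re_realM -mulrBr -[2 * t * _]mulrA.
  set b := complex.Re _ - _ in t0.
  suff : b = 0 by move/eqP; rewrite subr_eq0 => /eqP.
  set q := hnorm v ^+ 2 in t0.
  have q0 : 0 <= q by exact: sqr_ge0.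
  have q1 : 0 < q + 1 by rewrite ltr_wpDl.
  (* A negative value of the quadratic t^2 q + 2 t b, unless b = 0; the [+ 1] covers q = 0. *)
  have := t0 (- b / (q + 1)).
  have -> : (- b / (q + 1)) ^+ 2 * q + 2 * (- b / (q + 1)) * b
    = - (b ^+ 2 * ((q + 2) / (q + 1) ^+ 2)).
    by field; exact: lt0r_neq0.
  rewrite oppr_ge0 pmulr_lle0; last by rewrite divr_gt0 ?exprn_gt0 ?ltr_wpDl.
  by move=> h; apply/eqP; rewrite -sqrf_eq0 eq_le h sqr_ge0.
exists z => v.
(* The real part of the identity at i v is, up to sign, the imaginary part of the identity at v. *)
have := Rekey ('i%C *: v); rewrite innerZl lZ; have := Rekey v.
case: (inner v z) => a b; case: (l v) => c d /=; rewrite !mul0r !mul1r !sub0r.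
by move=> -> /oppr_inj ->.
Qed.

End Riesz.

(** * Bounded operators, adjoints, Lax-Milgram *)

Section BoundedOperators.
Context {R : realType} {H : hilbertType R}.
Implicit Types (A B : H -> H) (x y z : H).

Lemma bounded_op_bound A : bounded_op A ->
  exists2 C : R, 0 <= C & forall x, hnorm (A x) <= C * hnorm x.
Proof.
move=> [_ [C hC]]; exists (Num.max C 0); first by rewrite le_max lexx orbT.
move=> x; apply: le_trans (hC x) _.
by rewrite ler_wpM2r ?hnorm_ge0 // le_max lexx.
Qed.

Lemma bopD A x y : bounded_op A -> A (x + y) = A x + A y.
Proof. by case=> lA _; rewrite -[x]scale1r lA !scale1r. Qed.

Lemma bop0 A : bounded_op A -> A 0 = 0.
Proof. by case=> lA _; have := lA (-1) 0 0; rewrite scaler0 addr0 scaleN1r addNr. Qed.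

Lemma bopZ A a x : bounded_op A -> A (a *: x) = a *: A x.
Proof. by move=> bA; have := bA.1 a x 0; rewrite !addr0 (bop0 bA) addr0. Qed.

Lemma bopN A x : bounded_op A -> A (- x) = - A x.
Proof. by move=> bA; rewrite -scaleN1r bopZ // scaleN1r. Qed.

Lemma bopB A x y : bounded_op A -> A (x - y) = A x - A y.
Proof. by move=> bA; rewrite bopD // bopN. Qed.

Lemma bop_sum A (J : Type) (r : seq J) (P : pred J) (F : J -> H) :
  bounded_op A -> A (\sum_(i <- r | P i) F i) = \sum_(i <- r | P i) A (F i).
Proof.
move=> bA; elim/big_rec2 : _ => [|i y1 y2 _ <-]; first exact: bop0.
exact: bopD.
Qed.

Lemma bounded_op_id : bounded_op (@id H).
Proof. by split=> //; exists 1 => x; rewrite mul1r. Qed.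

Lemma bounded_op_lin (a : R[i]) A B : bounded_op A -> bounded_op B ->
  bounded_op (fun x => a *: A x + B x).
Proof.
move=> bA bB; split=> [b x y|].
  by rewrite bA.1 bB.1 !scalerDr !scalerA mulrC -!addrA [_ + (_ + B y)]addrCA.
have [C C0 hC] := bounded_op_bound bA; have [D D0 hD] := bounded_op_bound bB.
exists (cabs a * C + D) => x; apply: le_trans (ler_hnormD _ _) _.
rewrite hnormZ mulrDl -mulrA lerD //.
by rewrite ler_wpM2l ?cabs_ge0.
Qed.

Lemma bounded_op_comp A B : bounded_op A -> bounded_op B ->
  bounded_op (fun x => A (B x)).
Proof.
move=> bA bB; split=> [b x y|]; first by rewrite bB.1 bA.1.
have [C C0 hC] := bounded_op_bound bA; have [D D0 hD] := bounded_op_bound bB.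
exists (C * D) => x; apply: le_trans (hC _) _.
by rewrite -mulrA ler_wpM2l.
Qed.

Lemma bounded_op0 : bounded_op (fun=> 0 : H).
Proof.
split=> [b x y|]; first by rewrite scaler0 addr0.
by exists 0 => x; rewrite mul0r hnorm0.
Qed.

Lemma bounded_op_scale (a : R[i]) : bounded_op (fun x : H => a *: x).
Proof.
split=> [b x y|]; first by rewrite scalerDr !scalerA mulrC.
by exists (cabs a) => x; rewrite hnormZ.
Qed.

(** [riesz] supplies a witness, so the [xget] in [adj] never falls back on its default value. *)
Lemma adjP A x y : bounded_op A -> inner (A x) y = inner x (adj A y).
Proof.
move=> bA; have [C C0 hC] := bounded_op_bound bA.
have [||z hz] := @riesz R H (fun x => inner (A x) y) (C * hnorm y).
- by move=> a u v; rewrite bA.1 innerDl innerZl.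
- move=> u; apply: le_trans (inner_le _ _) _.
  by rewrite mulrAC ler_wpM2r ?hnorm_ge0.
by rewrite /adj; case: xgetP => [u -> //|/(_ z)].
Qed.

Lemma adj_eq A y z : bounded_op A ->
  (forall x, inner (A x) y = inner x z :> R[i]) -> adj A y = z.
Proof. by move=> bA h; apply: inner_eqr => x; rewrite -adjP. Qed.

Lemma adjP2 A x y : bounded_op A -> inner x (A y) = inner (adj A x) y :> R[i].
Proof. by move=> bA; rewrite innerC adjP // -innerC. Qed.

Lemma adj_bounded_op A : bounded_op A -> bounded_op (adj A).
Proof.
move=> bA; split=> [a x y|].
  by apply: adj_eq => // z; rewrite innerDr innerZr !adjP // innerDr innerZr.
have [C C0 hC] := bounded_op_bound bA; exists C => y.
apply: hnorm_le_dual => [|x]; first by rewrite mulr_ge0 // hnorm_ge0.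
rewrite -adjP2 //; apply: le_trans (Re_inner_le _ _) _.
by rewrite -mulrA mulrCA ler_wpM2l ?hnorm_ge0.
Qed.

Lemma adj_comp A B y : bounded_op A -> bounded_op B ->
  adj (fun x => A (B x)) y = adj B (adj A y).
Proof.
move=> bA bB; apply: adj_eq; first exact: bounded_op_comp.
by move=> x; rewrite !adjP.
Qed.

Lemma bop_cvg A (T : Type) (F : set_system T) {FF : Filter F} (f : T -> H) (l : H) :
  bounded_op A -> f @ F --> l -> (fun t => A (f t)) @ F --> A l.
Proof.
move=> bA /cvg_hnormP h; have [C C0 hC] := bounded_op_bound bA.
apply/cvg_hnormP => e e0.
have e1 : 0 < e / (C + 1) by rewrite divr_gt0 // ltr_wpDl.
apply: filterS (h _ e1) => t ht.
rewrite -bopB //; apply: le_lt_trans (hC _) _.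
have : hnorm (l - f t) * (C + 1) < e by rewrite -ltr_pdivlMr // ltr_wpDl.
by apply: le_lt_trans; rewrite mulrC ler_wpM2l ?hnorm_ge0 // lerDl.
Qed.

Lemma has_sup_opnorm A : bounded_op A ->
  has_sup [set hnorm (A x) | x in [set x | hnorm x <= 1]].
Proof.
move=> bA; have [C C0 hC] := bounded_op_bound bA; split.
  by exists (hnorm (A 0)), 0 => //=; rewrite hnorm0.
exists C => _ [x /= x1 <-]; apply: le_trans (hC x) _.
by rewrite ler_piMr.
Qed.

Lemma opnorm_ge0 A : bounded_op A -> 0 <= opnorm A.
Proof.
move=> bA; apply: le_trans (hnorm_ge0 (A 0)) _.
by apply: sup_ubound; [exact: (has_sup_opnorm bA).2|exists 0 => //=; rewrite hnorm0].
Qed.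

Lemma opnormP A x : bounded_op A -> hnorm (A x) <= opnorm A * hnorm x.
Proof.
move=> bA; have [->|x0] := eqVneq x 0; first by rewrite bop0 // hnorm0 mulr0.
have nx : 0 < hnorm x by rewrite lt_def hnorm_eq0 x0 hnorm_ge0.
rewrite -ler_pdivrMr //; apply: sup_ubound; first exact: (has_sup_opnorm bA).2.
exists ((hnorm x)^-1%:C%C *: x) => /=.
  by rewrite hnormZ cabs_real ger0_norm ?invr_ge0 ?hnorm_ge0 // mulVf // gt_eqF.
rewrite bopZ // hnormZ cabs_real ger0_norm ?invr_ge0 ?hnorm_ge0 //.
by rewrite mulrC.
Qed.

Lemma opnorm_le A (C : R) : 0 <= C -> (forall x, hnorm (A x) <= C * hnorm x) ->
  opnorm A <= C.
Proof.
move=> C0 hC; apply: ge_sup; first by exists (hnorm (A 0)), 0 => //=; rewrite hnorm0.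
by move=> _ [x /= x1 <-]; apply: le_trans (hC x) _; rewrite ler_piMr.
Qed.

Lemma fixpoint_contraction (f : H -> H) (q : R) : 0 <= q -> q < 1 ->
  (forall x y, hnorm (f x - f y) <= q * hnorm (x - y)) -> exists x, f x = x.
Proof.
move=> q0 q1 hf; pose u n := iter n f 0; pose d := hnorm (u 0%N - u 1%N).
have q1' : 0 < 1 - q by rewrite subr_gt0.
have hu n : hnorm (u n - u n.+1) <= q ^+ n * d.
  elim: n => [|n IH]; first by rewrite expr0 mul1r.
  by apply: le_trans (hf _ _) _; rewrite exprS -mulrA ler_wpM2l.
(* Passing through the successors of both points gives q |u_m - u_n| plus two one-step distances;
   absorbing the first term replaces the summation of a geometric series. *)
have dist m n : hnorm (u m - u n) <= (q ^+ m * d + q ^+ n * d) / (1 - q).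
  rewrite ler_pdivlMr //.
  have h1 := hnorm_triB (u m.+1) (u m) (u n).
  have h2 := hnorm_triB (u n.+1) (u m.+1) (u n).
  have h3 := hf (u m) (u n); have h4 := hu m; have := hu n.
  rewrite hnorm_distC; move: h1 h2 h3 h4; rewrite /u /= -/(u m) -/(u n); lra.
have qn : (fun n => q ^+ n) @ \oo --> 0 by apply: cvg_expr; rewrite ger0_norm.
have small e : 0 < e -> \forall n \near \oo, q ^+ n * d / (1 - q) < e.
  move=> e0; have e1 : 0 < e * (1 - q) / (d + 1).
    by rewrite divr_gt0 ?mulr_gt0 // ltr_wpDl // hnorm_ge0.
  move/cvgrPdist_lt : qn => /(_ _ e1); apply: filterS => n.
  rewrite sub0r normrN ger0_norm ?exprn_ge0 // ltr_pdivlMr ?ltr_wpDl ?hnorm_ge0 //.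
  rewrite ltr_pdivrMr // => h; apply: le_lt_trans h.
  by rewrite ler_wpM2l ?exprn_ge0 // lerDl.
have ucv : cvg (u @ \oo).
  apply: cauchy_hnorm_cvg => e e0; have e2 : 0 < e / 2 by rewrite divr_gt0.
  exists [set n | q ^+ n * d / (1 - q) < e / 2]; first exact: small.
  move=> m n /= hm hn; apply: le_lt_trans (dist m n) _.
  by rewrite mulrDl [e]splitr ltrD.
exists (lim (u @ \oo)); apply/eqP; rewrite -subr_eq0 -hnorm_eq0 eq_le hnorm_ge0 andbT.
apply: (@le0_of_small _ _ (q + 1)) => e e0.
have /cvg_hnormP/(_ _ e0)[N _ hN] := ucv.
apply: le_trans (hnorm_triB (u N.+1) _ _) _; rewrite mulrDr mulr1 lerD //.
  apply: le_trans (hf _ _) _; rewrite mulrC ler_wpM2r // ltW //; exact: hN N (leqnn N).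
by rewrite hnorm_distC ltW //; apply: hN; rewrite /= leqnSn.
Qed.

Lemma coercive_inj A (c : R) : bounded_op A -> 0 < c ->
  (forall x, c * hnorm x ^+ 2 <= complex.Re (inner (A x) x)) ->
  forall x, c * hnorm x <= hnorm (A x).
Proof.
move=> bA c0 h x; have [->|x0] := eqVneq x 0; first by rewrite hnorm0 mulr0 hnorm_ge0.
have nx : 0 < hnorm x by rewrite lt_def hnorm_eq0 x0 hnorm_ge0.
by rewrite -(ler_pM2r nx) -mulrA -expr2 (le_trans (h x)) // Re_inner_le.
Qed.

(* x |-> x - t (A x - y) is a contraction for small t > 0. *)
Lemma lax_milgram A (c : R) : bounded_op A -> 0 < c ->
  (forall x, c * hnorm x ^+ 2 <= complex.Re (inner (A x) x)) ->
  exists B, [/\ bounded_op B, cancel A B & cancel B A].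
Proof.
move=> bA c0 hc; have cI := coercive_inj bA c0 hc.
have [C0 C00 hC0] := bounded_op_bound bA.
pose C := C0 + c; have C_gt0 : 0 < C by rewrite ltr_wpDl.
have cC : c <= C by rewrite lerDr.
have hC x : hnorm (A x) <= C * hnorm x.
  by apply: le_trans (hC0 x) _; rewrite ler_wpM2r ?hnorm_ge0 // lerDl ltW.
(* The bound |x - t A x|^2 <= (1 - 2 t c + t^2 C^2) |x|^2 is best at t = c / C^2, where the factor
   is 1 - r <= (1 - r / 2)^2. Enlarging [C0] by [c] ensures c <= C, hence r <= 1. *)
pose t := c / C ^+ 2; pose r := (c / C) ^+ 2.
have r0 : 0 < r by rewrite exprn_gt0 // divr_gt0.
have r1 : r <= 1 by rewrite exprn_ile1 ?ler_pdivrMr ?mul1r // divr_ge0 // ltW.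
have t0 : 0 <= t by rewrite divr_ge0 ?sqr_ge0 // ltW.
have contr x : hnorm (x - t%:C%C *: A x) <= (1 - r / 2) * hnorm x.
  rewrite -(ler_pXn2r (n := 2)) // ?nnegrE ?hnorm_ge0 //; last first.
    by rewrite mulr_ge0 ?hnorm_ge0 //; lra.
  rewrite hnormB_sqr hnormZ cabs_real innerZr.
  have -> : Num.conj t%:C%C = (t%:C%C : R[i]).
    by apply: conj_Creal; rewrite complex_real.
  rewrite Re_realM [inner x _]innerC Re_conjC ger0_norm //.
  have h1 : (t * hnorm (A x)) ^+ 2 <= r * hnorm x ^+ 2.
    have -> : r * hnorm x ^+ 2 = (t * (C * hnorm x)) ^+ 2.
      by rewrite /r /t; field; exact: lt0r_neq0.
    apply: lerXn2r; rewrite ?nnegrE ?ler_wpM2l ?hC // mulr_ge0 // ?hnorm_ge0 //.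
    by rewrite mulr_ge0 ?hnorm_ge0 // ltW.
  have h2 : r * hnorm x ^+ 2 <= t * complex.Re (inner (A x) x).
    have -> : r * hnorm x ^+ 2 = t * (c * hnorm x ^+ 2).
      by rewrite /r /t; field; exact: lt0r_neq0.
    by rewrite ler_wpM2l.
  have : 0 <= (r / 2 * hnorm x) ^+ 2 by exact: sqr_ge0.
  move: h1 h2; move: (complex.Re _) (hnorm (A x)) (hnorm x) => a b d.
  move: (t) (r) => t' r'; rewrite !exprMn; lra.
have sol y : exists x, A x = y.
  have [||u v|x hx] := @fixpoint_contraction (fun x => x - t%:C%C *: (A x - y)) (1 - r / 2).
  - lra.
  - lra.
  - have -> : u - t%:C%C *: (A u - y) - (v - t%:C%C *: (A v - y)) =
        (u - v) - t%:C%C *: A (u - v).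
      rewrite (bopB u v bA).
      have -> : A u - A v = (A u - y) - (A v - y) by rewrite opprB subrKA.
      rewrite [in RHS]scalerBr.
      by rewrite opprD opprK addrACA [- _ + _]addrC opprB.
    exact: contr.
  exists x; move/eqP: hx; rewrite -subr_eq0 addrAC subrr sub0r oppr_eq0 scaler_eq0.
  have -> : (t%:C%C == 0 :> R[i]) = false.
    by rewrite gt_eqF // ltcR divr_gt0 // exprn_gt0.
  by rewrite subr_eq0 => /eqP.
have /choice[B hB] := sol; have AI : injective A.
  move=> x y e; apply/eqP; rewrite -subr_eq0 -hnorm_eq0 eq_le hnorm_ge0 andbT.
  by have := cI (x - y); rewrite (bopB x y bA) e subrr hnorm0 pmulr_rle0.
exists B; split=> // [|x]; last by apply: AI; rewrite hB.
split=> [a x y|]; first by apply: AI; rewrite bA.1 !hB.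
exists c^-1 => x; have := cI (B x); rewrite hB => h.
by rewrite -ler_pdivrMl ?invr_gt0 // invrK.
Qed.

End BoundedOperators.

(** * Finite partial sums and their bounds *)

Section FiniteSums.
Context {I : choiceType}.

Lemma partial_sumE (V : zmodType) (h : I -> V) (F : {fset I}) :
  summability.partial_sum h F = \sum_(i <- F) h i.
Proof. by rewrite /summability.partial_sum big_seq_fsetE. Qed.

Lemma sum_fset_split (V : nmodType) (h : I -> V) (F G : {fset I}) : (F `<=` G)%fset ->
  \sum_(i <- G) h i = \sum_(i <- F) h i + \sum_(i <- (G `\` F)%fset) h i.
Proof.
move=> FG; rewrite -big_cat; apply: perm_big; apply: uniq_perm => //.
  rewrite cat_uniq !fset_uniq andbT /=; apply/hasPn => i.
  by rewrite /= in_fsetD => /andP[].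
move=> i; rewrite mem_cat in_fsetD.
by case: (boolP (i \in F)) => //= iF; exact: (fsubsetP FG).
Qed.

Lemma sum_fset_sub (V : nmodType) (h : I -> V) (F G : {fset I}) :
  (F `<=` G)%fset -> (forall i, i \in G -> i \notin F -> h i = 0) ->
  \sum_(i <- G) h i = \sum_(i <- F) h i.
Proof.
move=> FG h0; rewrite (sum_fset_split _ FG) [X in _ + X]big1_seq ?addr0 // => i /andP[_].
by rewrite in_fsetD => /andP[iF iG]; exact: h0.
Qed.

Lemma totallyP (P : {fset I} -> Prop) :
  (\forall F \near summability.totally, P F) <->
  exists A, forall B, (A `<=` B)%fset -> P B.
Proof.
split=> [[A _ h]|[A h]]; first by exists A => B AB; exact: h.
by exists A => // B; exact: h.
Qed.

Context {R : realType}.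
Implicit Types (a : I -> R).

Lemma sum_fset_le a (F G : {fset I}) : (forall i, 0 <= a i) -> (F `<=` G)%fset ->
  \sum_(i <- F) a i <= \sum_(i <- G) a i.
Proof.
by move=> a0 FG; rewrite (sum_fset_split _ FG) lerDl sumr_ge0.
Qed.

Lemma sum_fset_ge1 a (F : {fset I}) i : (forall i, 0 <= a i) -> i \in F ->
  a i <= \sum_(j <- F) a j.
Proof.
move=> a0 iF; rewrite -(big_seq_fset1 +%R i a); apply: sum_fset_le => //.
by apply/fsubsetP => j /fset1P ->.
Qed.

(** The supremum defining [\esum] runs over finite sets, so bounding it means bounding all finite
    sums; this form keeps the estimates in [R]. *)
Definition sum_bounded a (M : R) := forall F : {fset I}, \sum_(i <- F) a i <= M.

Lemma sum_bounded_esum a (M : R) :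
  (\esum_(i in [set: I]) (a i)%:E <= M%:E)%E <-> sum_bounded a M.
Proof.
split=> [h F|h].
  rewrite -lee_fin; apply: le_trans h; apply: ereal_sup_ubound => /=.
  exists [set` F]; first by split.
  by rewrite -fsbig_seq // -sumEFin.
apply: ge_ereal_sup => _ [A [fA _] <-].
by rewrite fsbig_finite // sumEFin lee_fin.
Qed.

Lemma sum_bounded_ge1 a M i : sum_bounded a M -> a i <= M.
Proof. by move=> /(_ [fset i]%fset); rewrite big_seq_fset1. Qed.

Lemma sum_bounded_ge0 a M : sum_bounded a M -> 0 <= M.
Proof. by move=> /(_ fset0); rewrite big_seq_fset0. Qed.

(** Take [F] with a sum within [e] of the supremum of all finite sums: a set disjoint from [F] can
    only add what is left. *)
Lemma sum_bounded_tail a M e : (forall i, 0 <= a i) -> sum_bounded a M -> 0 < e ->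
  exists F : {fset I}, forall G : {fset I}, (forall i, i \in G -> i \notin F) ->
    \sum_(i <- G) a i <= e.
Proof.
move=> a0 aM e0; pose S := [set \sum_(i <- F) a i | F in [set: {fset I}]].
have hS : has_sup S.
  by split; [exists (\sum_(i <- fset0) a i), fset0 | exists M => _ [F _ <-]].
have [_ [F _ <-] hF] := sup_adherent e0 hS.
exists F => G dis.
have : \sum_(i <- (F `|` G)%fset) a i <= sup S.
  by apply: sup_ubound; [exact: hS.2|exists (F `|` G)%fset].
rewrite (sum_fset_split _ (fsubsetUl F G)).
have -> : ((F `|` G) `\` F = G)%fset.
  apply/fsetP => i; rewrite in_fsetD in_fsetU.
  by case: (boolP (i \in G)) => [/dis -> /=|]; rewrite ?orbT // orbF andNb.
move: hF; lra.
Qed.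

End FiniteSums.

(** * Unconditional sums in a Hilbert space *)

Section UnconditionalSums.
Context {R : realType} {H : hilbertType R} {I : choiceType}.
Implicit Types (h : I -> H) (A : H -> H).
Local Notation totally := (@summability.totally I).

Lemma usum_eq h (l : H) :
  summability.partial_sum h @ totally --> l -> usum h = l.
Proof.
move=> hl; apply: esym; apply: (cvg_hnorm_unique hl).
have hc : cvg (summability.partial_sum h @ totally) by apply/cvg_ex; exists l.
exact: hc.
Qed.

Lemma usummable_ex h (l : H) :
  summability.partial_sum h @ totally --> l -> usummable h.
Proof. by move=> hl; apply/cvg_ex; exists l. Qed.

Lemma usummable_fin h (F : {fset I}) : (forall i, i \notin F -> h i = 0) ->
  summability.partial_sum h @ totally --> \sum_(i <- F) h i.
Proof.
move=> h0; apply/cvg_hnormP => e e0; apply/totallyP; exists F => G FG.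
rewrite partial_sumE (sum_fset_sub FG) ?subrr ?hnorm0 // => i _; exact: h0.
Qed.

Lemma usum_fin h (F : {fset I}) : (forall i, i \notin F -> h i = 0) ->
  usum h = \sum_(i <- F) h i.
Proof. by move/usummable_fin/usum_eq. Qed.

Lemma usummable_cauchy h :
  (forall e : R, 0 < e -> exists F : {fset I}, forall G : {fset I},
     (forall i, i \in G -> i \notin F) -> hnorm (\sum_(i <- G) h i) < e) ->
  usummable h.
Proof.
move=> hh; apply: cauchy_hnorm_cvg => e e0.
have [|F hF] := hh (e / 2); first by rewrite divr_gt0.
exists [set G | (F `<=` G)%fset]; first by exists F.
move=> G1 G2 /= FG1 FG2; rewrite !partial_sumE.
rewrite (sum_fset_split _ FG1) (sum_fset_split _ FG2) opprD addrACA subrr add0r.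
apply: le_lt_trans (ler_hnormB _ _) _; rewrite [e]splitr ltrD //; apply: hF => i;
  by rewrite in_fsetD => /andP[].
Qed.

Lemma usummable_abs h (M : R) : sum_bounded (fun i => hnorm (h i)) M ->
  usummable h.
Proof.
move=> hM; apply: usummable_cauchy => e e0.
have [||F hF] := sum_bounded_tail _ hM (e := e / 2) => [i||].
- exact: hnorm_ge0.
- by rewrite divr_gt0.
exists F => G /hF hG; apply: le_lt_trans (ler_hnorm_sum _ _ _) _.
by apply: le_lt_trans hG _; rewrite ltr_pdivrMr // ltr_pMr //; lra.
Qed.

Lemma usum_hnorm_le_near h (x : H) (M : R) : usummable h ->
  (exists F : {fset I}, forall G : {fset I}, (F `<=` G)%fset ->
     hnorm (\sum_(i <- G) h i - x) <= M) -> hnorm (usum h - x) <= M.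
Proof.
move=> hs [F hF]; apply: (@hnorm_cvg_le _ _ _ totally _ _ (usum h) x M hs).
by apply/totallyP; exists F => G FG; rewrite partial_sumE; exact: hF.
Qed.

Lemma usum_hnorm_le h (x : H) (M : R) : usummable h ->
  (forall F : {fset I}, hnorm (\sum_(i <- F) h i - x) <= M) -> hnorm (usum h - x) <= M.
Proof. by move=> hs hM; apply: usum_hnorm_le_near => //; exists fset0 => G _. Qed.

Lemma usum_bop_cvg A h : bounded_op A -> usummable h ->
  summability.partial_sum (fun i => A (h i)) @ totally --> A (usum h).
Proof.
move=> bA hs; have := @bop_cvg _ _ _ _ totally _ _ _ bA hs.
have -> : (fun F => A (summability.partial_sum h F)) =
          summability.partial_sum (fun i => A (h i)).
  by apply/funext => F; rewrite !partial_sumE bop_sum.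
exact.
Qed.

Lemma usum_bop A h : bounded_op A -> usummable h ->
  usum (fun i => A (h i)) = A (usum h).
Proof. by move=> bA hs; apply: usum_eq; exact: usum_bop_cvg. Qed.

Lemma usummable_bop A h : bounded_op A -> usummable h ->
  usummable (fun i => A (h i)).
Proof. by move=> bA hs; apply: usummable_ex (usum_bop_cvg bA hs). Qed.

Lemma usum_lin_cvg (a : R[i]) h g : usummable h -> usummable g ->
  summability.partial_sum (fun i => a *: h i + g i) @ totally -->
    a *: usum h + usum g.
Proof.
move=> hs gs.
rewrite (_ : summability.partial_sum _ =
    fun F => a *: summability.partial_sum h F + summability.partial_sum g F).
  exact: cvgD (@bop_cvg _ _ _ _ totally _ _ _ (bounded_op_scale a) hs) gs.
by apply/funext => F /=; rewrite !partial_sumE scaler_sumr -big_split.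
Qed.

Lemma usum_lin (a : R[i]) h g : usummable h -> usummable g ->
  usum (fun i => a *: h i + g i) = a *: usum h + usum g.
Proof. by move=> hs gs; apply: usum_eq; exact: usum_lin_cvg. Qed.

Lemma usummable_lin (a : R[i]) h g : usummable h -> usummable g ->
  usummable (fun i => a *: h i + g i).
Proof.
move=> hs gs; apply: (@usummable_ex _ (a *: usum h + usum g)).
exact: usum_lin_cvg.
Qed.

End UnconditionalSums.

(** * Synthesis operator of a Bessel family *)

Section Bessel.
Context {R : realType} {H : hilbertType R} {I : choiceType}.
Variables (U : I -> H -> H) (B : R).
Hypothesis bU : forall k, bounded_op (U k).
Hypothesis B0 : 0 < B.
Hypothesis besselU : forall f, sum_bounded (fun k => hnorm (U k f) ^+ 2) (B * hnorm f ^+ 2).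
Implicit Types (c : I -> H) (f : H).

(* AM-GM: 2 |c_k| |U_k v| <= B |c_k|^2 + |U_k v|^2 / B, with v the sum. *)
Lemma hnorm_synthesis_fin c (F : {fset I}) :
  hnorm (\sum_(k <- F) adj (U k) (c k)) ^+ 2 <= B * \sum_(k <- F) hnorm (c k) ^+ 2.
Proof.
set v := \sum_(k <- F) _.
have e1 : hnorm v ^+ 2 <= \sum_(k <- F) hnorm (c k) * hnorm (U k v).
  rewrite hnorm_sqr {1}/v; elim/big_ind2 : _ => [|x a y b xa yb|k _].
  - by rewrite inner0l.
  - by rewrite innerDl ReD lerD.
  - by rewrite -adjP2 // Re_inner_le.
have e2 : \sum_(k <- F) hnorm (c k) * hnorm (U k v) <=
    2^-1 * (B * \sum_(k <- F) hnorm (c k) ^+ 2) +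
    2^-1 * (B^-1 * \sum_(k <- F) hnorm (U k v) ^+ 2).
  rewrite !mulr_sumr -big_split /=; apply: ler_sum => k _.
  have := sqr_ge0 (hnorm (c k) - B^-1 * hnorm (U k v)).
  move: (hnorm (c k)) (hnorm (U k v)) => x y h.
  have : 0 <= B * (x - B^-1 * y) ^+ 2 by rewrite mulr_ge0 // ltW.
  have -> : B * (x - B^-1 * y) ^+ 2 = B * x ^+ 2 - 2 * x * y + B^-1 * y ^+ 2.
    by field; exact: lt0r_neq0.
  lra.
have e3 : B^-1 * \sum_(k <- F) hnorm (U k v) ^+ 2 <= hnorm v ^+ 2.
  by rewrite ler_pdivrMl //; exact: besselU.
move: e1 e2 e3; lra.
Qed.

Lemma usummable_synthesis c (M : R) : sum_bounded (fun k => hnorm (c k) ^+ 2) M ->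
  usummable (fun k => adj (U k) (c k)).
Proof.
move=> cM; apply: usummable_cauchy => e e0.
have e1 : 0 < e ^+ 2 / (2 * B) by rewrite divr_gt0 ?exprn_gt0 ?mulr_gt0.
have [F hF] := sum_bounded_tail (fun k => sqr_ge0 (hnorm (c k))) cM e1.
exists F => G /hF hG; rewrite -(ltr_pXn2r (n := 2)) // ?nnegrE ?hnorm_ge0 ?(ltW e0) //.
apply: le_lt_trans (hnorm_synthesis_fin c G) _.
apply: (@le_lt_trans _ _ (B * (e ^+ 2 / (2 * B)))); first by rewrite ler_wpM2l // ltW.
have -> : B * (e ^+ 2 / (2 * B)) = e ^+ 2 / 2 by field; exact: lt0r_neq0.
by rewrite ltr_pdivrMr // ltr_pMr ?exprn_gt0 //; lra.
Qed.

Lemma hnorm_synthesis c (M : R) : sum_bounded (fun k => hnorm (c k) ^+ 2) M ->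
  hnorm (synthesis U c) ^+ 2 <= B * M.
Proof.
move=> cM; have M0 := sum_bounded_ge0 cM.
have s0 : 0 <= Num.sqrt (B * M) by exact: sqrtr_ge0.
have BM : 0 <= B * M by rewrite mulr_ge0 // ltW.
rewrite -[leRHS]sqr_sqrtr //.
rewrite lerXn2r ?nnegrE ?hnorm_ge0 // -[synthesis U c]subr0.
apply: usum_hnorm_le => [|F]; first exact: usummable_synthesis cM.
rewrite subr0 -(ler_pXn2r (n := 2)) ?nnegrE ?hnorm_ge0 //.
rewrite sqr_sqrtr //.
apply: le_trans (hnorm_synthesis_fin c F) _.
exact: ler_wpM2l (ltW B0) _ _ (cM F).
Qed.

(** Passes a lower bound from finite sums to [synthesis]. With [c] the coefficients of [f] itself,
    it turns the lower frame bound into coercivity of the frame operator. *)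
Lemma inner_synthesis_ge c f (M a : R) : sum_bounded (fun k => hnorm (c k) ^+ 2) M ->
  (exists F : {fset I}, forall G : {fset I}, (F `<=` G)%fset ->
    a <= \sum_(k <- G) complex.Re (inner (c k) (U k f))) ->
  a <= complex.Re (inner (synthesis U c) f).
Proof.
move=> cM [F hF]; rewrite -subr_le0; apply: (@le0_of_small _ _ (hnorm f)) => e e0.
have /cvg_hnormP/(_ _ e0)/totallyP[F2 h2] := usummable_synthesis cM.
have {}h2 := ltW (h2 _ (fsubsetUl F2 F)).
have := hF _ (fsubsetUr F2 F).
have <- : complex.Re (inner (summability.partial_sum (fun k => adj (U k) (c k))
    (F2 `|` F)%fset) f) = \sum_(k <- (F2 `|` F)%fset) complex.Re (inner (c k) (U k f)).
  rewrite partial_sumE; elim/big_ind2 : _ => [|x b y d <- <-|k _].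
  - by rewrite inner0l.
  - by rewrite innerDl ReD.
  - by rewrite -adjP2.
move: h2; rewrite -[lim _]/(synthesis U c); set g := summability.partial_sum _ _ => h2 h3.
have := Re_inner_ge (synthesis U c - g) f; rewrite innerBl ReD ReN.
have : hnorm (synthesis U c - g) * hnorm f <= e * hnorm f.
  by rewrite ler_wpM2r ?hnorm_ge0.
move: h3; move: (complex.Re _) (complex.Re _) (_ * _) (_ * _) => x y z t; lra.
Qed.

End Bessel.

(** * The g-frame operator and the matrices C_T Y D_T *)

Section Gram.
Context {R : realType} {H : hilbertType R} {I : choiceType}.
Variable T : I -> H -> H.

(** The matrix of C_T Y D_T. The product of the matrices for [Y] and [Z] belongs to Y S Z, so that
    matrix identities reduce to identities in B(H). *)
Definition gram (Y : H -> H) : I -> I -> H -> H :=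
  fun k l f => T k (Y (adj (T l) f)).

Definition square_summable (c : I -> H) :=
  exists M, sum_bounded (fun k => hnorm (c k) ^+ 2) M.

End Gram.

Section GFrame.
Context {R : realType} {H : hilbertType R} {I : choiceType}.
Variable T : I -> H -> H.
Hypothesis gT : gframe T.
Local Notation S := (frame_op T).
Local Notation Sinv := (frame_inv T).
Local Notation gram := (gram T).
Implicit Types (f g : H) (c : I -> H) (Y : H -> H).

Lemma gframe_bounded_op k : bounded_op (T k).
Proof. by case: gT. Qed.
Local Hint Resolve gframe_bounded_op : core.

Lemma gframe_bessel : exists2 B, 0 < B & forall f,
  sum_bounded (fun k => hnorm (T k f) ^+ 2) (B * hnorm f ^+ 2).
Proof.
case: gT => _ [A [B [A0 AB h]]]; exists B; first exact: lt_le_trans AB.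
by move=> f; apply/sum_bounded_esum; case: (h f).
Qed.

Lemma gframe_lower : exists2 A, 0 < A & forall f e, 0 < e ->
  exists F : {fset I}, forall G : {fset I}, (F `<=` G)%fset ->
    A * hnorm f ^+ 2 - e <= \sum_(k <- G) hnorm (T k f) ^+ 2.
Proof.
case: gT => _ [A [B [A0 AB h]]]; exists A => // f e e0.
(* If no finite set came within [e] of the lower frame bound, all finite sums, and with them the
   [\esum], would stay below it. *)
apply: contrapT => nF; have [h1 _] := h f; move: h1; apply/negP.
rewrite -ltNge; apply: (@le_lt_trans _ _ (A * hnorm f ^+ 2 - e)%:E); last first.
  by rewrite lte_fin ltrBlDr ltrDl.
apply/sum_bounded_esum => F; rewrite leNgt; apply/negP => hF; apply: nF.
exists F => G FG; apply: le_trans (ltW hF) _; apply: sum_fset_le => // k.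
exact: sqr_ge0.
Qed.

Lemma square_summable_analysis f : square_summable (analysis T f).
Proof.
by have [B _ hB] := gframe_bessel; exists (B * hnorm f ^+ 2); exact: hB.
Qed.

Lemma gframe_usummable c : square_summable c -> usummable (fun k => adj (T k) (c k)).
Proof.
have [B B0 hB] := gframe_bessel; case=> M.
exact: (usummable_synthesis gframe_bounded_op B0 hB).
Qed.

Lemma frame_opE f : S f = synthesis T (analysis T f).
Proof. by []. Qed.

Lemma frame_op_bounded : bounded_op S.
Proof.
have [B B0 hB] := gframe_bessel; split=> [a x y|].
  rewrite -usum_lin; try exact/gframe_usummable/square_summable_analysis.
  congr usum; apply/funext => k.
  by rewrite (gframe_bounded_op k).1 (adj_bounded_op (gframe_bounded_op k)).1.
exists B => f; rewrite -(ler_pXn2r (n := 2)) ?nnegrE ?mulr_ge0 ?hnorm_ge0 ?(ltW B0) //.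
have := hnorm_synthesis gframe_bounded_op B0 hB (hB f).
by rewrite mulrA -expr2 -exprMn.
Qed.

Lemma frame_op_coercive : exists2 A, 0 < A & forall f,
  A * hnorm f ^+ 2 <= complex.Re (inner (S f) f).
Proof.
have [B B0 hB] := gframe_bessel; have [A A0 hA] := gframe_lower; exists A => // f.
apply/ler_addgt0Pr => e e0; rewrite -lerBlDr.
apply: (inner_synthesis_ge gframe_bounded_op B0 hB (hB f)).
have [F hF] := hA f _ e0; exists F => G FG; apply: le_trans (hF G FG) _.
by apply: ler_sum => k _; rewrite hnorm_sqr.
Qed.

(** Partial sums over a common finite set are self-adjoint and approximate both sides. *)
Lemma frame_op_sym f g : inner (S f) g = inner f (S g) :> R[i].
Proof.
apply/eqP; rewrite -subr_eq0 -normr_eq0 -cabsE; set x := cabs _.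
suff : x <= 0 by move=> h; rewrite (_ : x = 0) //; apply/eqP; rewrite eq_le h cabs_ge0.
apply: (@le0_of_small _ _ (hnorm g + hnorm f)) => e e0.
have sf := gframe_usummable (square_summable_analysis f).
have sg := gframe_usummable (square_summable_analysis g).
have /cvg_hnormP/(_ _ e0)/totallyP[F1 h1] := sf.
have /cvg_hnormP/(_ _ e0)/totallyP[F2 h2] := sg.
have {}h1 := ltW (h1 _ (fsubsetUl F1 F2)); have {}h2 := ltW (h2 _ (fsubsetUr F1 F2)).
move: h1 h2; rewrite -[lim _]/(S f) -[lim (_ @ _)]/(S g).
set P := summability.partial_sum _ _; set Q := summability.partial_sum _ _ => h1 h2.
have PQ : inner P g = inner f Q :> R[i].
  rewrite /P /Q !partial_sumE.
  elim/big_ind2 : _ => [|a b a' b' ab ab'|k _]; first by rewrite inner0l inner0r.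
    by rewrite innerDl innerDr ab ab'.
  by rewrite -adjP2 // adjP.
have -> : x = cabs (inner (S f - P) g - inner f (S g - Q)).
  by rewrite /x innerBl innerBr PQ opprB addrA subrK.
apply: le_trans (cabsD _ _) _; rewrite cabsN mulrDr.
apply: lerD; apply: le_trans (inner_le _ _) _.
  exact: ler_wpM2r (hnorm_ge0 _) _ _ h1.
by rewrite mulrC; exact: ler_wpM2r (hnorm_ge0 _) _ _ h2.
Qed.

(** Lax-Milgram inverts the coercive operator S. Since its inverse is also a left inverse, the
    preimage chosen by [xget] is the only one. *)
Lemma frame_invP : [/\ bounded_op Sinv, cancel S Sinv & cancel Sinv S].
Proof.
have [A A0 hA] := frame_op_coercive.
have [J [bJ SJ JS]] := lax_milgram frame_op_bounded A0 hA.
suff -> : Sinv = J by [].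
apply/funext => f; rewrite /frame_inv; case: xgetP => [g _ <- //|/(_ (J f))].
by rewrite /= JS.
Qed.

Lemma frame_inv_bounded : bounded_op Sinv.
Proof. by case: frame_invP. Qed.
Local Hint Resolve frame_inv_bounded : core.

Lemma frame_opK : cancel S Sinv.
Proof. by case: frame_invP. Qed.

Lemma frame_invK : cancel Sinv S.
Proof. by case: frame_invP. Qed.

Lemma adj_frame_inv f : adj Sinv f = Sinv f.
Proof.
apply: adj_eq => // x.
by rewrite -{1}(frame_invK f) -frame_op_sym frame_invK.
Qed.

Lemma dual_bounded_op k : bounded_op (dual T k).
Proof. exact: (bounded_op_comp (gframe_bounded_op k) frame_inv_bounded). Qed.

Lemma adj_dual k f : adj (dual T k) f = Sinv (adj (T k) f).
Proof.
rewrite -adj_frame_inv.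
exact: (adj_comp _ (gframe_bounded_op k) frame_inv_bounded).
Qed.

Lemma gram_bounded_op Y k l : bounded_op Y -> bounded_op (gram Y k l).
Proof.
move=> bY; apply: bounded_op_comp (gframe_bounded_op k) _.
exact: bounded_op_comp bY (adj_bounded_op (gframe_bounded_op l)).
Qed.

Lemma gram_usummable Y c k : bounded_op Y -> square_summable c ->
  usummable (fun l => gram Y k l (c l)).
Proof.
move=> bY /gframe_usummable.
exact: usummable_bop (bounded_op_comp (gframe_bounded_op k) bY).
Qed.

Lemma mxapp_gram Y c k : bounded_op Y -> square_summable c ->
  mxapp (gram Y) c k = T k (Y (synthesis T c)).
Proof.
move=> bY /gframe_usummable.
exact: usum_bop (bounded_op_comp (gframe_bounded_op k) bY).
Qed.

Lemma square_summable_dual f : square_summable (analysis (dual T) f).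
Proof. exact: square_summable_analysis. Qed.

(** D_T maps the dual coefficients of [f] to S S^-1 f = f, and the coefficients in T to S f. This
    identity and the next two follow, and through them every later estimate on H becomes a matrix
    estimate on l^p. *)
Lemma mxapp_gram_inv f :
  mxapp (gram Sinv) (analysis (dual T) f) = analysis (dual T) f.
Proof.
apply/funext => k; rewrite mxapp_gram //; last exact: square_summable_dual.
by rewrite -[analysis _ _]/(analysis T (Sinv f)) -frame_opE frame_opK.
Qed.

Lemma mxapp_gram_id f :
  mxapp (gram id) (analysis (dual T) f) = analysis T f.
Proof.
apply/funext => k; rewrite (mxapp_gram _ bounded_op_id); last exact: square_summable_dual.
by rewrite -[analysis _ _]/(analysis T (Sinv f)) -frame_opE frame_invK.
Qed.

Lemma mxapp_gram_inv2 f :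
  mxapp (gram (Sinv \o Sinv)) (analysis T f) = analysis (dual T) f.
Proof.
apply/funext => k; rewrite mxapp_gram; last exact: square_summable_analysis.
  by rewrite -frame_opE /= frame_opK.
exact: bounded_op_comp.
Qed.

Lemma square_summable_gram Y : bounded_op Y -> exists2 C, 0 <= C & forall c M,
  sum_bounded (fun k => hnorm (c k) ^+ 2) M ->
  sum_bounded (fun k => hnorm (mxapp (gram Y) c k) ^+ 2) (C * M).
Proof.
move=> bY; have [B B0 hB] := gframe_bessel; have [C C0 hC] := bounded_op_bound bY.
exists (B * (C ^+ 2 * B)) => [|c M cM].
  by rewrite !mulr_ge0 ?sqr_ge0 // ltW.
have sc : square_summable c by exists M.
move=> F; have := hB (Y (synthesis T c)) F.
under eq_bigr do rewrite -mxapp_gram //.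
move/le_trans; apply; rewrite -mulrA ler_wpM2l ?(ltW B0) // -mulrA.
apply: (@le_trans _ _ (C ^+ 2 * hnorm (synthesis T c) ^+ 2)).
  by rewrite -exprMn lerXn2r ?nnegrE ?mulr_ge0 ?hnorm_ge0.
rewrite ler_wpM2l ?sqr_ge0 //.
exact: (hnorm_synthesis gframe_bounded_op B0 hB cM).
Qed.

End GFrame.

(** * Weighted l^p quasi-norms *)

Lemma ler_powRl (R : realType) (r x y : R) : 0 < r -> 0 <= x -> x <= y ->
  x `^ r <= y `^ r.
Proof.
move=> r0 x0 xy.
by apply: ge0_ler_powR; rewrite ?nnegrE ?(ltW r0) ?(le_trans x0 xy).
Qed.

Section WeightedNorms.
Context {R : realType} {H : hilbertType R} {I : choiceType}.
Variable w : I -> R.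
Hypothesis w_gt0 : forall k, 0 < w k.
Implicit Types (p : \bar R) (c d : I -> H) (M : R) (F G : {fset I}).

Definition wabs c k := hnorm (c k) * w k.

Lemma wabs_ge0 c k : 0 <= wabs c k.
Proof. by rewrite mulr_ge0 ?hnorm_ge0 // ltW. Qed.

(** The bound [ellnorm p w c <= M%:E] with both sides raised to the power [r], hence free of roots
    and of extended reals. *)
Definition lp_le p c M : Prop :=
  match p with
  | r%:E => if r == 0 then forall k, wabs c k <= M
            else sum_bounded (fun k => wabs c k `^ r) (M `^ r)
  | _ => forall k, wabs c k <= M
  end.

Lemma supnorm_leP c M : 0 <= M ->
  (ereal_sup (0%E |` [set (hnorm (c k) * w k)%:E | k in setT]) <= M%:E)%E <->
  forall k, wabs c k <= M.
Proof.
move=> M0; split=> [h k|h].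
  by rewrite -lee_fin; apply: le_trans h; apply: ereal_sup_ubound; right; exists k.
apply: ge_ereal_sup => _ [->|[k _ <-]]; first by rewrite lee_fin.
by rewrite lee_fin; exact: h.
Qed.

Lemma ellnorm_leP p c M : (0 <= p)%E -> 0 <= M ->
  (ellnorm p w c <= M%:E)%E <-> lp_le p c M.
Proof.
case: p => [r| |] //= p0 M0; rewrite /ellnorm /lp_le; last exact: supnorm_leP.
case: ifPn => r0; first exact: supnorm_leP.
have {}r0 : 0 < r by rewrite lt_def r0.
rewrite -sum_bounded_esum; set E := \esum_(k in _) _.
have E0 : (0 <= E)%E by apply: esum_ge0 => k _; rewrite lee_fin powR_ge0.
have E1 : ((E `^ r^-1) `^ r = E)%E by rewrite -poweRrM mulVf ?poweRe1 // gt_eqF.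
have M1 : (((M `^ r) `^ r^-1) = M) by rewrite -powRrM mulfV ?powRr1 // gt_eqF.
split=> h.
  rewrite -E1 -poweR_EFin; apply: gt0_ler_poweR => //; rewrite ?ltW //.
    by rewrite in_itv /= poweR_ge0 leey.
  by rewrite in_itv /= lee_fin M0 leey.
rewrite -M1 -poweR_EFin; apply: gt0_ler_poweR => //; rewrite ?invr_ge0 ?(ltW r0) //.
  by rewrite in_itv /= E0 leey.
by rewrite in_itv /= lee_fin powR_ge0 leey.
Qed.

Lemma ellnorm_ge0 p c : (0 <= ellnorm p w c)%E.
Proof.
have h : (0 <= ereal_sup (0%E |` [set (hnorm (c k) * w k)%:E | k in setT]))%E.
  by apply: ereal_sup_ubound; left.
case: p => [r| |] //; rewrite /ellnorm; case: ifP => // _; exact: poweR_ge0.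
Qed.

Lemma ellnorm_lty p c : (0 <= p)%E ->
  (ellnorm p w c < +oo)%E <-> exists2 M, 0 <= M & (ellnorm p w c <= M%:E)%E.
Proof.
move=> p0; split=> [h|[M _ /le_lt_trans]]; last by apply; rewrite ltry.
exists (fine (ellnorm p w c)); first by rewrite fine_ge0 // ellnorm_ge0.
by rewrite fineK // ge0_fin_numE // ellnorm_ge0.
Qed.

Lemma ellnorm0 c : ellnorm 0%E w c = ellnorm +oo%E w c.
Proof. by rewrite /ellnorm /= eqxx. Qed.

(** An l^p bound involves finitely many entries at a time. The slack is a factor because [powR] is
    multiplicative; an additive error per entry would accumulate with the size of [F]. *)
Lemma lp_le_fin p c M : (0 <= p)%E -> 0 <= M ->
  (forall (F : {fset I}) e, 0 < e -> exists2 d, lp_le p d M &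
     forall k, k \in F -> wabs c k <= (1 + e) * wabs d k) ->
  (ellnorm p w c <= M%:E)%E.
Proof.
move=> p0 M0 h; apply/lee_addgt0Pr => e e0.
pose e1 := e / (M + 1); have M1 : 0 < M + 1 by rewrite ltr_wpDl.
have e10 : 0 < e1 by rewrite divr_gt0.
apply: (@le_trans _ _ ((1 + e1) * M)%:E); last first.
  rewrite -EFinD lee_fin mulrDl mul1r lerD2l /e1 mulrAC ler_pdivrMr //.
  by rewrite ler_wpM2l ?ltW // ltrDl.
have e11 : 0 <= 1 + e1 by rewrite addr_ge0 // ltW.
apply/ellnorm_leP => //; first by rewrite mulr_ge0.
case: p p0 h => [r| |] // p0 h; rewrite /lp_le in h *.
  case: ifPn => r0 in h *.
    move=> k; have [d dM hd] := h [fset k]%fset _ e10.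
    apply: le_trans (hd k _) _; first by rewrite in_fset1.
    by rewrite ler_wpM2l.
  have {}r0 : 0 < r by rewrite lt_def r0.
  move=> F; have [d dM hd] := h F _ e10.
  rewrite powRM // (le_trans _ (ler_wpM2l (powR_ge0 _ _) (dM F))) // mulr_sumr.
  rewrite !big_seq; apply: ler_sum => k kF; rewrite -powRM ?wabs_ge0 //.
  by apply: ler_powRl; rewrite ?wabs_ge0 ?hd.
move=> k; have [d dM hd] := h [fset k]%fset _ e10.
apply: le_trans (hd k _) _; first by rewrite in_fset1.
by rewrite ler_wpM2l.
Qed.

Lemma ellnorm_fatou p (u : nat -> I -> H) c M : (0 <= p)%E -> 0 <= M ->
  (forall n, ellnorm p w (u n) <= M%:E)%E ->
  (forall k, u n k @[n --> \oo] --> c k) -> (ellnorm p w c <= M%:E)%E.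
Proof.
move=> p0 M0 uM uc; apply: lp_le_fin => // F e e0.
have /filter_ex[n hn] :
    \oo (\bigcap_(k in [set` F]) [set n | wabs c k <= (1 + e) * wabs (u n) k]).
  apply: filter_bigI => k _.
  have [c0|c0] := eqVneq (c k) 0.
    exists 0%N => // n _ /=; rewrite {1}/wabs c0 hnorm0 mul0r mulr_ge0 ?wabs_ge0 //.
    by rewrite addr_ge0 // ltW.
  have ck : 0 < hnorm (c k) by rewrite lt_def hnorm_eq0 c0 hnorm_ge0.
  (* If |c_k - u_k| < e / (1 + e) |c_k|, then |c_k| <= (1 + e) |u_k|. A zero entry leaves no room
     for a relative error and is treated apart. *)
  have e1 : 0 < e / (1 + e) * hnorm (c k).
    by rewrite mulr_gt0 // divr_gt0 // addr_gt0.
  have /cvg_hnormP/(_ _ e1) := uc k; apply: filterS => n /= hn.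
  rewrite /wabs mulrA ler_wpM2r ?(ltW (w_gt0 k)) //.
  have := hnorm_le_sub (c k) (u n k).
  have : hnorm (c k - u n k) * (1 + e) < e * hnorm (c k).
    by rewrite -ltr_pdivlMr ?addr_gt0 // mulrAC.
  move: (hnorm (c k - _)) (hnorm (c k)) (hnorm (u n k)) => x y z h1 h2.
  have : (1 + e) * y <= (1 + e) * (z + x) by rewrite ler_wpM2l // addr_ge0 // ltW.
  lra.
by exists (u n) => //; apply/ellnorm_leP.
Qed.

Lemma ellnorm_mono p c d (s M : R) : (0 <= p)%E -> 0 <= s -> 0 <= M ->
  (forall k, hnorm (d k) <= s * hnorm (c k)) ->
  (ellnorm p w c <= M%:E)%E -> (ellnorm p w d <= (s * M)%:E)%E.
Proof.
move=> p0 s0 M0 h; have h' k : wabs d k <= s * wabs c k.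
  by rewrite /wabs mulrA ler_wpM2r ?h // ltW.
move/ellnorm_leP => /(_ p0 M0) hc; apply/ellnorm_leP => //; first exact: mulr_ge0.
case: p p0 hc => [r| |] // p0; rewrite /lp_le.
  case: ifPn => r0 hc.
    by move=> k; apply: le_trans (h' k) _; rewrite ler_wpM2l.
  have {}r0 : 0 < r by rewrite lt_def r0.
  move=> F; rewrite powRM // (le_trans _ (ler_wpM2l (powR_ge0 _ _) (hc F))) //.
  rewrite mulr_sumr; apply: ler_sum => k _; rewrite -powRM ?wabs_ge0 //.
  by apply: ler_powRl; rewrite ?wabs_ge0.
by move=> hc k; apply: le_trans (h' k) _; rewrite ler_wpM2l.
Qed.

(** Without convexity, hence for every r > 0. Let s = (1 + e)^r - 1 = t^r. If y <= t x, the factor 1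
    + e absorbs y^r; otherwise x^r <= s^-1 y^r, and K^r = s^-1 + 1 absorbs x^r. *)
Lemma powR_sum_le (r e : R) : 0 < r -> 0 < e -> exists2 K, 0 < K & forall x y : R,
  0 <= x -> 0 <= y -> x `^ r + y `^ r <= ((1 + e) * x + K * y) `^ r.
Proof.
move=> r0 e0; have r'0 : 0 <= r by exact: ltW.
have rI (x : R) : 0 <= x -> (x `^ r^-1) `^ r = x.
  by move=> x0; rewrite -powRrM mulVf ?powRr1 // gt_eqF.
have e1 : 0 < 1 + e by rewrite addr_gt0.
have pe : 0 < (1 + e) `^ r - 1.
  have : (1 : R) `^ r < (1 + e) `^ r.
    by apply: gt0_ltr_powR; rewrite ?nnegrE ?ltrDl ?(ltW e1).
  by rewrite powR1 subr_gt0.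
pose s := (1 + e) `^ r - 1; pose t := s `^ r^-1.
have t0 : 0 < t by rewrite powR_gt0.
have tr : t `^ r = s by rewrite rI // ltW.
pose K := (s^-1 + 1) `^ r^-1.
have s1 : 0 < s^-1 + 1 by rewrite addr_gt0 // invr_gt0.
have K0 : 0 < K by rewrite powR_gt0.
have Kr : K `^ r = s^-1 + 1 by rewrite rI // ltW.
exists K => // x y x0 y0.
have [yx|xy] := leP y (t * x).
  apply: (@le_trans _ _ (((1 + e) * x) `^ r)); last first.
    by apply: ler_powRl; rewrite ?mulr_ge0 ?lerDl ?mulr_ge0 ?(ltW e1) ?(ltW K0).
  have : y `^ r <= (t * x) `^ r.
    exact: ler_powRl.
  rewrite !powRM ?(ltW t0) ?(ltW e1) // tr /s; lra.
apply: (@le_trans _ _ ((K * y) `^ r)); last first.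
  by apply: ler_powRl; rewrite ?mulr_ge0 ?lerDr ?mulr_ge0 ?(ltW e1) ?(ltW K0).
have : (t * x) `^ r <= y `^ r.
  by apply: ler_powRl; rewrite ?mulr_ge0 ?(ltW t0) ?(ltW xy).
rewrite !powRM ?(ltW t0) ?(ltW K0) // tr Kr => h; rewrite [leRHS]mulrDl mul1r.
by rewrite lerD2r ler_pdivlMl.
Qed.

Lemma hnormD_or (e : R) (x y : H) : 0 < e ->
  hnorm (x + y) <= (1 + e) * hnorm x \/ hnorm (x + y) <= (1 + e^-1) * hnorm y.
Proof.
move=> e0; have := ler_hnormD x y; have [h|h] := leP (hnorm y) (e * hnorm x).
  by left; lra.
right; have : hnorm x <= e^-1 * hnorm y by rewrite ler_pdivlMl // ltW.
lra.
Qed.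

(* Replaces the triangle inequality, uniformly in p. *)
Lemma ellnormD_le p (e : R) : (0 <= p)%E -> 0 < e -> exists2 K, 0 < K &
  forall c d M N, 0 <= M -> 0 <= N ->
  (ellnorm p w c <= M%:E)%E -> (ellnorm p w d <= N%:E)%E ->
  (ellnorm p w (c + d)%R <= ((1 + e) * M + K * N)%:E)%E.
Proof.
move=> p0 e0.
have sup_case : exists2 K, 0 < K & forall c d M N, 0 <= M -> 0 <= N ->
  (forall k, wabs c k <= M) -> (forall k, wabs d k <= N) ->
  (forall k, wabs (c + d) k <= (1 + e) * M + K * N).
  exists 1 => // c d M N M0 N0 hc hd k.
  apply: (@le_trans _ _ (wabs c k + wabs d k)).
    by rewrite /wabs -mulrDl ler_wpM2r ?ler_hnormD // ltW.
  rewrite mul1r lerD // (le_trans (hc k)) // mulrDl mul1r lerDl.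
  by rewrite mulr_ge0 // ltW.
have fold K : 0 < K -> (forall c d M N, 0 <= M -> 0 <= N ->
    lp_le p c M -> lp_le p d N -> lp_le p (c + d) ((1 + e) * M + K * N)) ->
  forall c d M N, 0 <= M -> 0 <= N ->
  (ellnorm p w c <= M%:E)%E -> (ellnorm p w d <= N%:E)%E ->
  (ellnorm p w (c + d)%R <= ((1 + e) * M + K * N)%:E)%E.
  move=> K0 h c d M N M0 N0 /ellnorm_leP => /(_ p0 M0) hc /ellnorm_leP => /(_ p0 N0) hd.
  apply/ellnorm_leP => //; last exact: h.
  by rewrite addr_ge0 // mulr_ge0 // ?(ltW K0) // addr_ge0 // ltW.
case: p p0 fold => [r| |] // p0 fold; last first.
  by have [K K0 hK] := sup_case; exists K => //; exact: fold.
have [r0|r0] := eqVneq r 0.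
  have [K K0 hK] := sup_case; exists K => //; apply: fold => // c d M N.
  by rewrite /lp_le r0 eqxx; exact: hK.
have {}r0 : 0 < r by rewrite lt_def r0.
(* The factor 1 + e1 is lost twice, entrywise in [hnormD_or] and for the sums in [powR_sum_le];
   hence (1 + e1)^2 = 1 + e. *)
pose e1 := Num.sqrt (1 + e) - 1.
have se : 1 < Num.sqrt (1 + e) by rewrite -{1}sqrtr1 ltr_sqrt ?ltrDl // addr_gt0.
have e10 : 0 < e1 by rewrite subr_gt0.
have E1 : (1 + e1) ^+ 2 = 1 + e.
  by rewrite /e1 addrC subrK sqr_sqrtr // addr_ge0 // ltW.
have [K K0 hK] := powR_sum_le r0 e10.
have e2 : 0 < 1 + e1^-1 by rewrite addr_gt0 // invr_gt0.
exists (K * (1 + e1^-1)); first by rewrite mulr_gt0.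
apply: fold => [|c d M N M0 N0]; first by rewrite mulr_gt0.
rewrite /lp_le gt_eqF // => hc hd F.
have e3 : 0 <= 1 + e1 by rewrite addr_ge0 // ltW.
apply: (@le_trans _ _ (((1 + e1) * M) `^ r + ((1 + e1^-1) * N) `^ r)); last first.
  apply: le_trans (hK _ _ _ _) _; rewrite ?mulr_ge0 ?(ltW e2) //.
  by rewrite !mulrA -expr2 E1.
rewrite !powRM ?(ltW e2) //.
apply: (@le_trans _ _ ((1 + e1) `^ r * (\sum_(k <- F) wabs c k `^ r) +
     (1 + e1^-1) `^ r * (\sum_(k <- F) wabs d k `^ r))); last first.
  by rewrite lerD // ler_wpM2l ?powR_ge0.
rewrite !mulr_sumr -big_split; apply: ler_sum => k _ /=.
rewrite -!powRM ?wabs_ge0 ?(ltW e2) //.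
have [h|h] := hnormD_or (c k) (d k) e10.
  apply: ler_wpDr; first exact: powR_ge0.
  apply: ler_powRl => //; first exact: wabs_ge0.
  by rewrite /wabs mulrA ler_wpM2r // ltW.
apply: ler_wpDl; first exact: powR_ge0.
apply: ler_powRl => //; first exact: wabs_ge0.
by rewrite /wabs mulrA ler_wpM2r // ltW.
Qed.

Lemma wabs_le_ellnorm p c M k : (0 <= p)%E -> 0 <= M ->
  (ellnorm p w c <= M%:E)%E -> wabs c k <= M.
Proof.
move=> p0 M0 /ellnorm_leP => /(_ p0 M0); case: p p0 => [r| |] // p0; rewrite /lp_le //.
case: ifPn => // r0; have {}r0 : 0 < r by rewrite lt_def r0.
move/sum_bounded_ge1 => /(_ k); rewrite leNgt => h; rewrite leNgt; apply: contra h => h.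
by apply: gt0_ltr_powR; rewrite ?nnegrE ?wabs_ge0.
Qed.

Lemma hnorm_le_ellnorm p c M k : (0 <= p)%E -> 0 <= M ->
  (ellnorm p w c <= M%:E)%E -> hnorm (c k) <= (w k)^-1 * M.
Proof.
by move=> p0 M0 /(wabs_le_ellnorm k p0 M0); rewrite ler_pdivlMl // mulrC.
Qed.

Lemma ellnormoo_le p c M : (0 <= p)%E -> 0 <= M ->
  (ellnorm p w c <= M%:E)%E -> (ellnorm +oo%E w c <= M%:E)%E.
Proof.
move=> p0 M0 h; apply/ellnorm_leP => // k; exact: wabs_le_ellnorm h.
Qed.

Definition trunc c F : I -> H := fun k => if k \in F then c k else 0.

Lemma trunc_ell00 c F : ell00 (trunc c F).
Proof.
apply: (@sub_finite_set _ _ [set` F]); last exact: finite_fset.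
by move=> k /=; rewrite /trunc; case: ifP => //; rewrite eqxx.
Qed.

Lemma ell00P c : ell00 c -> exists F : {fset I}, forall k, k \notin F -> c k = 0.
Proof.
move=> fc; exists (fset_set [set k | c k != 0]) => k; rewrite in_fset_set //.
by rewrite notin_setE /= => /negP; rewrite negbK => /eqP.
Qed.

Lemma ell00_lin (a : R[i]) c d : ell00 c -> ell00 d -> ell00 (a *: c + d).
Proof.
move=> fc fd; apply: (@sub_finite_set _ _ ([set k | c k != 0] `|` [set k | d k != 0])).
  move=> k /=; rewrite -[(_ + d) k]/(a *: c k + d k).
  have [->|] := eqVneq (c k) 0; last by left.
  by rewrite scaler0 add0r; right.
by rewrite finite_setU.
Qed.

Lemma ellnorm_fin p c : (0 <= p)%E -> ell00 c ->
  exists2 M, 0 <= M & (ellnorm p w c <= M%:E)%E.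
Proof.
move=> p0 /ell00P[F c0].
have supc : exists2 M, 0 <= M & forall k, wabs c k <= M.
  exists (\sum_(k <- F) wabs c k) => [|k].
    by apply: sumr_ge0 => k _; exact: wabs_ge0.
  have [kF|/c0 ck] := boolP (k \in F).
    by apply: sum_fset_ge1 => // i; exact: wabs_ge0.
  by rewrite {1}/wabs ck hnorm0 mul0r; apply: sumr_ge0 => i _; exact: wabs_ge0.
case: p p0 => [r| |] // p0; last first.
  by have [M M0 h] := supc; exists M => //; apply/ellnorm_leP.
have [r0|r0] := eqVneq r 0.
  have [M M0 h] := supc; exists M => //; apply/ellnorm_leP => //.
  by rewrite /lp_le r0 eqxx.
have {}r0 : 0 < r by rewrite lt_def r0.
pose N := \sum_(k <- F) wabs c k `^ r.
have N0 : 0 <= N by apply: sumr_ge0 => k _; exact: powR_ge0.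
exists (N `^ r^-1); first exact: powR_ge0.
apply/ellnorm_leP; rewrite ?powR_ge0 //.
rewrite /lp_le gt_eqF // -powRrM mulVf ?gt_eqF // powRr1 // => G.
apply: (@le_trans _ _ (\sum_(k <- (F `|` G)%fset) wabs c k `^ r)).
  by apply: sum_fset_le (fsubsetUr _ _) => k; exact: powR_ge0.
rewrite (sum_fset_sub (fsubsetUl F G)) // => k _ /c0 ck.
by rewrite /wabs ck hnorm0 mul0r powR0 // gt_eqF.
Qed.

Lemma ell_fin p c : (0 <= p)%E -> ell p w c ->
  exists2 M, 0 <= M & (ellnorm p w c <= M%:E)%E.
Proof.
move=> p0; rewrite /ell; case: ifPn => [/eqP -> [h _]|_ /= h].
  by apply/ellnorm_lty => //; rewrite ellnorm0.
exact/ellnorm_lty.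
Qed.

Lemma ell_lty p c : p != 0%E -> ell p w c <-> (ellnorm p w c < +oo)%E.
Proof. by rewrite /ell => /negbTE ->. Qed.

Lemma ell0P c : ell 0%E w c <-> (exists2 M, 0 <= M & (ellnorm 0%E w c <= M%:E)%E) /\
  forall e, 0 < e -> exists2 g, ell00 g & (ellnorm 0%E w (c - g)%R <= e%:E)%E.
Proof.
rewrite /ell eqxx; split=> [[h1 h2]|[h1 h2]]; split.
- by apply/ellnorm_lty => //; rewrite ellnorm0.
- by move=> e /h2[g fg h]; exists g => //; rewrite ellnorm0 ltW.
- by rewrite -ellnorm0; apply/ellnorm_lty.
- move=> e e0; have [|g fg h] := h2 (e / 2); first by rewrite divr_gt0.
  by exists g => //; rewrite -ellnorm0; apply: le_lt_trans h _; rewrite lte_fin; lra.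
Qed.

Lemma ell00_ell p c : (0 <= p)%E -> ell00 c -> ell p w c.
Proof.
move=> p0 fc; have [/eqP e|pn0] := boolP (p == 0%E).
  rewrite e in p0 *; apply/ell0P; split; first exact: ellnorm_fin.
  move=> e1 e10; exists c => //; rewrite subrr.
  apply/ellnorm_leP; rewrite ?(ltW e10) //.
  by rewrite /lp_le /= eqxx => k; rewrite /wabs hnorm0 mul0r ltW.
by apply/ell_lty => //; apply/ellnorm_lty => //; exact: ellnorm_fin.
Qed.

Lemma ell_lin p (a : R[i]) c d : (0 <= p)%E -> ell p w c -> ell p w d ->
  ell p w (a *: c + d).
Proof.
move=> p0 hc hd.
have Z (x : I -> H) M : 0 <= M -> (ellnorm p w x <= M%:E)%E ->
    (ellnorm p w (a *: x)%R <= (cabs a * M)%:E)%E.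
  move=> M0; apply: ellnorm_mono => //; first exact: cabs_ge0.
  by move=> k; rewrite -[(a *: x) k]/(a *: x k) hnormZ.
have [K K0 hK] := ellnormD_le p0 ltr01.
have fin : exists2 M, 0 <= M & (ellnorm p w (a *: c + d)%R <= M%:E)%E.
  have [M M0 hM] := ell_fin p0 hc; have [N N0 hN] := ell_fin p0 hd.
  eexists; last by apply: (hK _ _ _ _ _ _ (Z _ _ M0 hM) hN) => //; rewrite mulr_ge0 ?cabs_ge0.
  by rewrite addr_ge0 // !mulr_ge0 ?cabs_ge0 // ?addr_ge0 // ltW.
have [/eqP e|pn0] := boolP (p == 0%E); last first.
  by apply/ell_lty => //; apply/ellnorm_lty.
rewrite e in hc hd fin Z p0 hK *; apply/ell0P; split=> // e1 e10.
have [_ h1] := (ell0P _).1 hc; have [_ h2] := (ell0P _).1 hd.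
have a1 : 0 < cabs a + 1 by rewrite ltr_wpDl // cabs_ge0.
have [|g fg hg] := h1 (e1 / (2 * (1 + 1) * (cabs a + 1))).
  by rewrite divr_gt0 ?mulr_gt0.
have [|g' fg' hg'] := h2 (e1 / (2 * K)); first by rewrite divr_gt0 // mulr_gt0.
exists (a *: g + g'); first exact: ell00_lin.
rewrite opprD addrACA -scalerBr.
have eg : 0 <= e1 / (2 * (1 + 1) * (cabs a + 1)).
  by rewrite divr_ge0 ?mulr_ge0 ?(ltW a1) ?(ltW e10).
apply: le_trans (hK _ _ _ _ _ _ (Z _ _ eg hg) hg') _.
- by rewrite mulr_ge0 ?cabs_ge0.
- by rewrite divr_ge0 ?(ltW e10) // mulr_ge0 // ltW.
rewrite lee_fin.
have -> : K * (e1 / (2 * K)) = e1 / 2 by field; exact: lt0r_neq0.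
have -> : (1 + 1) * (cabs a * (e1 / (2 * (1 + 1) * (cabs a + 1)))) =
   e1 / 2 * (cabs a / (cabs a + 1)) by field; exact: lt0r_neq0.
have : e1 / 2 * (cabs a / (cabs a + 1)) <= e1 / 2 * 1.
  by rewrite ler_wpM2l ?divr_ge0 ?(ltW e10) // ler_pdivrMr // mul1r lerDl.
lra.
Qed.

Lemma ellB p c d : (0 <= p)%E -> ell p w c -> ell p w d -> ell p w (c - d).
Proof. by move=> p0 hc hd; rewrite addrC -scaleN1r; exact: ell_lin. Qed.

Lemma ell_closed p c : (0 <= p)%E ->
  (forall e, 0 < e -> exists2 d, ell p w d & (ellnorm p w (c - d)%R <= e%:E)%E) ->
  ell p w c.
Proof.
move=> p0 h; have [K K0 hK] := ellnormD_le p0 ltr01.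
have fin : exists2 M, 0 <= M & (ellnorm p w c <= M%:E)%E.
  have [d hd cd] := h 1 ltr01; have [M M0 dM] := ell_fin p0 hd.
  exists ((1 + 1) * M + K * 1); first by rewrite mulr1 addr_ge0 ?mulr_ge0 // ltW.
  by rewrite -[c](subrK d) addrC; exact: hK.
have [/eqP e|pn0] := boolP (p == 0%E); last first.
  by apply/ell_lty => //; apply/ellnorm_lty.
rewrite e in h fin p0 hK *; apply/ell0P; split=> // e1 e10.
have [|d hd cd] := h (e1 / 4); first by rewrite divr_gt0.
have [_ h1] := (ell0P _).1 hd.
have [|g fg hg] := h1 (e1 / (2 * K)); first by rewrite divr_gt0 // mulr_gt0.
exists g => //; rewrite -[c - g](subrKA d).
apply: le_trans (hK _ _ _ _ _ _ cd hg) _.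
- by rewrite divr_ge0 // ltW.
- by rewrite divr_ge0 ?(ltW e10) // mulr_ge0 // ltW.
rewrite lee_fin.
have -> : K * (e1 / (2 * K)) = e1 / 2 by field; exact: lt0r_neq0.
lra.
Qed.

Lemma ell_trunc p c e : (0 <= p)%E -> p != +oo%E -> ell p w c -> 0 < e ->
  exists F, forall G, (F `<=` G)%fset -> (ellnorm p w (c - trunc c G)%R <= e%:E)%E.
Proof.
move=> p0 poo hc e0.
have cE k G : (c - trunc c G) k = if k \in G then 0 else c k.
  rewrite -[LHS]/(c k - trunc c G k) /trunc; case: ifP => _; first by rewrite subrr.
  by rewrite subr0.
have [pE|pn0] := eqVneq p 0%E.
  (* Off the support [F] of [g], the sequence [c] coincides with [c - g], which is uniformly
     small. *)
  rewrite pE in hc p0 *; have [_ /(_ _ e0)[g /ell00P[F g0] hg]] := (ell0P _).1 hc.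
  exists F => G FG; apply/ellnorm_leP; rewrite ?(ltW e0) // /lp_le /= eqxx => k.
  rewrite /wabs cE; case: ifPn => kG; first by rewrite hnorm0 mul0r ltW.
  have := wabs_le_ellnorm k p0 (ltW e0) hg; rewrite /wabs.
  rewrite -[(c - g) k]/(c k - g k) g0 ?subr0 //.
  by apply: contra kG; exact: (fsubsetP FG).
case: p p0 poo hc pn0 => [r| |] // p0 _ hc pn0.
have rn0 : r != 0 by move: pn0; rewrite eqe.
have {}r0 : 0 < r by rewrite lt_def rn0.
have [M M0 /ellnorm_leP] := ell_fin p0 hc; move=> /(_ p0 M0).
rewrite /lp_le (negbTE rn0) => cM.
have [F hF] := sum_bounded_tail (fun k => powR_ge0 _ _) cM (powR_gt0 r e0).
exists F => G FG; apply/ellnorm_leP; rewrite ?(ltW e0) // /lp_le (negbTE rn0) => F1.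
apply: (@le_trans _ _ (\sum_(k <- (F1 `\` G)%fset) wabs c k `^ r)); last first.
  apply: hF => k; rewrite in_fsetD => /andP[kG _]; apply: contra kG.
  exact: (fsubsetP FG).
have z k : k \in G -> wabs (c - trunc c G) k `^ r = 0.
  by move=> kG; rewrite /wabs cE kG hnorm0 mul0r powR0.
have nz k : k \notin G -> wabs (c - trunc c G) k `^ r = wabs c k `^ r.
  by move=> kG; rewrite /wabs cE (negbTE kG).
rewrite (sum_fset_sub (F := (F1 `\` G)%fset)).
- by rewrite !big_seq; apply: ler_sum => k; rewrite in_fsetD => /andP[kG _]; rewrite nz.
- exact: fsubsetDl.
- move=> k kF1; rewrite in_fsetD kF1 andbT negbK; exact: z.
Qed.

End WeightedNorms.

(** * Matrices acting on weighted sequence spaces *)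

Section MatrixAction.
Context {R : realType} {H : hilbertType R} {I : choiceType}.
Variable w : I -> R.
Hypothesis w_gt0 : forall k, 0 < w k.
Implicit Types (p : \bar R) (A : I -> I -> H -> H) (c d : I -> H) (M : R).

Lemma mx_acts_bound p A : (0 <= p)%E -> mx_acts p w A ->
  exists2 C, 0 <= C & forall c M, ell p w c -> 0 <= M ->
    (ellnorm p w c <= M%:E)%E -> (ellnorm p w (mxapp A c) <= (C * M)%:E)%E.
Proof.
move=> p0 [_ [_ _ [C hC]]]; exists (Num.max C 0); first by rewrite le_max lexx orbT.
move=> c M ec M0 cM; apply: le_trans (hC c ec) _.
have c0 := ellnorm_ge0 w p c.
apply: (@le_trans _ _ ((Num.max C 0)%:E * ellnorm p w c)%E).
  by rewrite lee_wpmul2r // lee_fin le_max lexx.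
by rewrite EFinM lee_wpmul2l // lee_fin le_max lexx orbT.
Qed.

Lemma mx_acts_ell p A c : mx_acts p w A -> ell p w c -> ell p w (mxapp A c).
Proof. by case=> _ [h _ _]; exact: h. Qed.

Lemma mxappB p A c d : (0 <= p)%E -> mx_acts p w A -> ell p w c -> ell p w d ->
  mxapp A (c - d) = mxapp A c - mxapp A d.
Proof.
move=> p0 [_ [_ hl _]] hc hd.
by rewrite [c - d]addrC -scaleN1r hl // scaleN1r addrC.
Qed.

Lemma ell0_elloo c : ell 0%E w c -> ell +oo%E w c.
Proof.
by rewrite /ell eqxx => -[].
Qed.

(* A maps finite sequences into l^1, hence into l^0. *)
Lemma mx_acts0 A : mx_acts +oo%E w A -> mx_acts 1%E w A -> mx_acts 0%E w A.
Proof.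
move=> Aoo A1; have [soo [eoo loo [C hC]]] := Aoo.
have [K K0 hK] := mx_acts_bound le0y Aoo.
split; first by move=> c /ell0_elloo; exact: soo.
split=> [c hc|a c c' /ell0_elloo hc /ell0_elloo hc'|]; last 2 first.
- exact: loo.
- by exists C => c /ell0_elloo hc; rewrite !ellnorm0; exact: hC.
have hcoo := ell0_elloo hc.
have [[M M0 cM] happ] := (ell0P w c).1 hc.
apply/ell0P => //; split.
  exists (K * M); first exact: mulr_ge0.
  by rewrite ellnorm0; apply: hK => //; rewrite -ellnorm0.
move=> e e0; have [D D0 hD] := @ellnormD_le R H I w w_gt0 +oo%E 1 le0y ltr01.
have K1 : 0 < K + 1 by rewrite ltr_wpDl.
have eK : 0 < e / (4 * (K + 1)) by rewrite divr_gt0 // mulr_gt0.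
have [g fg hg] := happ _ eK.
have g1 : ell 1%E w g by apply: ell00_ell => //; rewrite lee_fin.
have goo : ell +oo%E w g by apply: ell00_ell => //.
have eD : 0 < e / (2 * D) by rewrite divr_gt0 // mulr_gt0.
have lee01 : (0 <= 1%:E :> \bar R)%E by rewrite lee_fin.
have one_noo : 1%:E != +oo%E :> \bar R by [].
have [F hF] := ell_trunc w_gt0 lee01 one_noo (mx_acts_ell A1 g1) eD.
have {hF} := hF _ (fsubset_refl F) => hF.
exists (trunc (mxapp A g) F); first exact: trunc_ell00.
rewrite ellnorm0 -[_ - _](subrKA (mxapp A g)) -(mxappB le0y Aoo hcoo goo).
apply: le_trans (hD _ _ (K * (e / (4 * (K + 1)))) (e / (2 * D)) _ _ _ _) _.
- by rewrite mulr_ge0 // ltW.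
- by rewrite ltW.
- apply: hK; [exact: ellB| exact: ltW|by rewrite -ellnorm0].
- by apply: (ellnormoo_le w_gt0 _ _ hF); rewrite ?lee_fin ?(ltW eD).
rewrite lee_fin.
have -> : D * (e / (2 * D)) = e / 2 by field; exact: lt0r_neq0.
have -> : (1 + 1) * (K * (e / (4 * (K + 1)))) = e / 2 * (K / (K + 1)).
  by field; exact: lt0r_neq0.
have : e / 2 * (K / (K + 1)) <= e / 2 * 1.
  by rewrite ler_wpM2l ?divr_ge0 ?(ltW e0) // ler_pdivrMr // mul1r lerDl.
lra.
Qed.

(** Nonnegative multiples of a single vector cannot cancel: the norm of a partial sum is the scalar
    sum times |h|. *)
Lemma sum_bounded_of_usummable (a : I -> R) (h : H) : h != 0 -> (forall l, 0 <= a l) ->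
  usummable (fun l => (a l)%:C%C *: h) -> exists M, sum_bounded a M.
Proof.
move=> h0 a0 /cvg_hnormP/(_ _ ltr01)/totallyP[F]; set L := lim _ => hF.
have nh : 0 < hnorm h by rewrite lt_def hnorm_eq0 h0 hnorm_ge0.
exists ((hnorm L + 1) / hnorm h) => G.
apply: (@le_trans _ _ (\sum_(l <- (F `|` G)%fset) a l)).
  exact: sum_fset_le (fsubsetUr _ _).
rewrite ler_pdivlMr //.
have -> : (\sum_(l <- (F `|` G)%fset) a l) * hnorm h =
    hnorm (summability.partial_sum (fun l => (a l)%:C%C *: h) (F `|` G)%fset).
  rewrite partial_sumE -scaler_suml -rmorph_sum hnormZ cabs_real ger0_norm //.
  by apply: sumr_ge0.
have := hF _ (fsubsetUl F G); set P := summability.partial_sum _ _ => h1.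
by have := hnorm_le_sub P L; rewrite hnorm_distC; lra.
Qed.

End MatrixAction.

(** * Absolutely summable rows and dominated convergence *)

Section SpectralAlgebra.
Context {R : realType} {H : hilbertType R} {I : choiceType}.
Variables (AA : set (I -> I -> H -> H)) (nA : (I -> I -> H -> H) -> R).
Hypothesis spA : spectral_algebra AA nA.
Implicit Types (A B : I -> I -> H -> H) (c : I -> H).

Lemma hnorm_unit : (exists2 h : H, h != 0 & hnorm h = 1) \/ (forall x : H, x = 0).
Proof.
have [[x x0]|nx] := pselect (exists x : H, x != 0); last first.
  by right=> x; apply: contrapT => /eqP x0; apply: nx; exists x.
left; have nx : hnorm x != 0 by rewrite hnorm_eq0.
have e1 : hnorm ((hnorm x)^-1%:C%C *: x) = 1.
  by rewrite hnormZ cabs_real ger0_norm ?invr_ge0 ?hnorm_ge0 // mulVf.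
by exists ((hnorm x)^-1%:C%C *: x) => //; rewrite -hnorm_eq0 e1 oner_eq0.
Qed.

Lemma opnorm_scale_le (t : R) : 0 <= t -> opnorm (fun x : H => t%:C%C *: x) <= t.
Proof.
by move=> t0; apply: opnorm_le => // x; rewrite hnormZ cabs_real ger0_norm.
Qed.

Lemma sa_abs A : AA A -> AA (fun k l x => (opnorm (A k l))%:C%C *: x).
Proof.
move=> hA; apply: (sa_solid spA hA _ _).1 => k l; first exact: bounded_op_scale.
exact/opnorm_scale_le/opnorm_ge0/(sa_entries spA).
Qed.

(* The matrix |A| = [|A_kl| id] belongs to the algebra, and it acts on the
   sequence w^-1 h. *)
Lemma row_absolute (w : I -> R) A k : (forall k, 0 < w k) -> AA A ->
  (forall B, AA B -> mx_acts +oo%E w B) ->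
  exists M, sum_bounded (fun l => opnorm (A k l) * (w l)^-1) M.
Proof.
move=> w0 hA acts; have a0 l : 0 <= opnorm (A k l) * (w l)^-1.
  apply: mulr_ge0; last by rewrite invr_ge0 ltW.
  exact/opnorm_ge0/(sa_entries spA hA).
(* In a trivial [H] there is no vector to test with, but then all operator norms vanish. *)
have [[h h0 h1]|h0] := hnorm_unit; last first.
  exists 0 => F; apply: sumr_le0 => l _; rewrite pmulr_lle0 ?invr_gt0 //.
  by apply: opnorm_le => // x; rewrite (h0 (A k l x)) hnorm0 mul0r.
have [acts1 _] := acts _ (sa_abs hA).
pose c l := (w l)^-1%:C%C *: h.
have ec : ell +oo%E w c.
  apply/ell_lty => //; apply/(ellnorm_lty) => //; exists 1 => //.
  apply/(ellnorm_leP) => // l; rewrite /wabs hnormZ h1 cabs_real mulr1.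
  by rewrite ger0_norm ?invr_ge0 ?(ltW (w0 l)) // mulVf // gt_eqF.
apply: (sum_bounded_of_usummable h0 a0).
have := acts1 _ ec k; congr usummable.
by apply/funext => l; rewrite /c scalerA rmorphM.
Qed.

Section DominatedConvergence.
Variables (w : I -> R) (A : I -> I -> H -> H) (k : I) (M K : R).
Hypotheses (w_gt0 : forall k, 0 < w k) (hA : AA A) (K0 : 0 <= K).
Hypothesis hM : sum_bounded (fun l => opnorm (A k l) * (w l)^-1) M.

Lemma dominated_term c l : wabs w c l <= K ->
  hnorm (A k l (c l)) <= K * (opnorm (A k l) * (w l)^-1).
Proof.
move=> cK; have bA := sa_entries spA hA k l.
apply: le_trans (opnormP _ bA) _.
by rewrite mulrCA ler_wpM2l ?opnorm_ge0 // ler_pdivlMr.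
Qed.

Lemma dominated_usummable c : (forall l, wabs w c l <= K) ->
  usummable (fun l => A k l (c l)).
Proof.
move=> cK; apply: (@usummable_abs _ _ _ _ (K * M)) => F.
apply: (@le_trans _ _ (K * \sum_(l <- F) opnorm (A k l) * (w l)^-1)).
  by rewrite mulr_sumr; apply: ler_sum => l _; exact: dominated_term.
by rewrite ler_wpM2l.
Qed.

Lemma wabs_cvg_le (u : nat -> I -> H) c l : (forall n, wabs w (u n) l <= K) ->
  u n l @[n --> \oo] --> c l -> wabs w c l <= K.
Proof.
move=> uK uc; rewrite /wabs -ler_pdivlMr // -[c l]subr0.
apply: (hnorm_cvg_le uc); apply: nearW => n.
by rewrite subr0 ler_pdivlMr //; exact: uK.
Qed.

Lemma mxapp_dominated_cvg (u : nat -> I -> H) c : (forall n l, wabs w (u n) l <= K) ->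
  (forall l, u n l @[n --> \oo] --> c l) ->
  mxapp A (u n) k @[n --> \oo] --> mxapp A c k.
Proof.
move=> uK uc; have cK l : wabs w c l <= K by exact: wabs_cvg_le (uK^~ l) (uc l).
have bA l := sa_entries spA hA k l.
apply/cvg_hnormP => e e0.
(* Beyond [F] the terms of [u n] and of [c] each contribute at most K times this tail, together at
   most e / 2; the finite part contributes e / 4. *)
have d0 : 0 < e / (4 * (K + 1)) by rewrite divr_gt0 // mulr_gt0 // ltr_wpDl.
have a0 l : 0 <= opnorm (A k l) * (w l)^-1.
  by rewrite mulr_ge0 ?opnorm_ge0 // invr_ge0 ltW.
have [F hF] := sum_bounded_tail a0 hM d0.
have sc : (\sum_(l <- F) A k l (u n l)) @[n --> \oo] --> \sum_(l <- F) A k l (c l).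
  by apply: cvg_big => [|l _]; [exact: add_continuous|exact: bop_cvg].
have e4 : 0 < e / 4 by rewrite divr_gt0.
have /cvg_hnormP/(_ _ e4) := sc; apply: filterS => n hn.
have su := dominated_usummable (uK n); have sC := dominated_usummable cK.
have -> : mxapp A c k - mxapp A (u n) k =
    usum (fun l => (-1) *: A k l (u n l) + A k l (c l)).
  by rewrite usum_lin // scaleN1r addrC.
have hle : hnorm (usum (fun l => (-1) *: A k l (u n l) + A k l (c l)) - 0) <=
    e / 4 + e / 2.
  apply: usum_hnorm_le_near; first exact: usummable_lin.
  exists F => G FG; rewrite subr0 (sum_fset_split _ FG).
  apply: le_trans (ler_hnormD _ _) _; apply: lerD.
    by rewrite big_split /= -scaler_sumr scaleN1r addrC ltW.
  apply: le_trans (ler_hnorm_sum _ _ _) _.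
  apply: (@le_trans _ _ (\sum_(l <- (G `\` F)%fset)
      2 * K * (opnorm (A k l) * (w l)^-1))).
    apply: ler_sum => l _; apply: le_trans (ler_hnormD _ _) _.
    rewrite scaleN1r hnormNE -mulrA mulr_natl mulr2n lerD //; exact: dominated_term.
  rewrite -mulr_sumr; apply: (@le_trans _ _ (2 * K * (e / (4 * (K + 1))))).
    rewrite ler_wpM2l ?mulr_ge0 //; apply: hF => l.
    by rewrite in_fsetD => /andP[].
  have K1 : 0 < K + 1 by rewrite ltr_wpDl.
  have -> : 2 * K * (e / (4 * (K + 1))) = e / 2 * (K / (K + 1)).
    by field; exact: lt0r_neq0.
  by rewrite ler_piMr ?divr_ge0 ?(ltW e0) // ler_pdivrMr // mul1r lerDl.
move: hle; rewrite subr0 => /le_lt_trans; apply; lra.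
Qed.

End DominatedConvergence.

End SpectralAlgebra.

(** * Square-summable sequences and matrix entries *)

Section SquareSummable.
Context {R : realType} {H : hilbertType R} {I : choiceType}.
Implicit Types (c : I -> H).

Lemma ell2_leP c (M : R) : 0 <= M ->
  (ellnorm 2%:E (fun=> 1%R) c <= M%:E)%E <->
  sum_bounded (fun k => hnorm (c k) ^+ 2) (M ^+ 2).
Proof.
have p2 : (0 <= 2%:E :> \bar R)%E by rewrite lee_fin.
move=> M0; rewrite (ellnorm_leP _ _ p2 M0).
rewrite /lp_le pnatr_eq0 /= powR_mulrn //.
have -> // : (fun k => wabs (fun=> 1) c k `^ 2) = (fun k => hnorm (c k) ^+ 2).
by apply/funext => k; rewrite /wabs mulr1 powR_mulrn // hnorm_ge0.
Qed.

Lemma ell2P c : ell2 c <-> square_summable c.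
Proof.
have n2 : 2%:E != 0%E :> \bar R by rewrite eqe pnatr_eq0.
have p2 : (0 <= 2%:E :> \bar R)%E by rewrite lee_fin.
rewrite /ell2 (ell_lty _ _ n2) (ellnorm_lty _ _ p2); split=> [[M M0 /(ell2_leP _ M0) h]|[M h]].
  by exists (M ^+ 2).
exists (Num.sqrt M) => //; apply/ell2_leP => //.
by rewrite sqr_sqrtr // (sum_bounded_ge0 h).
Qed.

Definition delta (l : I) (x : H) : I -> H := fun k => if k == l then x else 0.

Lemma delta_ell00 l x : ell00 (delta l x).
Proof.
apply: (@sub_finite_set _ _ [set l]); last exact: finite_set1.
by move=> k /=; rewrite /delta; case: ifP => [/eqP //|_]; rewrite eqxx.
Qed.

Lemma ell2_delta l x : ell2 (delta l x).
Proof. by apply: ell00_ell; [move=> _; exact: ltr01|rewrite lee_fin|exact: delta_ell00]. Qed.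

Lemma mxapp_delta (A : I -> I -> H -> H) k l x : (forall k l, bounded_op (A k l)) ->
  mxapp A (delta l x) k = A k l x.
Proof.
move=> bA; rewrite /mxapp (usum_fin (F := [fset l]%fset)).
  by rewrite big_seq_fset1 /delta eqxx.
by move=> j; rewrite in_fset1 /delta => /negbTE ->; rewrite bop0.
Qed.

Lemma mx_ext (A B : I -> I -> H -> H) : (forall k l, bounded_op (A k l)) ->
  (forall k l x, mxapp A (delta l x) k = B k l x) -> A = B.
Proof.
move=> bA h; apply/funext => k; apply/funext => l; apply/funext => x.
by rewrite -h mxapp_delta.
Qed.

End SquareSummable.

(** * Boundedness on the unit circle *)

Section CircleBound.
Context {R : realType}.
Variables (f : R[i] -> R) (K : R).
Hypothesis f0 : forall u, cabs u = 1 -> 0 <= f u.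
Hypothesis K0 : 0 <= K.
Hypothesis fK : forall u v, cabs u = 1 -> cabs v = 1 ->
  f u <= f v + cabs (u - v) * K * f u * f v.

(** [fK] is the shape in which the resolvent identity bounds the norm [f u] of a resolvent. For [u]
    close to [v] the product term is at most f u / 2; absorbing it shows that [f] at most
    doubles. *)
Let circle_local_bound u v : cabs u = 1 -> cabs v = 1 ->
  cabs (u - v) < (2 * (K * f v + 1))^-1 -> f u <= 2 * f v.
Proof.
move=> u1 v1; have Kf : 0 <= K * f v by rewrite mulr_ge0 // f0.
rewrite -[X in _ < X]mul1r ltr_pdivlMr ?mulr_gt0 ?ltr_wpDl // => h.
have h1 : cabs (u - v) * (K * f v) <= 1 / 2.
  have := cabs_ge0 (u - v); move: h; lra.
have := fK u1 v1; have := f0 u1.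
have : cabs (u - v) * (K * f v) * f u <= 1 / 2 * f u by rewrite ler_wpM2r // f0.
have -> : cabs (u - v) * K * f u * f v = cabs (u - v) * (K * f v) * f u by ring.
lra.
Qed.

(** Near each [s] the values stay below 2 f (g s). Compactness, in its near-covering form with the
    bound [n] as parameter, makes one [n] work on the whole interval. *)
Lemma circle_bounded_param (g : R -> R[i]) :
  (forall t, -1 <= t <= 1 -> cabs (g t) = 1) ->
  (forall s e, 0 < e -> \forall t \near s, cabs (g t - g s) < e) ->
  exists M, forall t, -1 <= t <= 1 -> f (g t) <= M.
Proof.
move=> g1 gc; have := @segment_compact R (-1) 1.
move/compact_near_coveringP => /(_ nat \oo (fun n t => -1 <= t <= 1 -> f (g t) <= n%:R)).
case=> [s|N _ hN].
  rewrite /= in_itv /= => s1; have Kf : 0 <= K * f (g s) by rewrite mulr_ge0 // f0 // g1.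
  have e0 : 0 < (2 * (K * f (g s) + 1))^-1 by rewrite invr_gt0 mulr_gt0 // ltr_wpDl.
  pose N := (Num.truncn (2 * f (g s))).+1.
  exists ([set t | cabs (g t - g s) < (2 * (K * f (g s) + 1))^-1], [set n | (N <= n)%N]).
    by split; [exact: gc|exists N].
  move=> [t n] /= [ht hn] t1; apply: le_trans (circle_local_bound (g1 _ t1) (g1 _ s1) ht) _.
  apply: (@le_trans _ _ N%:R); last by rewrite ler_nat.
  by rewrite ltW // truncnS_gt.
exists N%:R => t t1; exact: (hN N (leqnn N)).
Qed.

(** The circle as two graphs over its real part [t], with [s] the sign of the imaginary part. *)
Definition circle_arc (s : R) (t : R) : R[i] := (t +i* (s * Num.sqrt (1 - t ^+ 2)))%C.

Lemma circle_arc_cabs s t : s ^+ 2 = 1 -> -1 <= t <= 1 -> cabs (circle_arc s t) = 1.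
Proof.
move=> s1 t1; apply/eqP; rewrite -(eqrXn2 (n := 2)) ?cabs_ge0 // cabs_sqr /=.
rewrite exprMn s1 mul1r sqr_sqrtr ?expr1n ?[_ + (1 - _)]addrC ?subrK //.
by move: t1 => /andP[? ?]; nra.
Qed.

Lemma circle_arc_cont s x e : s ^+ 2 = 1 -> 0 < e ->
  \forall t \near x, cabs (circle_arc s t - circle_arc s x) < e.
Proof.
move=> s1 e0; have e2 : 0 < e / 2 by rewrite divr_gt0.
have c1 : (fun t : R => Num.sqrt (1 - t ^+ 2)) t @[t --> x] --> Num.sqrt (1 - x ^+ 2).
  apply: (@continuous_comp _ _ _ (fun t : R => 1 - t ^+ 2)); last exact: sqrt_continuous.
  by apply: cvgB; [exact: cvg_cst|exact: exprn_continuous].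
have c2 : id t @[t --> x] --> x by exact: cvg_id.
move/cvgrPdist_lt : c1 => /(_ _ e2) h1; move/cvgrPdist_lt : c2 => /(_ _ e2) h2.
apply: filterS (filterI h1 h2) => t [k1 k2].
have -> : circle_arc s t - circle_arc s x = (t - x)%:C%C +
   'i%C * (s * (Num.sqrt (1 - t ^+ 2) - Num.sqrt (1 - x ^+ 2)))%:C%C.
  apply/eqP; rewrite eq_complex /=; apply/andP; split; apply/eqP; ring.
apply: le_lt_trans (cabsD _ _) _; rewrite [e]splitr cabsM !cabs_real normrM.
have -> : cabs 'i%C = 1 :> R.
  by apply/eqP; rewrite -(eqrXn2 (n := 2)) ?cabs_ge0 // cabs_sqr /= expr0n add0r !expr1n.
have -> : `|s| = 1.
  by apply/eqP; rewrite -(eqrXn2 (n := 2)) // real_normK ?num_real // s1 expr1n.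
by rewrite !mul1r ltrD // distrC.
Qed.

Lemma circle_arcP (u : R[i]) : cabs u = 1 ->
  -1 <= complex.Re u <= 1 /\
  exists2 s, s = 1 \/ s = -1 & u = circle_arc s (complex.Re u).
Proof.
move=> u1; split; first by rewrite -ler_norml -u1 normRe_le_cabs.
have hb : complex.Im u ^+ 2 = 1 - complex.Re u ^+ 2.
  by have := cabs_sqr u; rewrite u1 expr1n; lra.
case: u u1 hb => a b u1 /= hb.
exists (if 0 <= b then 1 else -1); first by case: ifP; [left|right].
rewrite /circle_arc -hb sqrtr_sqr; congr Complex.
case: ifPn => b0; first by rewrite mul1r ger0_norm.
by rewrite mulN1r ltr0_norm ?opprK // ltNge.
Qed.

Lemma circle_bounded : exists M, forall u, cabs u = 1 -> f u <= M.
Proof.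
have arc s : s = 1 \/ s = -1 -> exists M, forall t, -1 <= t <= 1 -> f (circle_arc s t) <= M.
  move=> hs; have s1 : s ^+ 2 = 1 by case: hs => ->; rewrite ?sqrrN expr1n.
  apply: circle_bounded_param => [t t1|x e e0]; first exact: circle_arc_cabs.
  exact: circle_arc_cont.
have [M1 h1] := arc 1 (or_introl erefl); have [M2 h2] := arc (-1) (or_intror erefl).
exists (Num.max M1 M2) => u /circle_arcP[ru [s [] -> ->]]; rewrite le_max.
  by rewrite h1.
by rewrite h2 // orbT.
Qed.

End CircleBound.

(** * Inversion of 1 + C_T Y D_T inside the algebra *)

Section GramAlgebra.
Context {R : realType} {H : hilbertType R} {I : choiceType}.
Variables (AA : set (I -> I -> H -> H)) (nA : (I -> I -> H -> H) -> R).
Variable T : I -> H -> H.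
Hypothesis spA : spectral_algebra AA nA.
Hypothesis gT : gframe T.
Hypothesis locT : localized AA T T.
Local Notation S := (frame_op T).
Local Notation gram := (gram T).
Local Notation D := (synthesis T).
Implicit Types (Y Z : H -> H) (c : I -> H).

Let bT k : bounded_op (T k) := gframe_bounded_op gT k.

(** The matrix 1 + C_T Y D_T. Composing those for [Y] and [Z] gives the one for Z + Y + Y S Z, so an
    inverse on l^2 amounts to two equations in B(H). *)
Definition unit_gram Y : I -> I -> H -> H := (mxone : I -> I -> H -> H) + gram Y.

Lemma unit_gramE Y k l x : unit_gram Y k l x = mxone k l x + T k (Y (adj (T l) x)).
Proof. by []. Qed.

Lemma mxone_bounded_op k l : bounded_op (@mxone R H I k l).
Proof.
by rewrite /mxone; case: eqP => _; [exact: bounded_op_id|exact: bounded_op0].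
Qed.

Lemma unit_gram_bounded_op Y k l : bounded_op Y -> bounded_op (unit_gram Y k l).
Proof.
move=> bY; have := bounded_op_lin 1 (mxone_bounded_op k l) (gram_bounded_op gT k l bY).
congr bounded_op; by apply/funext => x; rewrite scale1r.
Qed.

Lemma mxone_cvg c k : usummable (fun l => mxone k l (c l)) /\
  usum (fun l => mxone k l (c l)) = c k.
Proof.
have h l : l \notin [fset k]%fset -> mxone k l (c l) = 0.
  by rewrite in_fset1 eq_sym /mxone => /negbTE ->.
split; first exact: usummable_ex (usummable_fin h).
by rewrite (usum_fin h) big_seq_fset1 /mxone eqxx.
Qed.

Lemma mxapp_unit_gram Y c k : bounded_op Y -> square_summable c ->
  mxapp (unit_gram Y) c k = c k + T k (Y (D c)).
Proof.
move=> bY sc; have [s1 e1] := mxone_cvg c k.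
rewrite -(mxapp_gram gT k bY sc) /mxapp -{1}e1.
rewrite -[X in X + _]scale1r -usum_lin //; last exact: gram_usummable.
by congr usum; apply/funext => l; rewrite scale1r.
Qed.

Lemma square_summableD c d : square_summable c -> square_summable d ->
  square_summable (c + d).
Proof.
case=> M hM [N hN]; exists (2 * M + 2 * N) => F.
apply: (@le_trans _ _ (2 * (\sum_(k <- F) hnorm (c k) ^+ 2) +
    2 * \sum_(k <- F) hnorm (d k) ^+ 2)); last by rewrite lerD // ler_pM2l.
rewrite !mulr_sumr -big_split; apply: ler_sum => k _ /=.
have h : hnorm ((c + d) k) ^+ 2 <= (hnorm (c k) + hnorm (d k)) ^+ 2.
  by rewrite lerXn2r ?nnegrE ?addr_ge0 ?hnorm_ge0 ?ler_hnormD.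
have := sqr_ge0 (hnorm (c k) - hnorm (d k)); move: h; lra.
Qed.

Lemma square_summable_unit_gram Y c : bounded_op Y -> square_summable c ->
  square_summable (mxapp (unit_gram Y) c).
Proof.
move=> bY sc; have -> : mxapp (unit_gram Y) c = c + analysis T (Y (D c)).
  by apply/funext => k; rewrite mxapp_unit_gram.
by apply: square_summableD => //; exact: square_summable_analysis.
Qed.

Lemma synthesisD c d : square_summable c -> square_summable d -> D (c + d) = D c + D d.
Proof.
move=> sc sd; rewrite -[D c]scale1r /synthesis.
rewrite -usum_lin; try exact: gframe_usummable.
congr usum; apply/funext => k; rewrite scale1r.
exact: bopD (adj_bounded_op (bT k)).
Qed.

Lemma synthesisZ (a : R[i]) c : square_summable c -> D (a *: c) = a *: D c.
Proof.
move=> /(gframe_usummable gT) sc.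
rewrite -(usum_bop (bounded_op_scale a) sc); congr usum; apply/funext => k.
exact: bopZ (adj_bounded_op (bT k)).
Qed.

Lemma square_summableZ (a : R[i]) c : square_summable c -> square_summable (a *: c).
Proof.
case=> M hM; exists (cabs a ^+ 2 * M) => F.
apply: (@le_trans _ _ (cabs a ^+ 2 * (\sum_(k <- F) hnorm (c k) ^+ 2))); last first.
  by rewrite ler_wpM2l // sqr_ge0.
by rewrite mulr_sumr; apply: ler_sum => k _; rewrite -exprMn -hnormZ.
Qed.

Lemma synthesis_unit_gram Y c : bounded_op Y -> square_summable c ->
  D (mxapp (unit_gram Y) c) = D c + S (Y (D c)).
Proof.
move=> bY sc; have -> : mxapp (unit_gram Y) c = c + analysis T (Y (D c)).
  by apply/funext => k; rewrite mxapp_unit_gram.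
by rewrite synthesisD //; exact: square_summable_analysis.
Qed.

Lemma mxapp_unit_gramM Y Z c k : bounded_op Y -> bounded_op Z -> square_summable c ->
  mxapp (unit_gram Y) (mxapp (unit_gram Z) c) k =
  c k + T k (Z (D c) + Y (D c) + Y (S (Z (D c)))).
Proof.
move=> bY bZ sc; have sZ := square_summable_unit_gram bZ sc.
rewrite mxapp_unit_gram // mxapp_unit_gram // synthesis_unit_gram // -addrA.
by rewrite -(bopD _ _ (bT k)) (bopD _ _ bY) addrA.
Qed.

Lemma ell_bounded_unit_gram Y : bounded_op Y ->
  ell_bounded 2%:E (fun=> 1) (mxapp (unit_gram Y)).
Proof.
move=> bY; have p2 : (0 <= 2%:E :> \bar R)%E by rewrite lee_fin.
have w1 (k : I) : 0 < 1 :> R by [].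
split=> [c /ell2P sc|a c c' /ell2P sc /ell2P sc'|].
- by apply/ell2P; exact: square_summable_unit_gram.
- apply/funext => k; have sac := square_summableZ a sc.
  rewrite mxapp_unit_gram //; last exact: square_summableD.
  rewrite -[RHS]/(a *: mxapp (unit_gram Y) c k + mxapp (unit_gram Y) c' k).
  rewrite !mxapp_unit_gram // synthesisD // synthesisZ //.
  rewrite bY.1 (bT k).1 scalerDr -[(a *: c + c') k]/(a *: c k + c' k).
  by rewrite addrACA.
have [C C0 hC] := square_summable_gram gT bY.
have [K K0 hK] := @ellnormD_le R H I _ w1 _ 1 p2 ltr01.
exists ((1 + 1) * 1 + K * Num.sqrt C) => c /(ell_fin p2)[M M0 hM].
have nn0 := ellnorm_ge0 (fun _ : I => 1 : R) 2%:E c.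
have fin : ellnorm 2%:E (fun=> 1) c \is a fin_num.
  by rewrite ge0_fin_numE //; apply: le_lt_trans hM _; rewrite ltry.
rewrite -(fineK fin) -EFinM; set m := fine _.
have m0 : 0 <= m by exact: fine_ge0.
have cm : (ellnorm 2%:E (fun=> 1%R) c <= m%:E)%E by rewrite fineK.
have cm2 := (ell2_leP _ m0).1 cm.
have sc : square_summable c by exists (m ^+ 2).
have -> : mxapp (unit_gram Y) c = c + mxapp (gram Y) c.
  apply/funext => k; rewrite mxapp_unit_gram //.
  by rewrite -[RHS]/(c k + mxapp (gram Y) c k) mxapp_gram.
rewrite mulrDl mulr1 -mulrA; apply: hK => //; first by rewrite mulr_ge0.
apply/ell2_leP; first by rewrite mulr_ge0.
rewrite exprMn sqr_sqrtr //; exact: hC.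
Qed.

(** Closedness under inversion yields some matrix of the algebra acting on l^2 as the inverse does;
    testing on sequences with a single entry identifies it with [unit_gram Z]. *)
Lemma AA_unit_gram_inv Y Z : bounded_op Y -> bounded_op Z -> AA (unit_gram Y) ->
  (forall z, Z z + Y z + Y (S (Z z)) = 0) -> (forall z, Y z + Z z + Z (S (Y z)) = 0) ->
  AA (unit_gram Z).
Proof.
move=> bY bZ hY YZ ZY.
have [|B hB BZ] := sa_inv spA hY (ell_bounded_unit_gram bZ).
  move=> c /ell2P sc; split; apply/funext => k.
    by rewrite mxapp_unit_gramM // ZY bop0 // addr0.
  by rewrite mxapp_unit_gramM // YZ bop0 // addr0.
suff -> : unit_gram Z = B by [].
have bB := sa_entries spA hB.
apply: esym; apply: mx_ext => // k l x.
rewrite BZ; last exact: ell2_delta.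
by rewrite mxapp_delta // => k' l'; exact: unit_gram_bounded_op.
Qed.

Lemma sa_scale (a : R[i]) A : AA A -> AA (a *: A).
Proof.
have z0 : AA 0.
  by have := sa_lin spA (-1) (sa_one spA) (sa_one spA); rewrite scaleN1r addNr.
by move=> hA; have := sa_lin spA a hA z0; rewrite addr0.
Qed.

Lemma sa_add A B : AA A -> AA B -> AA (A + B).
Proof. by move=> hA hB; have := sa_lin spA 1 hA hB; rewrite scale1r. Qed.

Lemma sa_sub A B : AA A -> AA B -> AA (A - B).
Proof. by move=> hA hB; rewrite -scaleN1r; apply: sa_add => //; exact: sa_scale. Qed.

Lemma sa_normN A : AA A -> nA (- A) = nA A.
Proof. by move=> hA; rewrite -scaleN1r (sa_normZ spA) // normrN normr1 mul1r. Qed.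

(* By solidity, A_kl may be replaced by a multiple of a fixed one-entry matrix. *)
Lemma sa_entry_bound k l : exists2 C, 0 <= C &
  forall A, AA A -> opnorm (A k l) <= C * nA A.
Proof.
have [[A0 [hA0 ne]]|nx] := pselect (exists A0, AA A0 /\ opnorm (A0 k l) != 0); last first.
  exists 0 => // A hA; rewrite mul0r; apply: contrapT => h; apply: nx.
  by exists A; split=> //; apply: contra_notN h => /eqP ->.
have b0 := sa_entries spA hA0 k l.
have s0 : 0 < opnorm (A0 k l) by rewrite lt_def ne opnorm_ge0.
set s := opnorm (A0 k l) in s0 ne.
pose E (t : R) : I -> I -> H -> H := fun i j x =>
  if (i == k) && (j == l) then t%:C%C *: x else 0.
have bE t i j : bounded_op (E t i j).
  rewrite /E; case: ((i == k) && (j == l)); first exact: bounded_op_scale.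
  exact: bounded_op0.
have Eop A t : AA A -> 0 <= t -> t <= opnorm (A k l) -> forall i j,
    opnorm (E t i j) <= opnorm (A i j).
  move=> hA t0 tA i j; rewrite /E.
  case: (boolP ((i == k) && (j == l))) => [/andP[/eqP -> /eqP ->]|_].
    exact: le_trans (opnorm_scale_le t0) tA.
  have b := opnorm_ge0 (sa_entries spA hA i j).
  by apply: opnorm_le => // x; rewrite hnorm0 mulr_ge0 ?hnorm_ge0.
have [hE _] := sa_solid spA hA0 (bE s) (Eop _ _ hA0 (ltW s0) (lexx _)).
have nE : 0 < nA (E s).
  rewrite lt_def (sa_norm_ge0 spA hE) andbT; apply/eqP => /(sa_norm_eq0 spA hE) E0.
  move: (s0); apply/negP; rewrite -leNgt; apply: opnorm_le => // x.
  have : E s k l x = 0 by rewrite E0.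
  rewrite /E !eqxx /= => /eqP; rewrite scaler_eq0 gt_eqF ?ltcR //= => /eqP ->.
  by rewrite bop0 // hnorm0 mul0r.
exists (s / nA (E s)) => [|A hA]; first by rewrite divr_ge0 // ltW.
set t := opnorm (A k l); have t0 : 0 <= t by exact/opnorm_ge0/(sa_entries spA hA).
have [hEt nEt] := sa_solid spA hA (bE t) (Eop _ _ hA t0 (lexx _)).
have Et : E t = (t / s)%:C%C *: E s.
  apply/funext => i; apply/funext => j; apply/funext => x.
  rewrite -[RHS]/((t / s)%:C%C *: E s i j x) /E; case: ifP => _; last by rewrite scaler0.
  by rewrite scalerA -rmorphM /= divfK.
move: nEt; rewrite Et (sa_normZ spA) // -/(cabs _) cabs_real ger0_norm; last first.
  by rewrite divr_ge0 // ltW.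
rewrite [leLHS]mulrAC ler_pdivrMr // => h.
by rewrite [leRHS]mulrAC ler_pdivlMr // [leRHS]mulrC.
Qed.

End GramAlgebra.

(** * Vector identities by pairing *)

Section PairingTactic.
Context {R : realType} {H : hilbertType R}.
Implicit Types (x y z : H).

Definition pairing z x : R[i] := inner x z.

Lemma pairingD z x y : pairing z (x + y) = pairing z x + pairing z y.
Proof. exact: innerDl. Qed.

Lemma pairingN z x : pairing z (- x) = - pairing z x.
Proof. exact: linearNl. Qed.

Lemma pairingZ z a x : pairing z (a *: x) = a * pairing z x.
Proof. exact: innerZl. Qed.

Lemma pairing0 z : pairing z 0 = 0.
Proof. exact: inner0l. Qed.

Lemma pairing_inj x y : (forall z, pairing z x = pairing z y) -> x = y.
Proof.
move=> h; apply: inner_eqr => z; rewrite innerC -[inner x z]/(pairing z x) h.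
by rewrite [RHS]innerC.
Qed.

End PairingTactic.

(* Vector identities become polynomial identities after pairing with a vector. *)
Ltac vring := apply: pairing_inj => ?;
  rewrite ?(pairingD, pairingN, pairingZ, pairing0); ring.

(** * Resolvents of the frame operator *)

Section Resolvents.
Context {R : realType} {H : hilbertType R} {I : choiceType}.
Variable T : I -> H -> H.
Hypothesis gT : gframe T.
Local Notation S := (frame_op T).

Let bS : bounded_op S := frame_op_bounded gT.

Definition resolves (c : R) (u : R[i]) (W : H -> H) :=
  [/\ bounded_op W, forall z, W z - (u * c%:C%C) *: W (S z) = z &
      forall z, W z - (u * c%:C%C) *: S (W z) = z].

(* 1 - u c S = - u (c S - u^* ), and c S - u^* is coercive. *)
Lemma resolves_ex : exists2 c : R, (forall z, 4 * hnorm z <= c * hnorm (S z)) /\ 0 < c &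
  forall u, cabs u = 1 -> exists W, resolves c u W.
Proof.
have [A0 A00 hA] := frame_op_coercive gT.
have hS := coercive_inj bS A00 hA.
(* This makes c S >= 4: subtracting a number of modulus 1 leaves coercivity constant 3, and 4 is
   also the starting value for the growth of the powers in [dop_expand]. *)
exists (4 / A0).
  split=> [z|]; last by rewrite divr_gt0.
  have := hS z; rewrite -(ler_pM2l (x := 4 / A0)) ?divr_gt0 // mulrA divfK //.
  exact: lt0r_neq0.
set c := 4 / A0 => u u1.
have uu : u * Num.conj u = 1 by rewrite -normCK -cabsE u1 expr1n.
pose B z := c%:C%C *: S z + (- Num.conj u) *: z.
have bB : bounded_op B := bounded_op_lin _ bS (bounded_op_scale _).
have coer z : 3 * hnorm z ^+ 2 <= complex.Re (inner (B z) z).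
  rewrite /B innerDl !innerZl inner_real ReD Re_realM [- _ * _]mulrC Re_realM.
  have h1 : 4 * hnorm z ^+ 2 <= c * complex.Re (inner (S z) z).
    have := hA z; rewrite -(ler_pM2l (x := c)) ?divr_gt0 // mulrA divfK //.
    exact: lt0r_neq0.
  have h2 : - 1 <= complex.Re (- Num.conj u).
    by rewrite ReN Re_conjC lerN2 -u1 Re_le_cabs.
  have : 0 <= hnorm z ^+ 2 * (complex.Re (- Num.conj u) + 1).
    by rewrite mulr_ge0 ?sqr_ge0 //; move: h2; lra.
  move: h1; move: (complex.Re _) (complex.Re _) => a b; lra.
have [J [bJ BJ JB]] := lax_milgram bB (ltr0n R 3) coer.
exists (fun z => J ((- Num.conj u) *: z)); split=> [|z|z].
- exact: bounded_op_comp bJ (bounded_op_scale _).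
- have := BJ z; rewrite /B (bopD _ _ bJ) !(bopZ _ _ bJ) => e.
  apply: pairing_inj => t; rewrite -[in RHS]e !(pairingD, pairingN, pairingZ).
  have -> : - (u * c%:C%C * (- Num.conj u * pairing t (J (S z)))) =
    (u * Num.conj u) * (c%:C%C * pairing t (J (S z))) by ring.
  rewrite uu; ring.
- have := JB ((- Num.conj u) *: z); set y := J _; rewrite /B => e.
  have : (- u) *: (c%:C%C *: S y + - Num.conj u *: y) = (- u) *: (- Num.conj u *: z).
    by rewrite e.
  rewrite !scalerDr !scalerA !mulrNN !uu !scale1r => <-.
  vring.
Qed.

End Resolvents.

(** * Resolvents of the Gram matrix on the circle *)

Section SpectralProjection.
Context {R : realType} {H : hilbertType R} {I : choiceType}.
Variables (AA : set (I -> I -> H -> H)) (nA : (I -> I -> H -> H) -> R).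
Variable T : I -> H -> H.
Hypothesis spA : spectral_algebra AA nA.
Hypothesis gT : gframe T.
Hypothesis locT : localized AA T T.
Local Notation S := (frame_op T).
Local Notation gram := (gram T).
Local Notation unit_gram := (unit_gram T).
Local Notation D := (synthesis T).

Let bT k : bounded_op (T k) := gframe_bounded_op gT k.
Let bS : bounded_op S := frame_op_bounded gT.

Lemma AA_gram_id : AA (gram id).
Proof. exact: locT. Qed.

Lemma AA_unit_gram_scale (a : R[i]) : AA (unit_gram (fun z => a *: z)).
Proof.
have := sa_add spA (sa_one spA) (sa_scale spA a AA_gram_id).
congr AA; congr (_ + _); apply/funext => k; apply/funext => l; apply/funext => x.
by rewrite -[LHS]/(a *: T k (adj (T l) x)) -bopZ.
Qed.

Variables (c : R) (W : R[i] -> H -> H).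
Hypothesis W_resolves : forall u, cabs u = 1 -> resolves T c u (W u).

(** Chosen so that (1 - u c G)^-1 = 1 + C_T Y D_T for Y = u c (1 - u c S)^-1, the push-through
    identity for G = C_T D_T and S = D_T C_T. *)
Definition res_op u z := (u * c%:C%C) *: W u z.

Lemma bounded_res_op u : cabs u = 1 -> bounded_op (res_op u).
Proof.
by case/W_resolves => bW _ _; exact: bounded_op_comp (bounded_op_scale _) bW.
Qed.

Lemma AA_res u : cabs u = 1 -> AA (unit_gram (res_op u)).
Proof.
move=> u1; have [bW WS SW] := W_resolves u1.
apply: (AA_unit_gram_inv spA gT _ (bounded_res_op u1)
    (AA_unit_gram_scale (- (u * c%:C%C)))); first exact: bounded_op_scale.
- move=> z; have := SW z; rewrite /res_op (bopZ _ _ bS) => e.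
  by rewrite -{2}e; vring.
- move=> z; have := WS z; rewrite /res_op (bopZ _ _ bS) (bopZ _ _ bW) => e.
  by rewrite -{1}e; vring.
Qed.

Lemma mxapp_scale (a : R[i]) A x : AA A -> ell2 x -> mxapp (a *: A) x = a *: mxapp A x.
Proof.
move=> hA e2; have := sa_ell2_lin spA (a - 1) hA hA e2.
by rewrite scalerBl scale1r subrK => ->; rewrite scalerBl scale1r subrK.
Qed.

(** First resolvent identity on H, from u (1 - v c S) - v (1 - u c S) = u - v. *)
Lemma res_op_sub u v x : cabs u = 1 -> cabs v = 1 ->
  res_op u x - res_op v x = ((u - v) * c%:C%C) *: W u (W v x).
Proof.
move=> u1 v1; have [bu uS Su] := W_resolves u1; have [bv vS Sv] := W_resolves v1.
rewrite /res_op -{1}(Sv x); set y := W v x.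
rewrite (bopB _ _ bu) (bopZ _ _ bu).
apply: pairing_inj => t; have := congr1 (pairing t) (uS y).
rewrite !(pairingD, pairingN, pairingZ) => e.
have -> : pairing t y = pairing t (W u y) + - (u * c%:C%C * pairing t (W u (S y))) by [].
ring.
Qed.

(** Verified on l^2, where the algebra acts faithfully. The right-hand side is a product inside the
    algebra, so that [sa_normM] can estimate it. *)
Lemma resolvent_identity u v : cabs u = 1 -> cabs v = 1 ->
  unit_gram (res_op u) - unit_gram (res_op v) =
  ((u - v) * c%:C%C) *:
    mxmul (unit_gram (res_op u)) (mxmul (gram id) (unit_gram (res_op v))).
Proof.
move=> u1 v1; have [bu uS Su] := W_resolves u1; have [bv vS Sv] := W_resolves v1.
have bZu := bounded_res_op u1; have bZv := bounded_res_op v1.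
have hu := AA_res u1; have hv := AA_res v1.
have hgv := sa_mul spA AA_gram_id hv; have hugv := sa_mul spA hu hgv.
apply: (sa_ell2_inj spA (sa_sub spA hu hv) (sa_scale spA _ hugv)) => x e2.
have sx := (ell2P x).1 e2; have sv := square_summable_unit_gram gT bZv sx.
have ev := (ell2P _).2 sv.
have Dv : D (mxapp (unit_gram (res_op v)) x) = W v (D x).
  by rewrite synthesis_unit_gram // /res_op (bopZ _ _ bS) -{1}(Sv (D x)) subrK.
have Gv : mxapp (gram id) (mxapp (unit_gram (res_op v)) x) = analysis T (W v (D x)).
  by apply/funext => k; rewrite (mxapp_gram gT _ bounded_op_id sv) Dv.
rewrite [unit_gram (res_op u) - _]addrC -scaleN1r (sa_ell2_lin spA) //.
rewrite mxapp_scale // (sa_ell2_mul spA) // (sa_ell2_mul spA AA_gram_id hv) // Gv.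
apply/funext => k.
rewrite -[LHS]/((-1) *: mxapp (unit_gram (res_op v)) x k + mxapp (unit_gram (res_op u)) x k).
rewrite !mxapp_unit_gram //.
rewrite -[RHS]/(((u - v) * c%:C%C) *: mxapp (unit_gram (res_op u)) (analysis T (W v (D x))) k).
rewrite mxapp_unit_gram //; last exact: square_summable_analysis.
rewrite -frame_opE -[analysis T _ k]/(T k (W v (D x))) -(bopD _ _ (bT k)).
have -> : W v (D x) + res_op u (S (W v (D x))) = W u (W v (D x)).
  by rewrite /res_op -{1}(uS (W v (D x))) subrK.
rewrite -(bopZ _ _ (bT k)) -res_op_sub // (bopB _ _ (bT k)).
by rewrite scaleN1r opprD addrACA addNr add0r addrC.
Qed.

Lemma res_lipschitz : exists2 L, 0 <= L & forall u v, cabs u = 1 -> cabs v = 1 ->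
  nA (unit_gram (res_op u) - unit_gram (res_op v)) <= L * cabs (u - v).
Proof.
pose f u := nA (unit_gram (res_op u)); pose K := `|c| * nA (gram id).
have f0 u : cabs u = 1 -> 0 <= f u by move=> u1; exact/(sa_norm_ge0 spA)/AA_res.
have K0 : 0 <= K by rewrite mulr_ge0 //; exact: sa_norm_ge0 spA _ AA_gram_id.
have sub u v : cabs u = 1 -> cabs v = 1 ->
    nA (unit_gram (res_op u) - unit_gram (res_op v)) <= cabs (u - v) * K * f u * f v.
  move=> u1 v1; have hu := AA_res u1; have hv := AA_res v1.
  have hgv := sa_mul spA AA_gram_id hv; have hugv := sa_mul spA hu hgv.
  rewrite resolvent_identity // (sa_normZ spA) // -/(cabs _) cabsM cabs_real -!mulrA.
  rewrite ler_wpM2l ?cabs_ge0 // ler_wpM2l //.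
  apply: le_trans (sa_normM spA hu hgv) _.
  rewrite [leRHS]mulrCA ler_wpM2l ?f0 //.
  exact: sa_normM spA _ _ AA_gram_id hv.
have [u v u1 v1|M hM] := circle_bounded f0 K0.
  have hu := AA_res u1; have hv := AA_res v1.
  rewrite {1}/f -{1}[unit_gram (res_op u)](subrK (unit_gram (res_op v))) [in leLHS]addrC.
  apply: le_trans (sa_normD spA hv (sa_sub spA hu hv)) _.
  by rewrite lerD2l sub.
have M0 : 0 <= M := le_trans (f0 1 (cabs1 R)) (hM 1 (cabs1 R)).
exists (K * M * M) => [|u v u1 v1]; first exact: mulr_ge0 (mulr_ge0 K0 M0) M0.
apply: le_trans (sub u v u1 v1) _.
have h : f u * f v <= M * M by rewrite ler_pM ?f0 ?hM.
have := ler_wpM2l (mulr_ge0 (cabs_ge0 (u - v)) K0) h.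
by rewrite mulrA => /le_trans; apply; rewrite le_eqVlt; apply/orP; left; apply/eqP; ring.
Qed.

End SpectralProjection.

(** * Averaging resolvents over roots of unity *)

Section Doubling.
Context {R : realType} {H : hilbertType R} {I : choiceType}.
Variables (AA : set (I -> I -> H -> H)) (nA : (I -> I -> H -> H) -> R).
Variable T : I -> H -> H.
Hypothesis spA : spectral_algebra AA nA.
Hypothesis gT : gframe T.
Hypothesis locT : localized AA T T.
Local Notation S := (frame_op T).
Local Notation Sinv := (frame_inv T).
Local Notation gram := (gram T).
Local Notation unit_gram := (unit_gram T).

Let bT k : bounded_op (T k) := gframe_bounded_op gT k.
Let bS : bounded_op S := frame_op_bounded gT.

Definition half : R[i] := (2^-1)%:C%C.

Lemma halfD : half + half = 1.
Proof. by rewrite /half -rmorphD /=; congr (_%:C%C); lra. Qed.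

Lemma cabs_half : cabs half = 2^-1.
Proof. by rewrite /half cabs_real ger0_norm. Qed.

Lemma cabs_sqrtC (v : R[i]) : cabs v = 1 -> cabs (sqrtC v) = 1.
Proof.
move=> v1; apply/eqP; rewrite -(eqrXn2 (n := 2)) ?cabs_ge0 // expr1n.
by rewrite expr2 -cabsM -expr2 sqrtCK v1.
Qed.

(* Of two unit square roots s, t and s, - t one pair is at distance <= sqrt 2. *)
Lemma cabs_sqrtC_dist (u v : R[i]) : cabs u = 1 -> cabs v = 1 ->
  exists2 t, t = sqrtC v \/ t = - sqrtC v &
    cabs (sqrtC u - t) <= 5 / 7 * cabs (u - v).
Proof.
move=> u1 v1; set s := sqrtC u; set r := sqrtC v.
have s1 : cabs s = 1 by exact: cabs_sqrtC.
have r1 : cabs r = 1 by exact: cabs_sqrtC.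
have par : cabs (s + r) ^+ 2 + cabs (s - r) ^+ 2 = 4.
  have := cabs_sqr s; have := cabs_sqr r; rewrite s1 r1 expr1n !cabs_sqr.
  by case: (s) => a b; case: (r) => a' b' /=; lra.
have prod : cabs (u - v) = cabs (s - r) * cabs (s + r).
  by rewrite -cabsM -subr_sqr /s /r !sqrtCK.
have p0 := cabs_ge0 (s + r); have m0 := cabs_ge0 (s - r).
(* Since (7 / 5)^2 < 2, [par] forbids both |s + r| and |s - r| to be below 7 / 5. Dividing |u - v|
   by a large one bounds the other; 5 / 7 is a rational stand-in for 1 / sqrt 2. *)
have [h|h] := leP (7 / 5) (cabs (s + r)).
  exists r; first by left.
  by rewrite prod; have := ler_wpM2l m0 h; lra.
exists (- r); first by right.
rewrite opprK prod; have h' : 7 / 5 <= cabs (s - r).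
  by rewrite leNgt; apply/negP => h2; nra.
by have := ler_wpM2r p0 h'; lra.
Qed.

Variables (c : R) (W : R[i] -> H -> H).
Hypothesis c0 : 0 < c.
Hypothesis cS : forall z, 4 * hnorm z <= c * hnorm (S z).
Hypothesis W_resolves : forall u, cabs u = 1 -> resolves T c u (W u).

(* [dop k] is (c S)^(2^k), and [dres k u] is (1 - u (c S)^(2^k))^-1, through
   2 (1 - x^2)^-1 = (1 - x)^-1 + (1 + x)^-1. *)
Fixpoint dop k : H -> H :=
  if k is k'.+1 then fun z => dop k' (dop k' z) else fun z => c%:C%C *: S z.

Fixpoint dres k (u : R[i]) : H -> H :=
  if k is k'.+1 then
    fun z => half *: (dres k' (sqrtC u) z + dres k' (- sqrtC u) z)
  else W u.

(** The matrix of (1 - u a^(2^k))^-1 for a = c G: it is 1 - P + C_T Y S^-1 D_T with Y = [dres k u],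
    since a acts on the range of C_T as c S does on H. For u = 1 the second term dies out as [k]
    grows and 1 - P remains. *)
Definition dmx k u := unit_gram (fun z => dres k u (Sinv z) - Sinv z).

Lemma dop_bounded k : bounded_op (dop k).
Proof.
elim: k => [|k IH]; last exact: bounded_op_comp.
exact: bounded_op_comp (bounded_op_scale _) bS.
Qed.

(** The iterated bound would be 4^(2^k). The weaker k + 4 tends to infinity as well, and its
    induction only needs (k + 4)^2 >= k + 5. *)
Lemma dop_expand k z : (k + 4)%:R * hnorm z <= hnorm (dop k z).
Proof.
elim: k z => [|k IH] z /=.
  by rewrite hnormZ cabs_real ger0_norm ?(ltW c0).
apply: le_trans (IH (dop k z)); have h := IH z.
have k0 : 0 <= (k + 4)%:R :> R by [].
apply: le_trans (ler_wpM2l k0 h); rewrite mulrA ler_wpM2r ?hnorm_ge0 //.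
by rewrite -natrM ler_nat; lia.
Qed.

Lemma dresE k u z : cabs u = 1 -> dres k u z - u *: dop k (dres k u z) = z.
Proof.
elim: k u z => [|k IH] v z v1 /=.
  by have [_ _ h] := W_resolves v1; rewrite -[RHS]h scalerA.
set s := sqrtC v; have s1 : cabs s = 1 by exact: cabs_sqrtC.
have Ns1 : cabs (- s) = 1 by rewrite cabsN.
have vs : v = s ^+ 2 by rewrite sqrtCK.
have ea := IH s z s1; have eb := IH (- s) z Ns1.
set a := dres k s z in ea *; set b := dres k (- s) z in eb *.
have bP := dop_bounded k; set P := dop k in bP ea eb *.
(* Applying 1 + s P to the equation of [a] and 1 - s P to that of [b] makes 1 - s^2 P^2 appear in
   both; the right-hand sides add up to 2 z. *)
have ea2 : P a - s *: P (P a) = P z by rewrite -[in RHS]ea (bopB _ _ bP) (bopZ _ _ bP).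
have eb2 : P b - (- s) *: P (P b) = P z.
  by rewrite -[in RHS]eb (bopB _ _ bP) (bopZ _ _ bP).
rewrite !(bopZ _ _ bP) (bopD _ _ bP) (bopD _ _ bP) vs.
apply: pairing_inj => t.
have := congr1 (pairing t) ea; have := congr1 (pairing t) eb.
have := congr1 (pairing t) ea2; have := congr1 (pairing t) eb2.
rewrite !(pairingD, pairingN, pairingZ).
move: (pairing t a) (pairing t b) (pairing t (P a)) (pairing t (P b)) => xa xb ya yb.
move: (pairing t (P (P a))) (pairing t (P (P b))) (pairing t z) => za zb x.
move: (pairing t (P z)) => y eyb eya exb exa.
have e1 : s * (ya - s * za) = s * y by rewrite eya.
have e2 : s * (yb - - s * zb) = s * y by rewrite eyb.
have -> : half * (xa + xb) - s ^+ 2 * (half * (za + zb)) =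
  half * ((xa - s * ya) + (xb - - s * yb) + s * (ya - s * za) - s * (yb - - s * zb)).
  by ring.
rewrite exa exb e1 e2.
have -> : half * (x + x + s * y - s * y) = (half + half) * x by ring.
by rewrite halfD mul1r.
Qed.

Lemma dres_small k z : (k + 3)%:R * hnorm (dres k 1 z) <= hnorm z.
Proof.
have := dresE k z (cabs1 R); rewrite scale1r; set x := dres k 1 z => e.
have h1 := dop_expand k x; have h2 := hnorm_le_sub (dop k x) x.
rewrite hnorm_distC e in h2.
have -> : (k + 3)%:R = (k + 4)%:R - 1 :> R by rewrite !natrD; ring.
lra.
Qed.

Lemma dmx0 u : cabs u = 1 -> dmx 0 u = unit_gram (res_op c W u).
Proof.
move=> u1; have [bW WS _] := W_resolves u1.
rewrite /dmx /=; congr unit_gram; apply/funext => z.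
by rewrite -[X in _ - X]WS (frame_invK gT) /res_op opprB addrC subrK.
Qed.

Lemma dmxS k v : dmx k.+1 v = half *: (dmx k (sqrtC v) + dmx k (- sqrtC v)).
Proof.
apply/funext => i; apply/funext => j; apply/funext => x.
rewrite -[RHS]/(half *: (dmx k (sqrtC v) i j x + dmx k (- sqrtC v) i j x)).
rewrite /dmx !unit_gramE /=; set z := Sinv _.
set a := dres k _ z; set b := dres k _ z; set m := mxone i j x.
rewrite !(bopB _ _ (bT i)) (bopZ _ _ (bT i)) (bopD _ _ (bT i)).
apply: pairing_inj => t; rewrite !(pairingD, pairingN, pairingZ).
move: (pairing t _) (pairing t _) (pairing t _) (pairing t _) => s r q p.
have -> : half * (p + (q - s) + (p + (r - s))) =
  (half + half) * p + half * (q + r) - (half + half) * s by ring.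
by rewrite halfD !mul1r; ring.
Qed.

Lemma AA_dmx k u : cabs u = 1 -> AA (dmx k u).
Proof.
elim: k u => [|k IH] u u1; first by rewrite dmx0 //; exact: (AA_res spA gT locT W_resolves u1).
rewrite dmxS; apply: (sa_scale spA); apply: (sa_add spA); apply: IH.
  exact: cabs_sqrtC.
by rewrite cabsN; exact: cabs_sqrtC.
Qed.

(** [sqrtC] jumps on the circle, but the average in [dmxS] is symmetric in the two square roots, so
    the root of [v] closer to that of [u] may be used. The pairs (s, t) and (- s, - t) are equally
    far apart, and each doubling gains 5 / 7. *)
Lemma dmx_lipschitz : exists2 L, 0 <= L & forall k u v, cabs u = 1 -> cabs v = 1 ->
  nA (dmx k u - dmx k v) <= L * (5 / 7) ^+ k * cabs (u - v).
Proof.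
have [L L0 hL] := res_lipschitz spA gT locT W_resolves.
exists L => // k; elim: k => [|k IH] u v u1 v1.
  by rewrite !dmx0 // expr0 mulr1; exact: hL.
have [t ht st] := cabs_sqrtC_dist u1 v1; set s := sqrtC u in st *.
have s1 : cabs s = 1 by exact: cabs_sqrtC.
have t1 : cabs t = 1 by case: ht => ->; rewrite ?cabsN; exact: cabs_sqrtC.
have -> : dmx k.+1 u - dmx k.+1 v =
    half *: ((dmx k s - dmx k t) + (dmx k (- s) - dmx k (- t))).
  have -> : dmx k.+1 v = half *: (dmx k t + dmx k (- t)).
    by rewrite dmxS; case: ht => ->; rewrite ?opprK // [dmx _ _ + _]addrC.
  by rewrite dmxS -scalerBr opprD addrACA.
have Ns1 : cabs (- s) = 1 by rewrite cabsN.
have Nt1 : cabs (- t) = 1 by rewrite cabsN.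
have h1 := sa_sub spA (AA_dmx k s1) (AA_dmx k t1).
have h2 := sa_sub spA (AA_dmx k Ns1) (AA_dmx k Nt1).
rewrite (sa_normZ spA half (sa_add spA h1 h2)) -/(cabs _) cabs_half.
have n1 := IH s t s1 t1; have n2 := IH _ _ Ns1 Nt1.
have e : cabs (- s - - t) = cabs (s - t) by rewrite -opprD cabsN.
rewrite e in n2; have n3 := sa_normD spA h1 h2.
have L5 : 0 <= L * (5 / 7) ^+ k by rewrite mulr_ge0 // exprn_ge0.
have := ler_wpM2l L5 st; rewrite exprS.
move: n1 n2 n3; lra.
Qed.

Lemma AA_gram_inv_of_resolvents : AA (gram Sinv).
Proof.
have [L L0 hL] := dmx_lipschitz.
have hk k : AA (dmx k 1) := AA_dmx k (cabs1 R).
(* The square roots of 1 are 1 and -1, so the difference is half of [dmx k (-1) - dmx k 1]; the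
   distance 2 of these points cancels the half. *)
have step k : nA (dmx k.+1 1 - dmx k 1) <= L * (5 / 7) ^+ k.
  have N1 : cabs (-1 : R[i]) = 1 by rewrite cabsN cabs1.
  have -> : dmx k.+1 1 - dmx k 1 = half *: (dmx k (-1) - dmx k 1).
    rewrite dmxS sqrtC1 scalerDr scalerBr addrAC.
        have {2}-> : dmx k 1 = half *: dmx k 1 + half *: dmx k 1.
      by rewrite -scalerDl halfD scale1r.
    by rewrite opprD addrA subrr sub0r addrC.
  rewrite (sa_normZ spA half (sa_sub spA (AA_dmx k N1) (hk k))).
  rewrite -/(cabs _) cabs_half.
  have := hL k (-1) 1 N1 (cabs1 R).
  have : cabs (-1 - 1 : R[i]) <= 2.
    by apply: le_trans (cabsD _ _) _; rewrite !cabsN cabs1; lra.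
  have L5 : 0 <= L * (5 / 7) ^+ k by rewrite mulr_ge0 // exprn_ge0.
  move=> /(ler_wpM2l L5); lra.
(* A geometric sum in closed form: 7 / 2 = 1 / (1 - 5 / 7). *)
have tele n j : nA (dmx (n + j) 1 - dmx n 1) <=
    7 / 2 * L * ((5 / 7) ^+ n - (5 / 7) ^+ (n + j)).
  elim: j => [|j IH].
    rewrite addn0 !subrr mulr0.
    have -> : (0 : I -> I -> H -> H) = (0 : R[i]) *: dmx n 1 by rewrite scale0r.
    by rewrite (sa_normZ spA) // normr0 mul0r.
  rewrite addnS -[dmx _ 1 - _](subrKA (dmx (n + j) 1)).
  apply: le_trans (sa_normD spA _ _) _; try exact: (sa_sub spA).
  by have := step (n + j)%N; rewrite exprS; move: IH; lra.
have small e : 0 < e -> exists N, forall n, (N <= n)%N -> 7 / 2 * L * (5 / 7) ^+ n < e.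
  move=> e0; have q1 : `|5 / 7 : R| < 1 by rewrite ger0_norm; lra.
  have e1 : 0 < e / (7 / 2 * L + 1) by rewrite divr_gt0 // ltr_wpDl // mulr_ge0.
  have /cvgrPdist_lt/(_ _ e1)[N _ hN] := cvg_expr q1.
  exists N => n /hN /=; rewrite sub0r normrN ger0_norm ?exprn_ge0 //.
  rewrite ltr_pdivlMr ?ltr_wpDl ?mulr_ge0 // => h; apply: le_lt_trans h.
  by rewrite mulrC ler_wpM2l ?exprn_ge0 // lerDl.
have dist n j : nA (dmx (n + j) 1 - dmx n 1) <= 7 / 2 * L * (5 / 7) ^+ n.
  apply: le_trans (tele n j) _; rewrite ler_wpM2l ?mulr_ge0 // lerBlDr lerDl.
  by rewrite exprn_ge0.
have [|Q hQ cQ] := sa_complete spA hk.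
  move=> e e0; have [N hN] := small e e0; exists N => m n Nm Nn.
  have [mn|nm] := leqP m n.
    rewrite -opprB (sa_normN spA (sa_sub spA (hk n) (hk m))) -(subnKC mn).
    exact: le_lt_trans (dist _ _) (hN _ Nm).
  rewrite -(subnKC (ltnW nm)); exact: le_lt_trans (dist _ _) (hN _ Nn).
suff -> : gram Sinv = (mxone : I -> I -> H -> H) - Q by exact: (sa_sub spA (sa_one spA) hQ).
apply/funext => i; apply/funext => j; apply/funext => x.
rewrite -[RHS]/(mxone i j x - Q i j x); set y := Sinv (adj (T j) x).
rewrite -[LHS]/(T i y); apply/eqP; rewrite -subr_eq0 -hnorm_eq0 eq_le hnorm_ge0 andbT.
have [C C0 hC] := sa_entry_bound spA i j; have [D D0 hD] := bounded_op_bound (bT i).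
apply: (@le0_of_small _ _ (C * hnorm x + D * hnorm y)) => e e0.
move/cvgrPdist_lt : cQ => /(_ _ e0)[N _ hN].
(* At this [n] both errors are of order e: n >= N controls [dmx n 1 - Q] in the algebra, and n >=
   e^-1 makes [dres n 1 y] at most e |y|. *)
pose n := (N + (Num.truncn e^-1).+1)%N.
have hn : nA (dmx n 1 - Q) <= e.
  have := hN n (leq_addr _ _); rewrite sub0r normrN => /ltW.
  exact: le_trans (ler_norm _).
have ne : hnorm (dres n 1 y) <= e * hnorm y.
  have := dres_small n y; have en : e^-1 <= (n + 3)%:R.
    apply: (@le_trans _ _ (Num.truncn e^-1).+1%:R); first exact/ltW/truncnS_gt.
    by rewrite ler_nat /n; lia.
  have : e^-1 * hnorm (dres n 1 y) <= (n + 3)%:R * hnorm (dres n 1 y).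
    by rewrite ler_wpM2r ?hnorm_ge0.
  by move=> /le_trans h /h; rewrite ler_pdivrMl.
have -> : T i y - (mxone i j x - Q i j x) = T i (dres n 1 y) - (dmx n 1 - Q) i j x.
  rewrite -[(dmx n 1 - Q) i j x]/(dmx n 1 i j x - Q i j x) /dmx unit_gramE -/y.
  rewrite (bopB _ _ (bT i)); vring.
apply: le_trans (ler_hnormB _ _) _; rewrite mulrDr addrC lerD //.
  have hs := sa_sub spA (hk n) hQ.
  apply: le_trans (opnormP _ (sa_entries spA hs i j)) _.
  rewrite mulrA ler_wpM2r ?hnorm_ge0 //; apply: le_trans (hC _ hs) _.
  by rewrite mulrC ler_wpM2r.
apply: le_trans (hD _) _; rewrite mulrCA ler_wpM2l //.
Qed.

End Doubling.

(** * Range projection and pseudo-inverse in the algebra *)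

Section GramInverse.
Context {R : realType} {H : hilbertType R} {I : choiceType}.
Variables (AA : set (I -> I -> H -> H)) (nA : (I -> I -> H -> H) -> R).
Variable T : I -> H -> H.
Hypothesis spA : spectral_algebra AA nA.
Hypothesis gT : gframe T.
Hypothesis locT : localized AA T T.
Local Notation S := (frame_op T).
Local Notation Sinv := (frame_inv T).

Let bT k : bounded_op (T k) := gframe_bounded_op gT k.
Let bS : bounded_op S := frame_op_bounded gT.
Let bSinv : bounded_op Sinv := frame_inv_bounded gT.

Lemma AA_gram_inv : AA (gram T Sinv).
Proof.
have [c [cS c0] hW] := resolves_ex gT.
have /choice[W WP] : forall u, exists Wu, cabs u = 1 -> resolves T c u Wu.
  move=> u; have [u1|n1] := pselect (cabs u = 1); last by exists id.
  by have [Wu h] := hW u u1; exists Wu.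
exact: (AA_gram_inv_of_resolvents spA gT locT c0 cS WP).
Qed.

(* 1 - P + G, with P = [T_k S^-1 T_l^*] the range projection of the Gram matrix G,
   is invertible with inverse 1 - P + [T_k S^-2 T_l^*]. *)
Lemma AA_gram_inv2 : AA (gram T (Sinv \o Sinv)).
Proof.
(* 1 - P + G is 1 + C_T Y D_T with Y = 1 - S^-1, and the claimed inverse has Z = S^-2 - S^-1. *)
pose Y z := z - Sinv z; pose Z z := Sinv (Sinv z) - Sinv z.
have bY : bounded_op Y.
  have := bounded_op_lin (-1) bSinv (@bounded_op_id R H).
  by congr bounded_op; apply/funext => z; rewrite scaleN1r addrC.
have bZ : bounded_op Z.
  have := bounded_op_lin (-1) bSinv (bounded_op_comp bSinv bSinv).
  by congr bounded_op; apply/funext => z; rewrite scaleN1r addrC.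
have hY : AA (unit_gram T Y).
  have := sa_add spA (sa_one spA) (sa_sub spA (AA_gram_id locT) AA_gram_inv).
  congr AA; congr (_ + _); apply/funext => k; apply/funext => l; apply/funext => x.
  by rewrite -[LHS]/(T k (adj (T l) x) - T k (Sinv (adj (T l) x))) -(bopB _ _ (bT k)).
have hZ : AA (unit_gram T Z).
  apply: (AA_unit_gram_inv spA gT bY bZ hY) => z; rewrite /Y /Z.
    by rewrite !(bopB _ _ bS, bopB _ _ bSinv, frame_invK gT); vring.
  by rewrite !(bopB _ _ bS, bopB _ _ bSinv, frame_opK gT); vring.
have := sa_add spA (sa_sub spA hZ (sa_one spA)) AA_gram_inv.
congr AA; apply/funext => k; apply/funext => l; apply/funext => x.
rewrite -[LHS]/(unit_gram T Z k l x - mxone k l x + T k (Sinv (adj (T l) x))).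
rewrite unit_gramE /Z (bopB _ _ (bT k)).
by rewrite -[RHS]/(T k (Sinv (Sinv (adj (T l) x)))); vring.
Qed.

End GramInverse.

(** * Limits of extended reals and of scalars *)

Section ExtendedLimits.
Context {R : realType}.

Lemma cvge_EFinP (T : Type) (F : set_system T) {FF : Filter F} (f : T -> \bar R) (l : R) :
  (forall e, 0 < e -> \forall t \near F, ((l - e)%:E <= f t)%E /\ (f t <= (l + e)%:E)%E) <->
  f @ F --> l%:E.
Proof.
split=> [h|/fine_cvgP[ff fl] e e0].
  apply/fine_cvgP; split.
    apply: filterS (h 1 ltr01) => t [h1 h2].
    by rewrite fin_numE -ltNye -ltey (lt_le_trans _ h1) ?ltNyr // (le_lt_trans h2) ?ltry.
  apply/cvgrPdist_le => e e0; apply: filterS (h e e0) => t [] /=.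
  case: (f t) => [r| |] //=; rewrite !lee_fin => h1 h2.
  by rewrite ler_distlC; apply/andP.
move/cvgrPdist_le : fl => /(_ e e0) fl; apply: filterS (filterI ff fl) => t [] /=.
case: (f t) => [r| |] //= _; rewrite !lee_fin ler_distlC => /andP[-> ->].
by [].
Qed.

Lemma cvge0P (T : Type) (F : set_system T) {FF : Filter F} (f : T -> \bar R) :
  (forall t, (0 <= f t)%E) ->
  (f @ F --> 0%E <-> forall e, 0 < e -> \forall t \near F, (f t <= e%:E)%E).
Proof.
move=> f0; split=> [/cvge_EFinP h e e0|h].
  by apply: filterS (h e e0) => t [_]; rewrite add0r.
apply/cvge_EFinP => e e0; apply: filterS (h e e0) => t ft; split; last by rewrite add0r.
by apply: le_trans (f0 t); rewrite lee_fin sub0r oppr_le0 ltW.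
Qed.

Lemma cvge_unique (T : Type) (F : set_system T) {FF : ProperFilter F}
    (f : T -> \bar R) (a b : \bar R) : f @ F --> a -> f @ F --> b -> a = b.
Proof. by move=> ha hb; apply: (cvg_unique _ ha hb); exact: ereal_hausdorff. Qed.

Lemma cvg_cabsP (T : Type) (F : set_system T) {FF : Filter F} (f : T -> R[i]^o) (l : R[i]^o) :
  (forall e : R, 0 < e -> \forall t \near F, cabs (l - f t) < e) -> f @ F --> l.
Proof.
move=> h; apply/cvgrPdist_lt => e e0.
have er : e \is Num.real by exact: gtr0_real.
have : 0 < complex.Re e by rewrite -ltcR RRe_real.
move/h; apply: filterS => t.
by rewrite -ltcR RRe_real // cabsE.
Qed.

End ExtendedLimits.

(** * Cauchy sequences through their coefficients *)

Section AnalysisNorm.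
Context {R : realType} {H : hilbertType R} {I : choiceType}.
Variables (w : I -> R) (U : I -> H -> H) (p : \bar R).
Hypothesis w_gt0 : forall k, 0 < w k.
Hypothesis bU : forall k, bounded_op (U k).
Hypothesis p0 : (0 <= p)%E.
Implicit Types (x y : H) (u v : nat -> H) (c : I -> H).

Lemma analysisB x y : analysis U (x - y) = analysis U x - analysis U y.
Proof. by apply/funext => k; exact: bopB. Qed.

Lemma ellnormN_le c M : 0 <= M -> (ellnorm p w c <= M%:E)%E ->
  (ellnorm p w (- c)%R <= M%:E)%E.
Proof.
move=> M0 h; rewrite -[M]mul1r; apply: ellnorm_mono h => // k.
by rewrite mul1r -[(- c) k]/(- c k) hnormNE.
Qed.

Lemma ellnorm_triB : exists2 K, 0 < K & forall b c d M N, 0 <= M -> 0 <= N ->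
  (ellnorm p w (b - c)%R <= M%:E)%E -> (ellnorm p w (c - d)%R <= N%:E)%E ->
  (ellnorm p w (b - d)%R <= (K * (M + N))%:E)%E.
Proof.
have [K K0 hK] := @ellnormD_le R H I w w_gt0 p 1 p0 ltr01.
exists (2 + K) => [|b c d M N M0 N0 h1 h2]; first by rewrite addr_gt0.
rewrite -[b - d](subrKA c); apply: le_trans (hK _ _ _ _ _ _ h1 h2) _ => //.
rewrite lee_fin; have := mulr_ge0 (ltW K0) M0; lra.
Qed.

Lemma ellnorm_distC c d M : 0 <= M -> (ellnorm p w (c - d)%R <= M%:E)%E ->
  (ellnorm p w (d - c)%R <= M%:E)%E.
Proof. by rewrite -[d - c]opprB; exact: ellnormN_le. Qed.

Definition ell_cvg (a : nat -> I -> H) c :=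
  forall e, 0 < e -> exists N, forall n, (N <= n)%N -> (ellnorm p w (c - a n)%R <= e%:E)%E.

Lemma ell_cvg_pointwise a c k : ell_cvg a c -> a n k @[n --> \oo] --> c k.
Proof.
move=> h; apply/cvg_hnormP => e e0.
have e1 : 0 < w k * (e / 2) by rewrite mulr_gt0 // divr_gt0.
have [N hN] := h _ e1; exists N => // n /= /hN.
move=> /(hnorm_le_ellnorm w_gt0 k p0 (ltW e1)).
rewrite mulKf ?gt_eqF // => /le_lt_trans; apply; lra.
Qed.

(** Here the constant 1 + d of [ellnormD_le], arbitrarily close to 1, is essential: a fixed
    quasi-triangle constant would not make the norm continuous. *)
Lemma ell_cvg_norm a c : ell p w c -> ell_cvg a c ->
  ellnorm p w (a n) @[n --> \oo] --> ellnorm p w c.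
Proof.
move=> ec ac; have [M0 M00 cM] := ell_fin p0 ec.
have fin : ellnorm p w c \is a fin_num.
  by rewrite ge0_fin_numE ?ellnorm_ge0 //; apply: le_lt_trans cM _; rewrite ltry.
rewrite -(fineK fin); set L := fine _.
have L0 : 0 <= L by rewrite fine_ge0 // ellnorm_ge0.
have cL : (ellnorm p w c <= L%:E)%E by rewrite /L fineK.
apply/cvge_EFinP => e e0.
have Le : 0 < L + e by rewrite ltr_wpDl.
(* Both norms are at most L + e, so the factor 1 + d costs at most e / 4. *)
pose d := e / (4 * (L + e)); have d0 : 0 < d by rewrite divr_gt0 // mulr_gt0.
have [K K0 hK] := @ellnormD_le R H I w w_gt0 p d p0 d0.
have eK : 0 < e / (4 * K) by rewrite divr_gt0 // mulr_gt0.
have [N hN] := ac _ eK; exists N => // n /= /hN hn.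
have KeK : K * (e / (4 * K)) = e / 4 by field; exact: lt0r_neq0.
have dL : d * (L + e) = e / 4 by rewrite /d; field; exact: lt0r_neq0.
have up : (ellnorm p w (a n) <= (L + e)%:E)%E.
  have := ellnorm_distC (ltW eK) hn => /(hK _ _ _ _ L0 (ltW eK) cL).
  rewrite [c + _]addrC subrK => /le_trans; apply; rewrite lee_fin KeK.
  have : 0 <= d * e by rewrite mulr_ge0 // ltW.
  move: dL; lra.
split=> //; have fa : ellnorm p w (a n) \is a fin_num.
  by rewrite ge0_fin_numE ?ellnorm_ge0 //; apply: le_lt_trans up _; rewrite ltry.
move: up; rewrite -(fineK fa) !lee_fin; set x := fine _ => xL.
have x0 : 0 <= x by rewrite fine_ge0 // ellnorm_ge0.
have ax : (ellnorm p w (a n) <= x%:E)%E by rewrite /x fineK.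
have := hK _ _ _ _ x0 (ltW eK) ax hn.
rewrite [a n + _]addrC subrK KeK -(fineK fin) lee_fin -/L.
have : d * x <= d * (L + e) by rewrite ler_wpM2l // ltW.
rewrite dL; lra.
Qed.

(** Entries converge because single entries are bounded by the norm. [ellnorm_fatou] carries the
    Cauchy estimate over to the entrywise limit, and [ell_closed] puts that limit in the space. *)
Lemma cauchy_ell_cvg u : cauchyV p w U u -> exists c, [/\ ell p w c &
  ell_cvg (fun n => analysis U (u n)) c].
Proof.
move=> [uV uC].
have uC' e : 0 < e -> exists N, forall m n, (N <= m)%N -> (N <= n)%N ->
    (ellnorm p w (analysis U (u m) - analysis U (u n))%R <= e%:E)%E.
  move=> /uC[N hN]; exists N => m n Nm Nn.
  by have := hN m n Nm Nn; rewrite /Vnorm analysisB => /ltW.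
have cv k : cvg (U k (u n) @[n --> \oo]).
  apply: cauchy_hnorm_cvg => e e0.
  have e1 : 0 < w k * (e / 2) by rewrite mulr_gt0 // divr_gt0.
  have [N hN] := uC' _ e1; exists [set n | (N <= n)%N]; first by exists N.
  move=> m n /= Nm Nn; have := hN m n Nm Nn.
  move=> /(hnorm_le_ellnorm w_gt0 k p0 (ltW e1)).
  rewrite mulKf ?gt_eqF // => /le_lt_trans; apply; lra.
pose c k := lim (U k (u n) @[n --> \oo]).
have cc : ell_cvg (fun n => analysis U (u n)) c.
  move=> e e0; have [N hN] := uC' e e0; exists N => n Nn.
  (* The index is shifted by [N] so that the Cauchy bound holds for every term. *)
  apply: (ellnorm_fatou w_gt0 (u := fun m => analysis U (u (m + N)%N) - analysis U (u n))
     p0 (ltW e0)) => [m|k]; first by apply: hN => //; exact: leq_addl.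
  apply: cvgB; last exact: cvg_cst.
  by rewrite (cvg_shiftn N (fun m => U k (u m))); exact: cv.
exists c; split=> //; apply: (ell_closed w_gt0) => // e /cc[N hN].
by exists (analysis U (u N)); [exact: uV|exact: hN].
Qed.

Lemma ell_cvg_cauchy u c : (forall n, V p w U (u n)) ->
  ell_cvg (fun n => analysis U (u n)) c -> cauchyV p w U u.
Proof.
move=> uV uc; split=> // e e0; have [K K0 hK] := ellnorm_triB.
have eK : 0 < e / (4 * K) by rewrite divr_gt0 // mulr_gt0.
have [N hN] := uc _ eK; exists N => m n Nm Nn; rewrite /Vnorm analysisB.
apply: le_lt_trans (hK _ _ _ _ _ (ltW eK) (ltW eK)
  (ellnorm_distC (ltW eK) (hN m Nm)) (hN n Nn)) _.
have -> : K * (e / (4 * K) + e / (4 * K)) = e / 2 by field; exact: lt0r_neq0.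
by rewrite lte_fin; lra.
Qed.

Lemma Vnorm_ge0 x : (0 <= Vnorm p w U x)%E.
Proof. exact: ellnorm_ge0. Qed.

(** A class is thus determined by the common limit [c] of the coefficients of its members. *)
Lemma class_finP u c : cauchyV p w U u -> ell_cvg (fun n => analysis U (u n)) c ->
  forall v, class_fin p w U u v <->
    (forall n, V p w U (v n)) /\ ell_cvg (fun n => analysis U (v n)) c.
Proof.
move=> uC uc v; have [K K0 hK] := ellnorm_triB.
have half e : 0 < e -> 0 < e / (2 * K) by move=> e0; rewrite divr_gt0 // mulr_gt0.
have KK e : K * (e / (2 * K) + e / (2 * K)) = e by field; exact: lt0r_neq0.
split=> [[vC /(cvge0P (fun n => Vnorm_ge0 _)) h]|[vV vc]].
  split; first exact: vC.1.
  move=> e /half e2; have [N1 hN1] := uc _ e2; have [N2 _ hN2] := h _ e2.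
  exists (maxn N1 N2) => n; rewrite geq_max => /andP[n1 n2]; rewrite -(KK e).
  apply: (hK _ (analysis U (u n)) _ _ _ (ltW e2) (ltW e2)); first exact: hN1.
  by have := hN2 n n2; rewrite /= /Vnorm analysisB.
split; first exact: ell_cvg_cauchy vc.
apply/(cvge0P (fun n => Vnorm_ge0 _)) => e /half e2.
have [N1 hN1] := uc _ e2; have [N2 hN2] := vc _ e2.
exists (maxn N1 N2) => // n /=; rewrite geq_max => /andP[n1 n2]; rewrite /Vnorm analysisB.
rewrite -(KK e); apply: (hK _ c _ _ _ (ltW e2) (ltW e2)); last exact: hN2.
by apply: ellnorm_distC; [exact: ltW|exact: hN1].
Qed.

Lemma ext_eq (A : H -> H) (f : set (nat -> H)) u l : f u ->
  (forall v, f v -> A (v n) @[n --> \oo] --> l) -> ext A f = l.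
Proof.
move=> fu h; rewrite /ext; case: xgetP => [y _ hy|/(_ l) //].
exact: cvg_hnorm_unique (hy u fu) (h u fu).
Qed.

Lemma coorbit_norm_eq f c u : p != +oo%E -> ell p w c -> f u ->
  (forall v, f v -> ell_cvg (fun n => analysis U (v n)) c) ->
  coorbit_norm p w U f = ellnorm p w c.
Proof.
move=> /negbTE poo ec fu h; rewrite /coorbit_norm poo.
have lim v : f v -> Vnorm p w U (v n) @[n --> \oo] --> ellnorm p w c.
  by move=> /h; exact: ell_cvg_norm.
case: xgetP => [y _ hy|/(_ (ellnorm p w c)) //].
exact: cvge_unique (hy u fu) (lim u fu).
Qed.

End AnalysisNorm.

Lemma equiv_norm_of_bounds (R : realType) (X : Type) (D : set X) (n1 n2 : X -> \bar R) :
  (forall x, D x -> (0 <= n1 x)%E /\ (0 <= n2 x)%E) ->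
  (exists2 C, 0 <= C & forall x M, D x -> 0 <= M ->
     (n1 x <= M%:E)%E -> (n2 x <= (C * M)%:E)%E) ->
  (exists2 C, 0 <= C & forall x M, D x -> 0 <= M ->
     (n2 x <= M%:E)%E -> (n1 x <= (C * M)%:E)%E) ->
  (forall x, D x -> (n1 x < +oo)%E) ->
  equiv_norm D n1 n2.
Proof.
move=> n0 [C C0 hC] [C' C'0 hC'] fin; exists (C' + 1)^-1, (C + 1).
have C1 : 0 < C + 1 by rewrite ltr_wpDl.
have C'1 : 0 < C' + 1 by rewrite ltr_wpDl.
split=> [||x Dx]; [by rewrite invr_gt0|by []|].
have [n1x n2x] := n0 x Dx.
have f1 : n1 x \is a fin_num by rewrite ge0_fin_numE // fin.
set m := fine (n1 x); have m1 : n1 x = m%:E by rewrite /m fineK.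
have m0 : 0 <= m by rewrite -lee_fin -m1.
have up : (n2 x <= (C * m)%:E)%E by apply: hC; rewrite // m1.
have f2 : n2 x \is a fin_num.
  by rewrite ge0_fin_numE //; apply: le_lt_trans up _; rewrite ltry.
set m' := fine (n2 x); have m2 : n2 x = m'%:E by rewrite /m' fineK.
have m'0 : 0 <= m' by rewrite -lee_fin -m2.
have : (n1 x <= (C' * m')%:E)%E by apply: hC'; rewrite // m2.
move: up; rewrite m1 m2 -!EFinM !lee_fin => h1 h2; split.
  by rewrite ler_pdivrMl //; lra.
lra.
Qed.


(** * Coorbit spaces for finite exponents *)

Section CoorbitSpaces.
Context {R : realType} {H : hilbertType R} {I : choiceType}.
Variables (AA : set (I -> I -> H -> H)) (nA : (I -> I -> H -> H) -> R).
Variables (T : I -> H -> H) (w : I -> R).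
Hypothesis spA : spectral_algebra AA nA.
Hypothesis gT : gframe T.
Hypothesis locT : localized AA T T.
Hypothesis w_gt0 : forall k, 0 < w k.
Local Notation Sinv := (frame_inv T).
Local Notation Td := (dual T).
Local Notation G := (gram T id).
Local Notation G1 := (gram T Sinv).
Local Notation G2 := (gram T (Sinv \o Sinv)).
Implicit Types (x y : H) (c d : I -> H) (u v : nat -> H) (f : set (nat -> H)).

Let bT k : bounded_op (T k) := gframe_bounded_op gT k.
Let bTd k : bounded_op (Td k) := dual_bounded_op gT k.
Let bSinv : bounded_op Sinv := frame_inv_bounded gT.
Let AG : AA G := AA_gram_id locT.
Let AG1 : AA G1 := AA_gram_inv spA gT locT.
Let AG2 : AA G2 := AA_gram_inv2 spA gT locT.

Lemma square_summable_fin c : ell00 c -> square_summable c.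
Proof.
move=> fc; apply/ell2P; apply: ell00_ell => //; by rewrite ?lee_fin.
Qed.

Lemma analysis_dual_synthesis c : square_summable c ->
  analysis Td (synthesis T c) = mxapp G1 c.
Proof. by move=> sc; apply/funext => k; rewrite (mxapp_gram gT). Qed.

Lemma synthesis_dual c : square_summable c -> synthesis Td c = Sinv (synthesis T c).
Proof.
move=> /(gframe_usummable gT) sc; rewrite -(usum_bop bSinv sc).
by congr usum; apply/funext => k; rewrite adj_dual.
Qed.

Lemma analysis_dual_synthesis_dual c : square_summable c ->
  analysis Td (synthesis Td c) = mxapp G2 c.
Proof.
move=> sc; apply/funext => k; rewrite (mxapp_gram gT) ?synthesis_dual //.
exact: bounded_op_comp.
Qed.

Lemma mxapp_trunc A d (F : {fset I}) l : AA A ->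
  mxapp A (trunc d F) l = \sum_(k <- F) A l k (d k).
Proof.
move=> hA; rewrite /mxapp (usum_fin (F := F)).
  by rewrite !big_seq; apply: eq_bigr => k kF; rewrite /trunc kF.
by move=> k /negbTE kF; rewrite /trunc kF (bop0 (sa_entries spA hA l k)).
Qed.

(** The coefficients of [h k] are column k of [A] applied to [d k], so partial sums of the series
    correspond to truncations of [d]. *)
Lemma analysis_partial_sum A d h (F : {fset I}) : AA A ->
  (forall k l, Td l (h k) = A l k (d k)) ->
  analysis Td (summability.partial_sum h F) = mxapp A (trunc d F).
Proof.
move=> hA hh; apply/funext => l; rewrite mxapp_trunc // /analysis partial_sumE.
by rewrite (bop_sum _ _ _ (bTd l)); apply: eq_bigr => k _.
Qed.

Section FixedExponent.
Variable p : \bar R.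
Hypothesis p0 : (0 <= p)%E.
Hypothesis acts : forall A, AA A -> mx_acts p w A.

Lemma V_dual : V p w Td = V p w T.
Proof.
apply/seteqP; split=> x; rewrite /V /= => h.
  by rewrite -(mxapp_gram_id gT); apply: mx_acts_ell h; exact: acts.
by rewrite -(mxapp_gram_inv2 gT); apply: mx_acts_ell h; exact: acts.
Qed.

Lemma ell_cvg_mxapp A (a : nat -> I -> H) c : AA A -> (forall n, ell p w (a n)) ->
  ell p w c -> ell_cvg w p a c -> ell_cvg w p (fun n => mxapp A (a n)) (mxapp A c).
Proof.
move=> hA ea ec ac e e0; have [C C0 hC] := mx_acts_bound p0 (acts hA).
have e1 : 0 < e / (C + 1) by rewrite divr_gt0 // ltr_wpDl.
have [N hN] := ac _ e1; exists N => n /hN h.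
rewrite -(mxappB p0 (acts hA)) //.
apply: le_trans (hC _ _ _ (ltW e1) h) _; first exact: ellB.
rewrite lee_fin mulrA ler_pdivrMr ?ltr_wpDl // [e * _]mulrC ler_wpM2r ?ltW //.
lra.
Qed.

Lemma ell_cvg_unique (a : nat -> I -> H) c d : ell_cvg w p a c -> ell_cvg w p a d -> c = d.
Proof.
move=> ac ad; apply/funext => k.
have hc := ell_cvg_pointwise w_gt0 p0 (k := k) ac.
have hd := ell_cvg_pointwise w_gt0 p0 (k := k) ad.
exact: (@cvg_hnorm_unique _ _ _ _ _ (fun n => a n k) _ _ hc hd).
Qed.

Lemma ell_cvg_analysis u c : (forall n, V p w Td (u n)) -> ell p w c ->
  ell_cvg w p (fun n => analysis Td (u n)) c ->
  ell_cvg w p (fun n => analysis T (u n)) (mxapp G c).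
Proof.
move=> uV ec uc; have := ell_cvg_mxapp AG uV ec uc.
by congr ell_cvg; apply/funext => n; rewrite (mxapp_gram_id gT).
Qed.

Lemma ell_cvg_analysis_dual u d : (forall n, V p w T (u n)) -> ell p w d ->
  ell_cvg w p (fun n => analysis T (u n)) d ->
  ell_cvg w p (fun n => analysis Td (u n)) (mxapp G2 d).
Proof.
move=> uV ed ud; have := ell_cvg_mxapp AG2 uV ed ud.
by congr ell_cvg; apply/funext => n; rewrite (mxapp_gram_inv2 gT).
Qed.

Lemma ell_cvg_analysis_inv u c : (forall n, V p w Td (u n)) -> ell p w c ->
  ell_cvg w p (fun n => analysis Td (u n)) c -> c = mxapp G1 c.
Proof.
move=> uV ec uc; apply: (ell_cvg_unique uc); have := ell_cvg_mxapp AG1 uV ec uc.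
by congr ell_cvg; apply/funext => n; rewrite (mxapp_gram_inv gT).
Qed.

Section FiniteExponent.
Hypothesis poo : p != +oo%E.

Lemma trunc_approx A d e : AA A -> ell p w d -> 0 < e -> exists F : {fset I},
  forall F', (F `<=` F')%fset ->
    (ellnorm p w (mxapp A d - mxapp A (trunc d F'))%R <= e%:E)%E.
Proof.
move=> hA ed e0; have [C C0 hC] := mx_acts_bound p0 (acts hA).
have e1 : 0 < e / (C + 1) by rewrite divr_gt0 // ltr_wpDl.
have [F hF] := ell_trunc w_gt0 p0 poo ed e1; exists F => F' FF'.
have ht : ell p w (trunc d F') by apply: ell00_ell => //; exact: trunc_ell00.
rewrite -(mxappB p0 (acts hA)) //.
apply: le_trans (hC _ _ _ (ltW e1) (hF _ FF')) _; first exact: ellB.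
rewrite lee_fin mulrA ler_pdivrMr ?ltr_wpDl // [e * _]mulrC ler_wpM2r ?ltW //.
lra.
Qed.

Lemma V_synthesis c : ell00 c -> V p w Td (synthesis T c).
Proof.
move=> fc; rewrite /V /= analysis_dual_synthesis; last exact: square_summable_fin.
by apply: (mx_acts_ell (acts AG1)); exact: ell00_ell.
Qed.

Lemma V_synthesis_dual c : ell00 c -> V p w Td (synthesis Td c).
Proof.
move=> fc; rewrite /V /= analysis_dual_synthesis_dual; last exact: square_summable_fin.
by apply: (mx_acts_ell (acts AG2)); exact: ell00_ell.
Qed.

(** Truncating the argument in c = P c stays among coefficient sequences of vectors, because P =
    C_Td D_T for the dual family Td. The next lemma does the same with the pseudo-inverse in place
    of P. *)
Lemma H00_dense x e : V p w Td x -> 0 < e -> exists y, [/\ H00 T y, V p w Td y &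
  (ellnorm p w (analysis Td x - analysis Td y)%R <= e%:E)%E].
Proof.
move=> xV e0; have [F hF] := trunc_approx AG1 xV e0.
exists (synthesis T (trunc (analysis Td x) F)).
have ft := trunc_ell00 (analysis Td x) F.
split; [by exists (trunc (analysis Td x) F)|exact: V_synthesis|].
rewrite analysis_dual_synthesis; last exact: square_summable_fin.
by rewrite -{1}(mxapp_gram_inv gT); exact: hF.
Qed.

Lemma H00_dual_dense x e : V p w Td x -> 0 < e -> exists y, [/\ H00 Td y, V p w Td y &
  (ellnorm p w (analysis Td x - analysis Td y)%R <= e%:E)%E].
Proof.
rewrite {1}V_dual => xV e0; have [F hF] := trunc_approx AG2 xV e0.
exists (synthesis Td (trunc (analysis T x) F)).
have ft := trunc_ell00 (analysis T x) F.
split; [by exists (trunc (analysis T x) F)|exact: V_synthesis_dual|].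
rewrite analysis_dual_synthesis_dual; last exact: square_summable_fin.
by rewrite -{1}(mxapp_gram_inv2 gT); exact: hF.
Qed.

Lemma dense_sequence (P : set H) u c :
  (forall x e, V p w Td x -> 0 < e -> exists y, [/\ P y, V p w Td y &
     (ellnorm p w (analysis Td x - analysis Td y)%R <= e%:E)%E]) ->
  (forall n, V p w Td (u n)) -> ell_cvg w p (fun n => analysis Td (u n)) c ->
  exists v, [/\ forall n, P (v n), forall n, V p w Td (v n) &
     ell_cvg w p (fun n => analysis Td (v n)) c].
Proof.
move=> dP uV uc.
have /choice[v hv] : forall n : nat, exists y, [/\ P y, V p w Td y &
    (ellnorm p w (analysis Td (u n) - analysis Td y)%R <= n.+1%:R^-1%:E)%E].
  by move=> n; apply: dP.
exists v; split=> [n|n|e e0]; [by case: (hv n)|by case: (hv n)|].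
have [K K0 hK] := @ellnorm_triB R H I w p w_gt0 p0.
have e2 : 0 < e / (2 * K) by rewrite divr_gt0 // mulr_gt0.
have [N1 hN1] := uc _ e2.
have [N2 _ hN2] := near_infty_natSinv_lt (PosNum e2).
exists (maxn N1 N2) => n; rewrite geq_max => /andP[n1 n2].
have -> : e = K * (e / (2 * K) + e / (2 * K)) by field; exact: lt0r_neq0.
apply: hK (ltW e2) (ltW e2) (hN1 n n1) _; case: (hv n) => _ _ /le_trans; apply.
by rewrite lee_fin ltW //; exact: hN2.
Qed.

(** The class named by the limit [c] of its coefficients with respect to the dual family; both
    orders of the pair (dual T, T) are described by these sets. *)
Definition limit_class c : set (nat -> H) :=
  [set v | (forall n, V p w Td (v n)) /\ ell_cvg w p (fun n => analysis Td (v n)) c].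

(** By density of [H00 T], each nonempty limit class contains a sequence of [H00 T], as membership
    in the space requires. *)
Lemma coorbit_finP f : coorbit_fin p w Td T f <->
  exists c, [/\ ell p w c, limit_class c !=set0 & f = limit_class c].
Proof.
split=> [[u [uC uH ->]]|[c [ec [u [uV uc]] ->]]].
  have [c [ec uc]] := cauchy_ell_cvg w_gt0 bTd p0 uC; exists c; split=> //.
    by exists u; split=> //; exact: uC.1.
  apply/seteqP; split=> v.
    by move/(class_finP w_gt0 bTd p0 uC uc).
  by move=> ?; exact/(class_finP w_gt0 bTd p0 uC uc).
have [v [vH vV vc]] := dense_sequence H00_dense uV uc.
have vC := ell_cvg_cauchy w_gt0 bTd p0 vV vc.
exists v; split=> //; apply/seteqP; split=> v'.
  by move=> ?; exact/(class_finP w_gt0 bTd p0 vC vc).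
by move/(class_finP w_gt0 bTd p0 vC vc).
Qed.

(** [G] and [G2] carry the limits of the two kinds of coefficients into each other. Going back needs
    c = G2 (G c), which the given representative [u] provides. *)
Lemma limit_classE c u : limit_class c u -> ell p w c ->
  limit_class c = [set v | (forall n, V p w T (v n)) /\
    ell_cvg w p (fun n => analysis T (v n)) (mxapp G c)].
Proof.
move=> [uV uc] ec; apply/seteqP; split=> v /= [vV vc].
  by split; [rewrite -V_dual|exact: ell_cvg_analysis].
split; first by rewrite V_dual.
have eGc := mx_acts_ell (acts AG) ec.
have -> : c = mxapp G2 (mxapp G c); last exact: ell_cvg_analysis_dual.
apply: (ell_cvg_unique uc); apply: ell_cvg_analysis_dual => //; first by rewrite -V_dual.
exact: ell_cvg_analysis.
Qed.

(** The right-hand side is literally that of [coorbit_finP], which makes the two spaces equal as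
    sets of classes. *)
Lemma coorbit_fin_swapP f : coorbit_fin p w T Td f <->
  exists c, [/\ ell p w c, limit_class c !=set0 & f = limit_class c].
Proof.
split=> [[u [uC uH ->]]|[c [ec [u [uV uc]] ->]]].
  have [d [ed ud]] := cauchy_ell_cvg w_gt0 bT p0 uC.
  have uV : forall n, V p w Td (u n) by rewrite V_dual; exact: uC.1.
  have eG2 := mx_acts_ell (acts AG2) ed.
  have uc := ell_cvg_analysis_dual uC.1 ed ud.
  have hu : limit_class (mxapp G2 d) u by [].
  exists (mxapp G2 d); split=> //; first by exists u.
  rewrite (limit_classE hu) //.
  have -> : mxapp G (mxapp G2 d) = d.
    by apply: (ell_cvg_unique _ ud); exact: ell_cvg_analysis.
  apply/seteqP; split=> v.
    by move/(class_finP w_gt0 bT p0 uC ud).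
  by move=> ?; exact/(class_finP w_gt0 bT p0 uC ud).
have [v [vH vV vc]] := dense_sequence H00_dual_dense uV uc.
have vd := ell_cvg_analysis vV ec vc.
have vC : cauchyV p w T v by apply: (ell_cvg_cauchy w_gt0 bT p0 _ vd); rewrite -V_dual.
have hu : limit_class c u by [].
exists v; split=> //; rewrite (limit_classE hu) //; apply/seteqP; split=> v'.
  by move=> ?; exact/(class_finP w_gt0 bT p0 vC vd).
by move/(class_finP w_gt0 bT p0 vC vd).
Qed.

Lemma limit_class_ext c u : limit_class c u -> (fun k => ext (Td k) (limit_class c)) = c.
Proof.
move=> hu; apply/funext => k; apply: (ext_eq hu) => v [_ vc].
exact: ell_cvg_pointwise vc.
Qed.

Lemma limit_class_ext_swap c u : ell p w c -> limit_class c u ->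
  (fun k => ext (T k) (limit_class c)) = mxapp G c.
Proof.
move=> ec hu; apply/funext => k; apply: (ext_eq hu).
by rewrite (limit_classE hu ec) => v [_ vc]; exact: ell_cvg_pointwise vc.
Qed.

Lemma limit_class_norm c u : ell p w c -> limit_class c u ->
  coorbit_norm p w Td (limit_class c) = ellnorm p w c.
Proof. by move=> ec hu; apply: (coorbit_norm_eq w_gt0 p0 poo ec hu) => v []. Qed.

Lemma limit_class_norm_swap c u : ell p w c -> limit_class c u ->
  coorbit_norm p w T (limit_class c) = ellnorm p w (mxapp G c).
Proof.
move=> ec hu; have eG := mx_acts_ell (acts AG) ec.
apply: (coorbit_norm_eq w_gt0 p0 poo eG hu).
by rewrite (limit_classE hu ec) => v [].
Qed.

(** Subtracting a partial sum from the class shifts its coefficient limit to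
    [c - mxapp A (trunc d F)], and [trunc_approx] makes that small. The pair [A], [d] is left
    general so as to serve both expansions. *)
Lemma ucvg_limit_class A d c u h : AA A -> ell p w d -> c = mxapp A d ->
  (forall k l, Td l (h k) = A l k (d k)) -> limit_class c u ->
  ucvg_fin p w Td h (limit_class c).
Proof.
move=> hA ed cE hh hu; have ec : ell p w c by rewrite cE; exact: mx_acts_ell (acts hA) ed.
have bA := sa_entries spA hA.
have hV k : V p w Td (h k).
  rewrite /V /= (_ : analysis Td (h k) = mxapp A (delta k (d k))).
    by apply: (mx_acts_ell (acts hA)); apply: ell00_ell => //; exact: delta_ell00.
  by apply/funext => l; rewrite mxapp_delta // -hh.
have et F : ell p w (trunc d F) by apply: ell00_ell => //; exact: trunc_ell00.
have nE F : coorbit_norm p w Td (class_sub (limit_class c) (summability.partial_sum h F)) =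
    ellnorm p w (c - mxapp A (trunc d F))%R.
  have hF := analysis_partial_sum F hA hh.
  have hs : class_sub (limit_class c) (summability.partial_sum h F)
      (fun n => u n - summability.partial_sum h F) by exists u.
  apply: (coorbit_norm_eq w_gt0 p0 poo _ hs).
  - apply: ellB => //; exact: mx_acts_ell (acts hA) (et F).
  - move=> _ [v [vV vc] <-] e /vc[N hN]; exists N => n /hN.
    by rewrite (analysisB bTd) hF opprB addrA subrK.
split=> //; apply/cvge0P => [F|e e0]; first by rewrite nE; exact: ellnorm_ge0.
have [F hF] := trunc_approx hA ed e0; apply/totallyP; exists F => F' FF'.
by rewrite nE {1}cE; exact: hF.
Qed.

End FiniteExponent.

End FixedExponent.

End CoorbitSpaces.

(** * Coorbit spaces for p = oo *)

Section CoorbitInfty.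
Context {R : realType} {H : hilbertType R} {I : choiceType}.
Variables (AA : set (I -> I -> H -> H)) (nA : (I -> I -> H -> H) -> R).
Variables (T : I -> H -> H) (w : I -> R).
Hypothesis spA : spectral_algebra AA nA.
Hypothesis gT : gframe T.
Hypothesis locT : localized AA T T.
Hypothesis w_gt0 : forall k, 0 < w k.
Hypothesis acts : forall A, AA A -> mx_acts +oo%E w A.
Local Notation Sinv := (frame_inv T).
Local Notation Td := (dual T).
Local Notation G := (gram T id).
Local Notation G1 := (gram T Sinv).
Local Notation G2 := (gram T (Sinv \o Sinv)).
Implicit Types (x y : H) (c d : I -> H) (u v : nat -> H) (f : set (nat -> H)).
Implicit Types (U : I -> H -> H).

Let bT k : bounded_op (T k) := gframe_bounded_op gT k.
Let bTd k : bounded_op (Td k) := dual_bounded_op gT k.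
Let AG : AA G := AA_gram_id locT.
Let AG1 : AA G1 := AA_gram_inv spA gT locT.
Let AG2 : AA G2 := AA_gram_inv2 spA gT locT.
Let p0 : (0 <= +oo :> \bar R)%E := le0y.

Lemma elloo_le c K : 0 <= K -> (ellnorm +oo%E w c <= K%:E)%E -> ell +oo%E w c.
Proof. by move=> K0 cK; apply/ell_lty => //; apply/ellnorm_lty => //; exists K. Qed.

Lemma bounded_seqP U u : bounded_seq w U u <->
  exists2 K, 0 <= K & forall n, (ellnorm +oo%E w (analysis U (u n)) <= K%:E)%E.
Proof.
rewrite /bounded_seq; split=> [h|[K K0 hK]].
  set s := ereal_sup _ in h; have us n : (Vnorm +oo w U (u n) <= s)%E.
    by apply: ereal_sup_ubound; exists n.
  have s0 : (0 <= s)%E by apply: le_trans (us 0%N); exact: ellnorm_ge0.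
  exists (fine s) => [|n]; first exact: fine_ge0.
  have sf : s \is a fin_num by rewrite ge0_fin_numE.
  by rewrite (fineK sf); exact: us.
apply: (@le_lt_trans _ _ K%:E); last exact: ltry.
by apply: ge_ereal_sup => _ [n _ <-]; exact: hK.
Qed.

Lemma mxapp_cvg A (a : nat -> I -> H) c (K : R) k : AA A -> 0 <= K ->
  (forall n, (ellnorm +oo%E w (a n) <= K%:E)%E) ->
  (forall l, a n l @[n --> \oo] --> c l) ->
  mxapp A (a n) k @[n --> \oo] --> mxapp A c k.
Proof.
move=> hA K0 aK ac; have [M hM] := row_absolute spA k w_gt0 hA acts.
apply: (mxapp_dominated_cvg spA w_gt0 hA K0 hM (u := a)) ac => n l.
exact: (wabs_le_ellnorm w_gt0 l p0 K0 (aK n)).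
Qed.

(** Counterpart of [limit_class] for p = oo: entrywise convergence with a uniform bound replaces
    norm convergence. *)
Definition limit_class_oo U c : set (nat -> H) :=
  [set v | (forall k, U k (v n) @[n --> \oo] --> c k) /\ bounded_seq w U v].

Lemma bounded_seqB U u v : (forall k, bounded_op (U k)) ->
  bounded_seq w U u -> bounded_seq w U v -> bounded_seq w U (fun n => u n - v n).
Proof.
move=> bU /bounded_seqP[K K0 uK] /bounded_seqP[M M0 vM]; apply/bounded_seqP.
have [C C0 hC] := @ellnormD_le R H I w w_gt0 +oo%E 1 p0 ltr01.
exists ((1 + 1) * K + C * M) => [|n].
  by rewrite addr_ge0 // mulr_ge0 // ltW.
by rewrite (analysisB bU); apply: hC => //; exact: ellnormN_le.
Qed.

Lemma eq_cvg_seq (f g : nat -> H) (l : H) : f =1 g ->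
  f n @[n --> \oo] --> l -> g n @[n --> \oo] --> l.
Proof. by move=> /funext ->. Qed.

Lemma cvg_seqB (f g : nat -> H) (l m : H) : f n @[n --> \oo] --> l ->
  g n @[n --> \oo] --> m -> f n - g n @[n --> \oo] --> l - m.
Proof. exact: cvgB. Qed.

Lemma limit_class_ooE U c u : (forall k, bounded_op (U k)) ->
  limit_class_oo U c u -> class_infty w U u = limit_class_oo U c.
Proof.
move=> bU [uc ub]; apply/seteqP; split=> v [h1 h2]; split.
- move=> k; have := cvg_seqB (uc k) (h1 k); rewrite subr0 => hk.
  apply: (eq_cvg_seq _ hk) => n.
  by rewrite (bopB _ _ (bU k)) opprB addrC subrK.
- have := bounded_seqB bU ub h2.
  by congr bounded_seq; apply/funext => n; rewrite opprB addrC subrK.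
- move=> k; have := cvg_seqB (uc k) (h1 k); rewrite subrr => hk.
  apply: (eq_cvg_seq _ hk) => n.
  by rewrite (bopB _ _ (bU k)).
- exact: bounded_seqB.
Qed.

Lemma coorbit_inftyP U f : (forall k, bounded_op (U k)) ->
  coorbit_infty w U f <-> exists2 c, limit_class_oo U c !=set0 & f = limit_class_oo U c.
Proof.
move=> bU; split=> [[u [uc ub ->]]|[c [u hu] ->]].
  exists (fun k => lim (U k (u n) @[n --> \oo])); first by exists u; split.
  by apply: limit_class_ooE => //; split.
exists u; split; last by rewrite (limit_class_ooE bU hu).
- by move=> k; apply/cvg_ex; exists (c k); exact: hu.1.
- exact: hu.2.
Qed.

Lemma limit_class_oo_ell U c u : limit_class_oo U c u -> ell +oo%E w c.
Proof.
move=> [uc /bounded_seqP[K K0 uK]]; apply: (elloo_le K0).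
exact: (ellnorm_fatou w_gt0 (u := fun n => analysis U (u n)) p0 K0 uK uc).
Qed.

(** Boundedness of [A] alone does not respect entrywise limits; dominated convergence in each row
    does. *)
Lemma limit_class_oo_map A U U' c u : AA A ->
  (forall x, analysis U' x = mxapp A (analysis U x)) ->
  limit_class_oo U c u -> limit_class_oo U' (mxapp A c) u.
Proof.
move=> hA hU [uc /bounded_seqP[K K0 uK]]; split.
  move=> k; have h := @mxapp_cvg A (fun n => analysis U (u n)) c K k hA K0 uK uc.
  apply: (eq_cvg_seq _ h) => n.
  by rewrite -[RHS]/(analysis U' (u n) k) hU.
have [C C0 hC] := mx_acts_bound p0 (acts hA).
apply/bounded_seqP; exists (C * K) => [|n]; first exact: mulr_ge0.
by rewrite hU; apply: hC => //; exact: elloo_le (uK n).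
Qed.

Lemma limit_class_oo_unique U c d u :
  limit_class_oo U c u -> limit_class_oo U d u -> c = d.
Proof.
move=> [uc _] [ud _]; apply/funext => k; exact: cvg_hnorm_unique (uc k) (ud k).
Qed.

Lemma limit_class_oo_dual c u : limit_class_oo Td c u ->
  limit_class_oo Td c = limit_class_oo T (mxapp G c).
Proof.
have toT := limit_class_oo_map AG (fun x => esym (mxapp_gram_id gT x)).
have toTd := limit_class_oo_map AG2 (fun x => esym (mxapp_gram_inv2 gT x)).
move=> hu; apply/seteqP; split=> v; first exact: toT.
by move/toTd; rewrite -(limit_class_oo_unique hu (toTd _ _ (toT _ _ hu))).
Qed.

Lemma limit_class_oo_inv c u : limit_class_oo Td c u -> c = mxapp G1 c.
Proof.
move=> hu; apply: (limit_class_oo_unique hu).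
exact: limit_class_oo_map AG1 (fun x => esym (mxapp_gram_inv gT x)) hu.
Qed.

Lemma limit_class_oo_inv2 c u : limit_class_oo Td c u -> c = mxapp G2 (mxapp G c).
Proof.
move=> hu; apply: (limit_class_oo_unique hu).
apply: limit_class_oo_map AG2 (fun x => esym (mxapp_gram_inv2 gT x)) _.
exact: limit_class_oo_map AG (fun x => esym (mxapp_gram_id gT x)) hu.
Qed.

Lemma coorbit_infty_swap : coorbit_infty w Td = coorbit_infty w T.
Proof.
apply/seteqP; split=> f.
  move/(coorbit_inftyP _ bTd) => [c [u hu] ->]; apply/(coorbit_inftyP _ bT).
  have e := limit_class_oo_dual hu.
  by exists (mxapp G c) => //; exists u; rewrite -e.
move/(coorbit_inftyP _ bT) => [d [u hu] ->]; apply/(coorbit_inftyP _ bTd).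
have hu2 := limit_class_oo_map AG2 (fun x => esym (mxapp_gram_inv2 gT x)) hu.
exists (mxapp G2 d); first by exists u.
have e := limit_class_oo_dual hu2; rewrite e.
by congr limit_class_oo; apply: (limit_class_oo_unique hu); rewrite -e.
Qed.

Lemma limit_class_oo_ext U c u : limit_class_oo U c u ->
  (fun k => ext (U k) (limit_class_oo U c)) = c.
Proof.
by move=> hu; apply/funext => k; apply: (ext_eq hu) => v [vc _]; exact: vc.
Qed.

(** Pairing with an element of [H00 U] sees only finitely many coefficients, so entrywise
    convergence implies weak convergence against [H00 U]. *)
Lemma inner_synthesis_fin U c : (forall k, bounded_op (U k)) -> ell00 c ->
  exists F : {fset I}, forall x,
    inner x (synthesis U c) = \sum_(k <- F) inner (U k x) (c k) :> R[i].
Proof.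
move=> bU /ell00P[F c0]; exists F => x'.
rewrite /synthesis (usum_fin (F := F)); last first.
  by move=> k /c0 ->; exact: bop0 (adj_bounded_op (bU k)).
elim/big_ind2 : _ => [|a b a' b' <- <-|k _]; first by rewrite inner0r.
  by rewrite innerDr.
by rewrite adjP.
Qed.

Lemma inner_cvg (v : nat -> H) x y : v n @[n --> \oo] --> x ->
  (inner (v n) y : R[i]^o) @[n --> \oo] --> (inner x y : R[i]^o).
Proof.
move=> /cvg_hnormP h; apply: cvg_cabsP => e e0.
have y1 : 0 < hnorm y + 1 by rewrite ltr_wpDl // hnorm_ge0.
have e1 : 0 < e / (hnorm y + 1) by rewrite divr_gt0.
apply: filterS (h _ e1) => n hn; rewrite -innerBl.
apply: le_lt_trans (inner_le _ _) _.
have : hnorm (x - v n) * (hnorm y + 1) < e by rewrite -ltr_pdivlMr.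
by apply: le_lt_trans; rewrite ler_wpM2l ?hnorm_ge0 // lerDl.
Qed.

(** Truncations of [d] along an exhausting sequence are uniformly bounded and converge entrywise, so
    the partial sums represent the class. All its representatives share their entrywise limits,
    hence their limits against [H00 Td]. *)
Lemma ucvg_limit_class_oo A d c u h : AA A -> ell +oo%E w d -> c = mxapp A d ->
  (forall k l, Td l (h k) = A l k (d k)) -> limit_class_oo Td c u ->
  ucvg_infty Td h (limit_class_oo Td c).
Proof.
move=> hA ed cE hh hu F [Fmono Fex].
have sumE n := analysis_partial_sum spA gT (F n) hA hh.
have [M M0 dM] := ell_fin p0 ed.
have tM n : (ellnorm +oo%E w (trunc d (F n)) <= M%:E)%E.
  rewrite -[M]mul1r; apply: (ellnorm_mono w_gt0 _ _ _ _ dM) => // k.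
  by rewrite mul1r /trunc; case: ifP => // _; rewrite hnorm0 hnorm_ge0.
have tc l : trunc d (F n) l @[n --> \oo] --> d l.
  have [N lN] := Fex l; have Nn n : (N <= n)%N -> l \in F n.
    move=> /subnK <-; elim: (n - N)%N => //= m IH.
    by rewrite addSn; exact: (fsubsetP (Fmono _)).
  apply/cvg_hnormP => e e0; exists N => // n /= /Nn ln.
  by rewrite /trunc ln subrr hnorm0.
have fF : limit_class_oo Td c (fun n => summability.partial_sum h (F n)).
  split=> [k|].
    have := @mxapp_cvg A (fun n => trunc d (F n)) d M k hA M0 tM tc; rewrite -cE => hk.
  apply: (eq_cvg_seq _ hk) => n.
    by rewrite -[RHS]/(analysis Td (summability.partial_sum h (F n)) k) sumE.
  have [C C0 hC] := mx_acts_bound p0 (acts hA).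
  apply/bounded_seqP; exists (C * M) => [|n]; first exact: mulr_ge0.
  by rewrite sumE; apply: hC => //; exact: elloo_le (tM n).
split=> // g v [b fb <-] fv.
have [E hE] := inner_synthesis_fin bTd fb.
have lim v' : limit_class_oo Td c v' ->
    (inner (v' n) (synthesis Td b) : R[i]^o) @[n --> \oo] -->
    (\sum_(k <- E) inner (c k) (b k) : R[i]^o).
  move=> [vc _]; have -> : (fun n => inner (v' n) (synthesis Td b) : R[i]^o) =
      (fun n => \sum_(k <- E) (inner (Td k (v' n)) (b k) : R[i]^o)).
    by apply/funext => n; rewrite hE.
  apply: cvg_big => [|k _]; first exact: add_continuous.
  exact: inner_cvg.
exists (\sum_(k <- E) inner (c k) (b k)); split; exact: lim.
Qed.

End CoorbitInfty.

(** * Equality of the coorbit spaces and the expansions *)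

Section CoorbitEquality.
Context {R : realType} {H : hilbertType R} {I : choiceType}.
Variables (AA : set (I -> I -> H -> H)) (nA : (I -> I -> H -> H) -> R).
Variables (T : I -> H -> H) (w : I -> R) (p0 : R) (p : \bar R).
Hypothesis spA : spectral_algebra AA nA.
Hypothesis gT : gframe T.
Hypothesis locT : localized AA T T.
Hypothesis w_gt0 : forall k, 0 < w k.
Hypothesis p0_gt0 : 0 < p0.
Hypothesis adm : admissible AA p0 w.
Hypothesis hp : (p0%:E < p)%E \/ p = 0%E \/ p = 1%E.
Local Notation Td := (dual T).
Local Notation G := (gram T id).
Local Notation G1 := (gram T (frame_inv T)).
Local Notation G2 := (gram T (frame_inv T \o frame_inv T)).
Implicit Types (c : I -> H) (u : nat -> H) (f : set (nat -> H)).

Let AG : AA G := AA_gram_id locT.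
Let AG1 : AA G1 := AA_gram_inv spA gT locT.
Let AG2 : AA G2 := AA_gram_inv2 spA gT locT.

Lemma admissible_ge0 : (0 <= p)%E.
Proof.
by case: hp => [h|[->|->]]; rewrite ?lee_fin // ltW // (lt_trans _ h) // lte_fin.
Qed.

Lemma admissible_acts A : AA A -> mx_acts p w A.
Proof.
move=> hA; case: hp => [h|[->|->]]; [by apply: (adm hA); left| |by apply: (adm hA); right].
(* Admissibility does not mention the exponent 0; boundedness there comes from the exponents oo and
   1. *)
by apply: mx_acts0 => //; apply: (adm hA); [left; rewrite ltry|right].
Qed.

Let pge0 := admissible_ge0.
Let acts := admissible_acts.

(** Interface common to p < oo and p = oo: a single sequence [c] carries the norms, the extended
    coefficients and the convergence criterion for [f]. *)
Lemma coorbit_class f : coorbit p w Td T f -> exists c, [/\ ell p w c,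
  c = mxapp G1 c /\ c = mxapp G2 (mxapp G c),
  (fun k => ext (Td k) f) = c /\ (fun k => ext (T k) f) = mxapp G c,
  coorbit_norm p w Td f = ellnorm p w c /\
    coorbit_norm p w T f = ellnorm p w (mxapp G c)
  & forall A d h, AA A -> ell p w d -> c = mxapp A d ->
      (forall k l, Td l (h k) = A l k (d k)) -> ucvg p w Td h f].
Proof.
rewrite /coorbit /ucvg; case: ifPn => [/eqP pE|poo].
  have actsoo A : AA A -> mx_acts +oo%E w A by rewrite -pE; exact: acts.
  rewrite pE; move/(coorbit_inftyP w_gt0 _ (dual_bounded_op gT)).
  move=> [c [u hu] ->]; exists c.
  have e1 := limit_class_oo_ext hu.
  have hT := limit_class_oo_dual spA gT locT w_gt0 actsoo hu.
  have e2 : (fun k => ext (T k) (limit_class_oo w Td c)) = mxapp G c.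
    by rewrite hT; apply: (@limit_class_oo_ext _ _ _ w T _ u); rewrite -hT.
  split.
  - exact (limit_class_oo_ell w_gt0 hu).
  - split; first exact (limit_class_oo_inv spA gT locT w_gt0 actsoo hu).
    exact (limit_class_oo_inv2 spA gT locT w_gt0 actsoo hu).
  - by [].
  - by rewrite /coorbit_norm eqxx e1 e2.
  - move=> A d h hA ed cE hh.
    exact (ucvg_limit_class_oo spA gT w_gt0 actsoo hA ed cE hh hu).
move/(coorbit_finP spA gT locT w_gt0 pge0 acts poo) => [c [ec [u hu] ->]]; exists c.
have [uV uc] := hu; have e2 := limit_class_ext_swap spA gT locT w_gt0 pge0 acts ec hu.
split=> //.
- split; first exact (ell_cvg_analysis_inv spA gT locT w_gt0 pge0 acts uV ec uc).
  apply: (ell_cvg_unique w_gt0 pge0 uc).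
  apply: (ell_cvg_analysis_dual spA gT locT w_gt0 pge0 acts).
  + by rewrite -(V_dual spA gT locT acts).
  + exact: mx_acts_ell (acts AG) ec.
  + exact (ell_cvg_analysis gT locT w_gt0 pge0 acts uV ec uc).
- by split=> //; exact (limit_class_ext w_gt0 pge0 hu).
- split; first exact (limit_class_norm w_gt0 pge0 poo ec hu).
  exact (limit_class_norm_swap spA gT locT w_gt0 pge0 acts poo ec hu).
- move=> A d h hA ed cE hh.
  exact (ucvg_limit_class spA gT w_gt0 pge0 acts poo hA ed cE hh hu).
Qed.

Lemma coorbit_dual_eq : coorbit_eq p w Td T.
Proof.
split=> [poo|].
  split; first exact (V_dual spA gT locT acts).
  have [C C0 hC] := mx_acts_bound pge0 (acts AG).
  have [C' C'0 hC'] := mx_acts_bound pge0 (acts AG2).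
  apply: equiv_norm_of_bounds.
  - by move=> x _; split; exact: ellnorm_ge0.
  - exists C => // x M xV M0; rewrite /Vnorm -(mxapp_gram_id gT); exact: hC.
  - exists C' => // x M; rewrite (V_dual spA gT locT acts) => xV M0.
    by rewrite /Vnorm -(mxapp_gram_inv2 gT); exact: hC'.
  - by move=> x /(ell_fin pge0)[M _ /le_lt_trans]; apply; rewrite ltry.
split.
  rewrite /coorbit; case: ifPn => [/eqP pE|poo].
    have actsoo A : AA A -> mx_acts +oo%E w A by rewrite -pE; exact: acts.
    exact (coorbit_infty_swap spA gT locT w_gt0 actsoo).
  have finP := coorbit_finP spA gT locT w_gt0 pge0 acts poo.
  have swapP := coorbit_fin_swapP spA gT locT w_gt0 pge0 acts poo.
  by apply/seteqP; split=> f; [move/finP/swapP|move/swapP/finP].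
have [C C0 hC] := mx_acts_bound pge0 (acts AG).
have [C' C'0 hC'] := mx_acts_bound pge0 (acts AG2).
apply: equiv_norm_of_bounds.
- by move=> f /coorbit_class[c [_ _ _ [-> ->] _]]; split; exact: ellnorm_ge0.
- exists C => // f M /coorbit_class[c [ec _ _ [-> ->] _]] M0; exact: hC.
- exists C' => // f M /coorbit_class[c [ec [_ e2] _ [-> ->] _]] M0 hM.
  by rewrite e2; apply: hC' => //; exact: mx_acts_ell (acts AG) ec.
- by move=> f /coorbit_class[c [/(ell_fin pge0)[M _ cM] _ _ [-> _] _]];
    apply: le_lt_trans cM _; rewrite ltry.
Qed.

(** The two series split c = G1 c and c = G2 (G c) into columns, where [c] and [G c] are the
    extended coefficients of [f] in the dual family and in [T]. *)
Lemma coorbit_expansion f : coorbit p w Td T f ->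
  ucvg p w Td (fun k => adj (T k) (ext (Td k) f)) f /\
  ucvg p w Td (fun k => frame_inv T (adj (T k) (ext (T k) f))) f.
Proof.
move=> /coorbit_class[c [ec [e1 e2] [x1 x2] _ hu]]; split.
  by apply: (hu _ _ _ AG1 ec e1) => k l; rewrite -[in RHS]x1.
apply: (hu _ _ _ AG2 _ e2) => [|k l]; first exact: mx_acts_ell (acts AG) ec.
by rewrite -[in RHS]x2.
Qed.

End CoorbitEquality.

Theorem corollary3p27 (R : realType) (H : hilbertType R) (d : nat)
    (X : set 'rV[R]_d) (AA : set (X -> X -> H -> H))
    (nA : (X -> X -> H -> H) -> R) (p0 : R) (w : 'rV[R]_d -> R)
    (T : X -> H -> H) (p : \bar R) :
  separable H -> countable X -> spectral_algebra AA nA ->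
  0 < p0 -> p0 <= 1 ->
  weight w -> admissible AA p0 (fun k : X => w (val k)) ->
  gframe T -> localized AA T T ->
  (p0%:E < p)%E \/ p = 0%E \/ p = 1%E ->
  let wX := fun k : X => w (val k) in
  coorbit_eq p wX (dual T) T /\
  forall f, coorbit p wX (dual T) T f ->
    ucvg p wX (dual T) (fun k => adj (T k) (ext (dual T k) f)) f /\
    ucvg p wX (dual T) (fun k => frame_inv T (adj (T k) (ext (T k) f))) f.
Proof.
move=> _ _ spA p0_gt0 _ [_ w_gt0] adm gT locT hp wX.
have wX_gt0 k : 0 < wX k by exact: w_gt0.
split; first exact (coorbit_dual_eq spA gT locT wX_gt0 p0_gt0 adm hp).
exact (coorbit_expansion spA gT locT wX_gt0 p0_gt0 adm hp).
Qed.
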